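(* Let $C\subset\mathbb{P}^2$ be a rational curve of degree $d$, and let $k$ be an integer with $2\le 2k\le d$. The splitting type of $C$ is $(k,d-k)$ if and only if there is a rational curve $\mathcal{D}\subset\mathbb{P}^{k+1}$ of degree $d$ which is contained in a rational normal surface (scroll) $S_{h,k-h}\subseteq\mathbb{P}^{k+1}$, with $2h\le k$, such that $C$ is the projection of $\mathcal{D}$ from $k-1$ points outside $S_{h,k-h}$, and either (i) $h>0$, and $S_{h,k-h}$ and $\mathcal{D}$ are smooth (and $C$ is not Ascenzi); or (ii) $h=0$, $S_{0,k}$ is a cone, $\mathcal{D}$ passes through the vertex $V$ of the cone with multiplicity $d-k$, and $V$ is the only singular point of $\mathcal{D}$ (this includes the case $k=1$, $S_{0,1}=\mathbb{P}^2$, for which $C=\mathcal{D}$); in this case $C$ is Ascenzi. Moreover, the curve $\mathcal{D}$ and the scroll $S_{h,k-h}$ whose existence is asserted are such that $\mathcal{D}$ is unisecant to the fibers of $S_{h,k-h}$, and $h$ is the degree of a syzygy of minimal degree for a syzygy of minimal degree $k$ of $C$; that is, if $C$ is parameterized by $(f_0,f_1,f_2)$ and $(\alpha_0,\alpha_1,\alpha_2)$ is a nonzero syzygy of minimal degree $k$ of $(f_0,f_1,f_2)$, then $h$ is the minimal degree of a nonzero syzygy of $(\alpha_0,\alpha_1,\alpha_2)$.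
   Context: The ground field $K$ is algebraically closed of characteristic $0$, and $S=K[s,t]$ is the graded polynomial ring. Rational plane curve and parameterization: a rational curve $C\subset\mathbb{P}^2$ of degree $d$ is given as the image of a morphism $f=(f_0,f_1,f_2):\mathbb{P}^1\to\mathbb{P}^2$, $f_i\in K[s,t]_d$ without common zeros, which is generically injective and generically smooth over its image; one says $C$ is parameterized by $(f_0,f_1,f_2)$. Syzygies: a syzygy of degree $n$ of a triple $(g_0,g_1,g_2)$ of forms of the same degree in $K[s,t]$ is a triple $(A_0,A_1,A_2)$ with $A_i\in K[s,t]_n$ and $A_0g_0+A_1g_1+A_2g_2=0$. Splitting type: the splitting type of $C$ is the pair $(k,d-k)$, $2k\le d$, such that the minimal graded free resolution of the ideal $J=(f_0,f_1,f_2)$ is $0\to S(-k-d)\oplus S(k-2d)\to S(-d)^{\oplus 3}\to J\to 0$. Equivalently, the module of syzygies of $(f_0,f_1,f_2)$ is free with generators of degrees $k$ and $d-k$. Ascenzi: a rational plane curve $C$ of degree $d$ is Ascenzi if it has a point of multiplicity $m$ with $2m+1\ge d$. Scrolls: for $0\le h\le k-h$, $k\geq 1$, the rational normal scroll $S_{h,k-h}\subseteq\mathbb{P}^{k+1}$ is the surface of degree $k$ which is the union of the lines (the fibers) joining corresponding points of two rational normal curves of degrees $h$ and $k-h$, both parameterized by the same $\mathbb{P}^1$ and lying in complementary linear subspaces $\mathbb{P}^h$ and $\mathbb{P}^{k-h}$ of $\mathbb{P}^{k+1}$. For $h=0$ the first curve is a point $V$ and $S_{0,k}$ is the cone with vertex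 $V$ over a rational normal curve of degree $k$ (and $S_{0,1}=\mathbb{P}^2$). A curve is unisecant to the fibers of a scroll if it meets the general fiber in exactly one point outside the vertex (in the smooth case: it has intersection number $1$ with the fibers). Projection from $k-1$ points of $\mathbb{P}^{k+1}$ means linear projection to $\mathbb{P}^2$ with center the $(k-2)$-dimensional linear span of the points (for $k=1$ it is the identity of $\mathbb{P}^2$).
   Formalization: “C is not Ascenzi” in (i) is dropped if d=2k+1; the span of the k−1 points, not just the points, avoids S; D unisecant is required in (i); V must be singular only if d−k>1; if d=2k, h comes from some minimal syzygy, not every one, and each such syzygy is realized. *)

(* Defs.v *)
From mathcomp Require Import all_boot all_order all_algebra.
From mathcomp Require Import mpoly.

Set Implicit Arguments.
Unset Strict Implicit.
Unset Printing Implicit Defensive.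

Import GRing.Theory.
Local Open Scope ring_scope.

Section Defs.
Variable K : closedFieldType.

(* A point of P^n is a nonzero row vector of length n.+1, and two nonzero row
   vectors p, q are the same point iff (p == q)%MS. *)
Definition pset (n : nat) := 'rV[K]_n.+1 -> Prop.

(* "For all but finitely many points of P^1". *)
Definition generic (P : 'rV[K]_2 -> Prop) : Prop :=
  exists Z : seq 'rV[K]_2, forall x, x != 0 ->
    (forall z, z \in Z -> ~~ (x == z)%MS) -> P x.

(* K[s,t] is {mpoly K[2]}; a row of n.+1 forms of the same degree is a
   (rational) map from P^1 to P^n. *)
Definition ev n (phi : 'rV[{mpoly K[2]}]_n) (x : 'rV[K]_2) : 'rV[K]_n :=
  map_mx (meval (x 0)) phi.

Definition jac n (phi : 'rV[{mpoly K[2]}]_n) (x : 'rV[K]_2) : 'M[K]_(2, n) :=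
  \matrix_(i, j) ((phi 0 j)^`M(i)).@[x 0].

(* phi parameterizes a rational curve of degree d in P^n. In the last clause,
   over a point x of P^1 the row space of the Jacobian matrix is the cone over
   the projective tangent line of the branch at x, provided that its rank is
   2, i.e. that the differential of phi at x is nonzero (characteristic 0). *)
Definition rational_param n (d : nat) (phi : 'rV[{mpoly K[2]}]_n.+1) : Prop :=
  [/\ forall i, phi 0 i \is d.-homog,
      forall x, x != 0 -> ev phi x != 0,
      generic (fun x => forall y, y != 0 -> (ev phi y == ev phi x)%MS ->
                                  (y == x)%MS)
    & generic (fun x => \rank (jac phi x) = 2%N)].

Definition curve n (phi : 'rV[{mpoly K[2]}]_n.+1) : pset n :=
  fun p => p != 0 /\ exists2 x, x != 0 & (p == ev phi x)%MS.

(* v lies in the cone over the projective Zariski tangent space of X at p,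
   which is cut out by the differentials at p of the forms vanishing on X. *)
Definition tangent n (X : pset n) (p v : 'rV[K]_n.+1) : Prop :=
  forall (e : nat) (F : {mpoly K[n.+1]}), F \is e.-homog ->
    (forall q, X q -> F.@[q 0] = 0) ->
    \sum_i (F^`M(i)).@[p 0] * v 0 i = 0.

(* Smoothness of an r-dimensional X at p: the projective tangent space has
   dimension r. *)
Definition smooth_at n (r : nat) (X : pset n) (p : 'rV[K]_n.+1) : Prop :=
  exists2 W : 'M[K]_(r.+1, n.+1), row_free W &
    forall v, tangent X p v <-> (v <= W)%MS.

Definition smooth n (r : nat) (X : pset n) : Prop :=
  forall p, X p -> smooth_at r X p.

(* m is the intersection multiplicity at p of the curve parameterized by phi
   with the hyperplane l: the degree of the part over p of the divisor of
   zeros of l o phi on P^1. *)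
Definition hyperplane_mult n (phi : 'rV[{mpoly K[2]}]_n.+1)
    (p : 'rV[K]_n.+1) (l : 'cV[K]_n.+1) (m : nat) : Prop :=
  exists G H : {mpoly K[2]},
    [/\ (phi *m map_mx (@mpolyC 2 K) l) 0 0 = G * H,
        G \is m.-homog,
        forall x : 'rV[K]_2, x != 0 -> G.@[x 0] = 0 -> (ev phi x == p)%MS
      & forall x : 'rV[K]_2, x != 0 -> (ev phi x == p)%MS -> H.@[x 0] != 0].

(* The multiplicity of a curve at p is its intersection multiplicity at p with
   a general hyperplane through p, i.e. the least one. *)
Definition mult_at n (phi : 'rV[{mpoly K[2]}]_n.+1) (p : 'rV[K]_n.+1)
    (m : nat) : Prop :=
  (exists l, [/\ l != 0, p *m l = 0 & hyperplane_mult phi p l m]) /\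
  (forall l m', l != 0 -> p *m l = 0 -> hyperplane_mult phi p l m' ->
     (m <= m')%N).

Definition ascenzi (d : nat) (f : 'rV[{mpoly K[2]}]_3) : Prop :=
  exists p m, [/\ @curve 2 f p, @mult_at 2 f p m & (d <= 2 * m + 1)%N].

Definition syzygy (n : nat) (A g : 'rV[{mpoly K[2]}]_3) : Prop :=
  (forall i, A 0 i \is n.-homog) /\ A *m g^T = 0.

Definition min_syzygy_degree (n : nat) (g : 'rV[{mpoly K[2]}]_3) : Prop :=
  (exists2 A, A != 0 & syzygy n A g) /\
  (forall m A, A != 0 -> syzygy m A g -> (n <= m)%N).

(* The module of all syzygies of f is free on a basis of degrees k and l. *)
Definition splitting_type (f : 'rV[{mpoly K[2]}]_3) (k l : nat) : Prop :=
  exists a b, [/\ syzygy k a f, syzygy l b f &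
    forall A, A *m f^T = 0 ->
      exists! c : {mpoly K[2]} * {mpoly K[2]}, A = c.1 *: a + c.2 *: b].

(* The rational normal curve of degree h in standard coordinates. *)
Definition veronese (h : nat) (x : 'rV[K]_2) : 'rV[K]_h.+1 :=
  \row_(i < h.+1) (x 0 0 ^+ (h - i) * x 0 1 ^+ i).

Section Scroll.
Variables k h : nat.

(* A scroll S_{h,k-h} in P^{k+1} is given by two rational normal curves
   x |-> veronese h x *m G1 and x |-> veronese (k - h) x *m G2, the row spaces
   of G1 and G2 being complementary: for h <= k, the h.+1 + (k - h).+1 = k.+2
   rows of G1 and G2 form a basis. *)
Definition scroll_frame (G1 : 'M[K]_(h.+1, k.+2))
    (G2 : 'M[K]_((k - h).+1, k.+2)) : Prop :=
  row_free (col_mx G1 G2).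

Variables (G1 : 'M[K]_(h.+1, k.+2)) (G2 : 'M[K]_((k - h).+1, k.+2)).

Definition fiber (x : 'rV[K]_2) : pset k.+1 :=
  fun p => p != 0 /\
    (p <= veronese h x *m G1 + veronese (k - h) x *m G2)%MS.

Definition scroll : pset k.+1 :=
  fun p => exists2 x, x != 0 & fiber x p.

(* The vertex when h = 0, in which case G1 has a single row. *)
Definition vertex : 'rV[K]_k.+2 := row 0 G1.

Definition unisecant (D : pset k.+1) : Prop :=
  generic (fun x => exists2 p : 'rV[K]_k.+2, p != 0 &
    forall q, [/\ D q, fiber x q & ~ (h = 0%N /\ (q == vertex)%MS)] <->
              q != 0 /\ (q == p)%MS).

End Scroll.

(* C is the image of D under the linear projection p |-> p *m M, whose center
   is spanned by the k - 1 points given by the rows of Q; not only these points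
   but their span is disjoint from S (a fiber met by the center is contracted,
   which yields a syzygy of degree < k of C). For k = 1 the projection is
   the identity of P^2. *)
Definition is_projection (k : nat) (Q : 'M[K]_(k.-1, k.+2))
    (M : 'M[K]_(k.+2, 3)) (S D : pset k.+1) (C : pset 2) : Prop :=
  [/\ row_free Q, (kermx M == Q)%MS,
      forall p, S p -> ~~ (p <= Q)%MS,
      k = 1%N -> forall i j, M i j = (i == j :> nat)%:R
    & forall p, C p <-> p != 0 /\ exists2 q, D q & (p == q *m M)%MS].

Section Model.
Variables (d k : nat) (f : 'rV[{mpoly K[2]}]_3) (h : nat).
Variables (G1 : 'M[K]_(h.+1, k.+2)) (G2 : 'M[K]_((k - h).+1, k.+2)).
Variable phi : 'rV[{mpoly K[2]}]_k.+2.
Variables (Q : 'M[K]_(k.-1, k.+2)) (M : 'M[K]_(k.+2, 3)).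

Let S := scroll G1 G2.
Let D : pset k.+1 := @curve k.+1 phi.

Definition on_scroll : Prop :=
  [/\ (2 * h <= k)%N, scroll_frame G1 G2, @rational_param k.+1 d phi,
      forall p, D p -> S p
    & is_projection Q M S D (@curve 2 f)].

(* Unisecance belongs to what is asserted to exist, and the converse is false
   without it: for k = 4, a smooth rational curve of bidegree (5, 1) on
   S_{2,2} = P^1 x P^1, of degree 11 and meeting the fibers in 5 points, has a
   general projection to P^2 whose splitting type is (5, 6) and not (4, 7). In
   the cone case unisecance is a consequence of the multiplicity of the
   vertex. *)
Definition smooth_case : Prop :=
  [/\ (0 < h)%N, smooth 2 S, smooth 1 D & unisecant G1 G2 D].

(* For d - k = 1, i.e. d = 2 and k = 1, the vertex is a smooth point of the
   conic D, hence the restriction in the last clause. *)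
Definition cone_case : Prop :=
  [/\ h = 0%N, @mult_at k.+1 phi (vertex G1) (d - k),
      forall p, D p -> ~~ (p == vertex G1)%MS -> smooth_at 1 D p
    & (1 < d - k)%N -> ~ smooth_at 1 D (vertex G1)].

End Model.
End Defs.

(* Main.v *)
Require Import Defs.
From HB Require Import structures.
From mathcomp Require Import all_boot all_order all_algebra.
From mathcomp Require Import mpoly.
From mathcomp Require Import ring zify.
From Stdlib Require Import Classical.

(** A syzygy alpha of degree k of f is a line moving with the point f(x) and
    passing through it. When k is minimal, alpha has no zeros, and in the dual
    plane it is a curve with syzygies of its own: let b be one of minimal degree
    h. A dimension count gives a second one, c, of degree k - h, with
    b x c = alpha ([complementary_syzygy], a form of the Hilbert-Burch theorem
    for triples of binary forms). Thus b(x) and c(x) are points moving on the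
    line alpha(x) and spanning it, and f, which lies on that line, is
    f = B b + C c for forms B and C of degrees d - h and d - (k - h).

    Now b and c are projections of the rational normal curves of degrees h and
    k - h. Lifting both to complementary subspaces of P^{k+1} makes the moving
    line a fiber of S_{h,k-h}, and f the projection of the curve D given by
    phi = (B ver_h, C ver_{k-h}), where ver_m is the Veronese map
    ([model_of_syzygy]). The center is disjoint from the scroll because b and c
    are independent at each point. By construction D meets a general fiber in
    phi(x) only.

    Tangent spaces are computed from both sides: polynomial arcs give tangent
    vectors, equations give bounds. The 2 x 2 minors cutting out the scroll
    determine a tangent vector up to the fiber and one transversal direction
    ([tangent_deviation], [smooth_scroll]), and D has an equation which is of
    degree 1 along the fibers ([smooth_curve_at]). For h = 0 the zeros of C are
    the branches of D at the vertex, whose multiplicity is deg C = d - k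
    ([multiplicity_over]), and the tangent space there contains a hyperplane
    ([singular_vertex]).

    Conversely, let C be the projection of a curve D on a scroll. The fiber
    through phi(x) depends on x through a map tau of P^1, and
    phi = (B ver_h(tau), C ver_{k-h}(tau)) ([fiber_map]). The degree of tau is 1:
    in characteristic 0 a general fiber meets D in deg tau points
    ([unisecant_degree]), and on a cone the multiplicity of the vertex is
    d - k deg tau ([cone_degree]). The projection of D has the same image as f,
    hence is f up to a linear change of parameter ([reparametrization]): f is
    injective and immersive at a general point, so that the parameter of f is a
    rational function of that of D. The projections b and c of the two
    directrices are independent at each point, the center being disjoint from
    the fibers, and again f = B b + C c ([directrices_of_model]). Then alpha =
    b x c is a syzygy of f without zeros, which is part of a basis of degrees k
    and d - k, and its own minimal syzygy is b, of degree h. For 2k < d it is the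
    only syzygy of degree k up to a constant.

    Finally, h = 0 means that b is a constant point p, through which all the
    lines alpha(x) pass, and f = B p + C c shows that p has multiplicity
    d - k >= d / 2. If conversely p is a point of multiplicity m with
    2m + 1 >= d, the lines joining p to f(x) give a syzygy of degree d - m having
    p as a constant syzygy, and for d <> 2k + 1 that degree has to be k
    ([ascenzi_syzygy]). *)

Set Implicit Arguments.
Unset Strict Implicit.
Unset Printing Implicit Defensive.

Import GRing.Theory.
Local Open Scope ring_scope.

(** * Points of projective space *)

Lemma ord2_case (i : 'I_2) : i = 0 \/ i = 1.
Proof. by case: i => [[|[|//]] H]; [left|right]; apply: val_inj. Qed.

Section Points.
Variable K : closedFieldType.
Implicit Types x y : 'rV[K]_2.

Lemma row2P (R : Type) (u v : 'rV[R]_2) :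
  u 0 0 = v 0 0 -> u 0 1 = v 0 1 -> u = v.
Proof.
by move=> e0 e1; apply/rowP=> i; case: (ord2_case i) => ->.
Qed.

Definition pt (a b : K) : 'rV[K]_2 := \row_i (if i == 0 then a else b).

Lemma pt0 a b : pt a b 0 0 = a. Proof. by rewrite mxE. Qed.
Lemma pt1 a b : pt a b 0 1 = b. Proof. by rewrite mxE. Qed.

Lemma row2_neq0 x : x != 0 -> x 0 0 != 0 \/ x 0 1 != 0.
Proof.
case: (eqVneq (x 0 0) 0) => [e0|]; last by left.
case: (eqVneq (x 0 1) 0) => [e1|]; last by right.
by case/eqP; apply: row2P; rewrite ?mxE.
Qed.

Lemma pt_neq0 a b : (a != 0) || (b != 0) -> pt a b != 0.
Proof.
by apply: contraTneq => e; rewrite -(pt0 a b) -{2}(pt1 a b) e !mxE eqxx.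
Qed.

Lemma sub_point n (p q : 'rV[K]_n) : p != 0 -> (p <= q)%MS ->
  exists2 c, c != 0 & p = c *: q.
Proof.
move=> p0 /sub_rVP[c e]; exists c => //.
by apply: contraNneq p0 => c0; rewrite e c0 scale0r.
Qed.

Lemma same_pointP n (p q : 'rV[K]_n) : p != 0 ->
  reflect (exists2 c, c != 0 & p = c *: q) (p == q)%MS.
Proof.
move=> p0; apply: (iffP idP) => [/andP[le _]|[c c0 ->]].
  exact: sub_point.
by apply/eqmxP; apply: eqmx_scale.
Qed.

Lemma same_point2 x y : x != 0 -> y != 0 ->
  (x == y)%MS = (x 0 0 * y 0 1 == x 0 1 * y 0 0).
Proof.
move=> x0 y0; apply/idP/idP => [/(same_pointP _ x0)[c _ ->]|/eqP e].
  by rewrite !mxE; apply/eqP; ring.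
apply/(same_pointP _ x0).
have [yn|yn] := row2_neq0 y0.
  have xn : x 0 0 != 0.
    apply: contraNneq x0 => x00; apply/eqP; apply: row2P; rewrite ?mxE //.
    apply/eqP; move: e; rewrite x00 mul0r => /esym/eqP.
    by rewrite mulf_eq0 (negPf yn) orbF.
  exists (x 0 0 / y 0 0); first by rewrite mulf_neq0 ?invr_eq0.
  apply: row2P; rewrite mxE; first by field.
  by apply: (mulIf yn); rewrite -e; field.
have xn : x 0 1 != 0.
  apply: contraNneq x0 => x00; apply/eqP; apply: row2P; rewrite ?mxE //.
  apply/eqP; move: e; rewrite x00 mul0r => /eqP.
  by rewrite mulf_eq0 (negPf yn) orbF.
exists (x 0 1 / y 0 1); first by rewrite mulf_neq0 ?invr_eq0.
apply: row2P; rewrite mxE; last by field.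
by apply: (mulIf yn); rewrite e; field.
Qed.

Lemma generic_and (P Q : 'rV[K]_2 -> Prop) :
  generic P -> generic Q -> generic (fun x => P x /\ Q x).
Proof.
move=> [Z HZ] [Z' HZ']; exists (Z ++ Z') => x x0 H; split.
  by apply: HZ => // z z_in; apply: H; rewrite mem_cat z_in.
by apply: HZ' => // z z_in; apply: H; rewrite mem_cat z_in orbT.
Qed.

Lemma generic_impl (P Q : 'rV[K]_2 -> Prop) :
  (forall x, x != 0 -> P x -> Q x) -> generic P -> generic Q.
Proof. by move=> PQ [Z HZ]; exists Z => x x0 /(HZ x x0); apply: PQ. Qed.

Lemma generic_ex (P : 'rV[K]_2 -> Prop) : generic P -> exists2 x, x != 0 & P x.
Proof.
move=> [Z HZ]; pose p := \prod_(z <- Z) ('X - (z 0 1 / z 0 0)%:P).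
have p0 : p != 0.
  by rewrite prodf_seq_neq0; apply/allP=> z _ /=; rewrite polyXsubC_eq0.
have [r rP] := closed_nonrootP p p0.
have x0 : pt 1 r != 0 by apply: pt_neq0; rewrite oner_eq0.
exists (pt 1 r) => //; apply: HZ => // z zZ.
apply: contra rP => /(same_pointP _ x0)[c c0 e].
have e0 : 1 = c * z 0 0 by rewrite -(pt0 1 r) e mxE.
have e1 : r = c * z 0 1 by rewrite -{1}(pt1 1 r) e mxE.
have z0 : z 0 0 != 0.
  by apply: contra_eq_neq e0 => ->; rewrite mulr0 oner_eq0.
rewrite /root horner_prod; apply/eqP.
apply/eqP; rewrite prodf_seq_eq0; apply/hasP; exists z => //=.
rewrite hornerXsubC e1 subr_eq0; apply/eqP.
rewrite mulrC; congr (_ * _); apply: (mulIf z0).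
by rewrite -e0 mulVf.
Qed.

End Points.

(** * Substituting into homogeneous polynomials *)

Section Substitution.
Variables (K : fieldType) (n : nat).
Implicit Types F G : {mpoly K[n]}.

Lemma mpoly_ind_ring (P : {mpoly K[n]} -> Prop) :
  (forall c, P c%:MP) -> (forall i, P 'X_i) ->
  (forall F G, P F -> P G -> P (F + G)) ->
  (forall F G, P F -> P G -> P (F * G)) -> forall F, P F.
Proof.
move=> PC PX PD PM; apply: mpolyind => [|c m F _ _ PF].
  by rewrite -mpolyC0.
apply: (PD) => //; rewrite -mul_mpolyC; apply: (PM) => //.
rewrite mpolyXE_id; apply: (big_ind P) => [||i _]; [by rewrite -mpolyC1 | exact: PM |].
elim: (m i) => [|e IH]; first by rewrite expr0 -mpolyC1.
by rewrite exprS; apply: (PM).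
Qed.

Variable R : comNzRingType.
Variable iota : {rmorphism K -> R}.

Lemma mmapXU (h : 'I_n -> R) i : mmap iota h 'X_i = h i.
Proof. by rewrite mmapX mmap1U. Qed.

Lemma eq_mmap (h h' : 'I_n -> R) F : h =1 h' -> mmap iota h F = mmap iota h' F.
Proof.
by move=> e; rewrite /mmap; apply: eq_bigr => m _; rewrite (mmap1_eq _ e).
Qed.

Lemma mmap_homog_scale e F (c : R) (h : 'I_n -> R) : F \is e.-homog ->
  mmap iota (fun i => c * h i) F = c ^+ e * mmap iota h F.
Proof.
move=> /dhomogP hF; rewrite /mmap mulr_sumr !big_seq; apply: eq_bigr => m mF.
have em : mdeg m = e := hF m mF.
rewrite mulrCA -em mdegE; congr (_ * _).
rewrite /mmap1 -prodrXr -big_split /=; apply: eq_bigr => i _.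
by rewrite exprMn.
Qed.

Lemma mmap_point F (a : 'I_n -> K) : mmap iota (fun i => iota (a i)) F = iota F.@[a].
Proof.
elim/mpoly_ind_ring: F => [c|i|F G E E'|F G E E'].
- by rewrite mmapC mevalC.
- by rewrite mmapXU mevalXU.
- by rewrite rmorphD mevalD rmorphD /= E E'.
- by rewrite rmorphM mevalM rmorphM /= E E'.
Qed.

(** First-order expansion over an extension of K, which serves for the arcs and
    for the forms restricted to a curve. *)
Lemma mmap_taylor F (c : R) (a w : 'I_n -> R) :
  exists r, mmap iota (fun i => a i + c * w i) F =
    mmap iota a F + c * (\sum_i mmap iota a F^`M(i) * w i) + c ^+ 2 * r.
Proof.
elim/mpoly_ind_ring: F => [b|j|F G [r e] [r' e']|F G [r e] [r' e']].
- exists 0; rewrite !mmapC big1 ?mulr0 ?addr0 // => i _.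
  by rewrite mderivC mmap0 mul0r.
- exists 0; rewrite !mmapXU mulr0 addr0 (bigD1 j) //= big1 ?addr0.
    rewrite mderivX mnm1E eqxx scale1r -{1}[U_(j)%MM]add0m addmK.
    by rewrite mpolyX0 rmorph1 mul1r.
  by move=> i ij; rewrite mderivX mnm1E eq_sym (negPf ij) scale0r mmap0 mul0r.
- exists (r + r'); rewrite !rmorphD /= e e'.
  under [X in _ = _ + c * X + _]eq_bigr => i _.
    rewrite mderivD rmorphD mulrDl; over.
  by rewrite big_split /=; ring.
set s := \sum_i _ in e; set s' := \sum_i _ in e'.
exists (r * mmap iota a G + r' * mmap iota a F + s * s' + c * (s * r' + r * s')
        + c ^+ 2 * r * r').
rewrite !rmorphM /= e e'.
have -> : \sum_i mmap iota a (F * G)^`M(i) * w i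
        = s * mmap iota a G + mmap iota a F * s'.
  rewrite mulr_suml mulr_sumr -big_split /=; apply: eq_bigr => i _.
  by rewrite mderivM rmorphD !rmorphM /=; ring.
ring.
Qed.

End Substitution.

Lemma horner_mmap (K : fieldType) n (P : 'I_n -> {poly K}) F c :
  (mmap polyC P F).[c] = F.@[fun i => (P i).[c]].
Proof.
elim/mpoly_ind_ring: F => [b|i|F G E E'|F G E E'].
- by rewrite mmapC /= hornerC mevalC.
- by rewrite mmapXU mevalXU.
- by rewrite rmorphD hornerD mevalD /= E E'.
- by rewrite rmorphM hornerM mevalM /= E E'.
Qed.

(** * Binary forms *)

Section BinaryForms.
Variable K : closedFieldType.
Local Notation S := {mpoly K[2]}.
Implicit Types (P Q : S) (p q : {poly K}) (x y : 'rV[K]_2).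

Lemma dhomogC (n : nat) c : (c%:MP : {mpoly K[n]}) \is 0.-homog.
Proof. by rewrite -[c%:MP]mulr1 mul_mpolyC; apply/dhomogZ/dhomog1. Qed.

Lemma dhomogXU (n : nat) i : ('X_i : {mpoly K[n]}) \is 1.-homog.
Proof. by rewrite dhomogX /= mdeg1. Qed.

Lemma dhomogXn (n : nat) i e : ('X_i ^+ e : {mpoly K[n]}) \is e.-homog.
Proof. by have := dhomogMn e (dhomogXU i); rewrite mul1n. Qed.

Lemma meval_scale n e (F : {mpoly K[n]}) c (v : 'rV[K]_n) : F \is e.-homog ->
  F.@[(c *: v) 0] = c ^+ e * F.@[v 0].
Proof.
move=> hF; rewrite -(mmap_homog_scale idfun c (v 0) hF).
by apply: eq_mmap => i; rewrite mxE.
Qed.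

Definition dehom P : {poly K} :=
  mmap polyC (fun i : 'I_2 => if i == 0 then 1 else 'X) P.

Definition homogenize (n : nat) p : S :=
  \sum_(i < n.+1) p`_i *: ('X_0 ^+ (n - i) * 'X_1 ^+ i).

Lemma hom_homog n p : homogenize n p \is n.-homog.
Proof.
apply: rpred_sum => i _; apply: rpredZ.
have := dhomogM (dhomogXn 0 (n - i)) (dhomogXn 1 i).
rewrite subnK; first exact.
by rewrite -ltnS.
Qed.

Fact hom_is_linear n : linear (homogenize n).
Proof.
move=> c p q; rewrite /homogenize scaler_sumr -big_split /=; apply: eq_bigr => i _.
by rewrite coefD coefZ scalerDl scalerA.
Qed.
HB.instance Definition _ n :=
  GRing.isLinear.Build K {poly K} S _ (homogenize n) (hom_is_linear n).

HB.instance Definition _ := GRing.RMorphism.copy dehom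
  (mmap polyC (fun i : 'I_2 => if i == 0 then 1 else 'X)).

Lemma dehomX0 : dehom 'X_0 = 1. Proof. by rewrite /dehom mmapXU eqxx. Qed.
Lemma dehomX1 : dehom 'X_1 = 'X. Proof. by rewrite /dehom mmapXU. Qed.
Lemma dehomZ c P : dehom (c *: P) = c *: dehom P.
Proof. by rewrite /dehom mmapZ /= mul_polyC. Qed.

Lemma dehom_hom n p : (size p <= n.+1)%N -> dehom (homogenize n p) = p.
Proof.
move=> sp; rewrite /homogenize rmorph_sum /=.
under eq_bigr => i _ do
  rewrite dehomZ rmorphM !rmorphXn /= dehomX0 dehomX1 expr1n mul1r.
rewrite -poly_def; apply/polyP=> i; rewrite coef_poly.
by case: ltnP => // le; rewrite nth_default // (leq_trans sp).
Qed.

Lemma hom_dehom n P : P \is n.-homog -> homogenize n (dehom P) = P.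
Proof.
move=> /dhomogP hP; rewrite [in RHS](mpolyE P) {1}(mpolyE P) !rmorph_sum /=.
rewrite linear_sum /= !big_seq; apply: eq_bigr => m mP.
rewrite dehomZ linearZ /=; congr (_ *: _).
have dm : (m 0%R + m 1%R)%N = n.
  have <- : mdeg m = n := hP m mP.
  by rewrite mdegE !big_ord_recl big_ord0 addn0; congr (_ + m _)%N; apply: val_inj.
rewrite mpolyXE_id rmorph_prod /= !big_ord_recl !big_ord0 !mulr1.
have -> : lift 0 0 = 1 :> 'I_2 by apply: val_inj.
rewrite !rmorphXn /= dehomX0 dehomX1 expr1n mul1r.
have mn : (m 1%R < n.+1)%N by rewrite -dm ltnS leq_addl.
rewrite /homogenize (bigD1 (Ordinal mn)) //= coefXn eqxx scale1r -{1}dm addnK.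
rewrite big1 ?addr0 // => i ne; rewrite coefXn (_ : _ == _ = false) ?scale0r //.
by apply: contraNF ne => /eqP e; apply/eqP/val_inj.
Qed.

Lemma dehom_inj n P Q : P \is n.-homog -> Q \is n.-homog ->
  dehom P = dehom Q -> P = Q.
Proof. by move=> hP hQ e; rewrite -(hom_dehom hP) e hom_dehom. Qed.

Lemma size_dehom n P : P \is n.-homog -> (size (dehom P) <= n.+1)%N.
Proof.
move=> hP; rewrite -(hom_dehom hP) /homogenize rmorph_sum /=.
apply: (leq_trans (size_sum _ _ _)); apply/bigmax_leqP => i _.
rewrite dehomZ rmorphM !rmorphXn /= dehomX0 dehomX1 expr1n mul1r.
by apply: (leq_trans (size_scale_leq _ _)); rewrite size_polyXn ltnS leq_ord.
Qed.

Lemma meval_dehom P r : P.@[pt 1 r 0] = (dehom P).[r].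
Proof.
rewrite /dehom horner_mmap; apply: meval_eq => i.
by case: (ord2_case i) => ->; rewrite ?pt0 ?pt1 ?hornerC ?hornerX.
Qed.

Lemma meval_hom n p x :
  (homogenize n p).@[x 0] = \sum_(i < n.+1) p`_i * (x 0 0 ^+ (n - i) * x 0 1 ^+ i).
Proof.
rewrite rmorph_sum /=; apply: eq_bigr => i _.
by rewrite mevalZ rmorphM !rmorphXn /= !mevalXU.
Qed.

Lemma meval_infty n P : P \is n.-homog -> P.@[pt 0 1 0] = (dehom P)`_n.
Proof.
move=> hP; rewrite -{1}(hom_dehom hP) meval_hom (bigD1 ord_max) //=.
rewrite pt0 pt1 subnn expr0 expr1n !mulr1 big1 ?addr0 // => i ne.
rewrite expr0n subn_eq0 (_ : (n <= i)%N = false) ?mul0r ?mulr0 //.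
apply: contraNF ne => le; apply/eqP/val_inj => /=.
by apply/eqP; rewrite eqn_leq leq_ord.
Qed.

Lemma form_const P : P \is 0.-homog -> exists c, P = c%:MP.
Proof.
move=> hP; exists (dehom P)`_0; rewrite -[LHS](hom_dehom hP) /homogenize big_ord1.
by rewrite !expr0 mulr1 -mul_mpolyC mulr1.
Qed.

Lemma form_root n P : (0 < n)%N -> P \is n.-homog ->
  exists2 x : 'rV[K]_2, x != 0 & P.@[x 0] = 0.
Proof.
move=> n0 hP; have [e|ne] := eqVneq ((dehom P)`_n) 0.
  by exists (pt 0 1); rewrite ?(meval_infty hP) // pt_neq0 ?oner_eq0 ?orbT.
have sz : size (dehom P) = n.+1.
  apply/eqP; rewrite eqn_leq (size_dehom hP) /=.
  by rewrite ltnNge; apply: contra ne => /leq_sizeP->.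
have /closed_rootP[r rP] : size (dehom P) != 1 by rewrite sz; case: n n0 {hP ne sz}.
exists (pt 1 r); first by rewrite pt_neq0 ?oner_eq0.
by rewrite meval_dehom; apply/eqP.
Qed.

Lemma affine_point x : x 0 0 != 0 -> x = x 0 0 *: pt 1 (x 0 1 / x 0 0).
Proof. by move=> x0; apply: row2P; rewrite !mxE /=; field. Qed.

Lemma infty_point x : x 0 0 = 0 -> x = x 0 1 *: pt 0 1.
Proof. by move=> x0; apply: row2P; rewrite !mxE /= ?x0; ring. Qed.

Lemma generic_form n P : P \is n.-homog -> P != 0 ->
  generic (fun x => P.@[x 0] != 0).
Proof.
move=> hP P0; have p0 : dehom P != 0.
  apply: contra_neq P0 => e; apply: (dehom_inj hP); first exact: dhomog0.
  by rewrite e raddf0.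
have [rs Ers] := closed_field_poly_normal (dehom P).
exists (pt 0 1 :: [seq pt 1 r | r <- rs]) => x x0 H.
have [e|xn] := eqVneq (x 0 0) 0.
  have := H (pt 0 1) (mem_head _ _); rewrite same_point2 ?pt_neq0 ?oner_eq0 ?orbT //.
  by rewrite pt0 pt1 e mul0r mulr0 eqxx.
rewrite (affine_point xn) (meval_scale _ _ hP) mulf_neq0 ?expf_neq0 //.
rewrite meval_dehom; apply/negP; rewrite -/(root _ _).
rewrite Ers rootZ ?lead_coef_eq0 // root_prod_XsubC => rrs.
have := H (pt 1 (x 0 1 / x 0 0)); rewrite inE map_f ?orbT // => /(_ isT).
rewrite same_point2 ?pt_neq0 ?oner_eq0 // pt0 pt1 mulr1 mulrC divfK //.
by rewrite eqxx.
Qed.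

Lemma form_eq0 n P : P \is n.-homog -> generic (fun x => P.@[x 0] = 0) -> P = 0.
Proof.
move=> hP g0; apply/eqP; apply: contraT => P0.
have [x _ [e /eqP//]] := generic_ex (generic_and g0 (generic_form hP P0)).
Qed.

Lemma form_eq n P Q : P \is n.-homog -> Q \is n.-homog ->
  (forall x, x != 0 -> P.@[x 0] = Q.@[x 0]) -> P = Q.
Proof.
move=> hP hQ e; apply/eqP; rewrite -subr_eq0; apply/eqP.
apply: (@form_eq0 n); first exact: rpredB.
by exists [::] => x x0 _; rewrite mevalB e ?subrr.
Qed.

(** The linear form vanishing at x. *)
Definition line_form x : S := x 0 1 *: 'X_0 - x 0 0 *: 'X_1.

Lemma line_form_homog x : line_form x \is 1.-homog.
Proof. by rewrite rpredB // rpredZ // dhomogXU. Qed.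

Lemma meval_line_form x y :
  (line_form x).@[y 0] = x 0 1 * y 0 0 - x 0 0 * y 0 1.
Proof. by rewrite mevalB !mevalZ !mevalXU. Qed.

Lemma line_form_neq0 x : x != 0 -> line_form x != 0.
Proof.
move=> x0; apply/eqP => e.
have [xn|xn] := row2_neq0 x0; move/eqP: xn; apply.
  have := meval_line_form x (pt 0 1); rewrite e meval0 pt0 pt1.
  by rewrite mulr0 sub0r mulr1 => /esym/eqP; rewrite oppr_eq0 => /eqP.
have := meval_line_form x (pt 1 0); rewrite e meval0 pt0 pt1.
by rewrite mulr0 subr0 mulr1.
Qed.

(** On the affine line this is the factor theorem; a zero at infinity means that
    the dehomogenization has smaller degree. *)
Lemma form_factor n P x : P \is n.-homog -> x != 0 -> P.@[x 0] = 0 ->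
  exists2 Q, Q \is n.-1.-homog & P = line_form x * Q.
Proof.
case: n => [|n] hP x0.
  have [c ->] := form_const hP; rewrite mevalC => ->.
  by exists 0; rewrite ?dhomog0 // mulr0 mpolyC0.
have [e|xn] := eqVneq (x 0 0) 0.
  have x1 : x 0 1 != 0 by have [|//] := row2_neq0 x0; rewrite e eqxx.
  rewrite {1}(infty_point e) (meval_scale _ _ hP) (meval_infty hP) => /eqP.
  rewrite mulf_eq0 expf_eq0 (negPf x1) andbF /= => /eqP pn.
  have sz : (size (dehom P) <= n.+1)%N.
    rewrite -ltnS ltn_neqAle (size_dehom hP) andbT.
    apply/eqP => sz; have : lead_coef (dehom P) != 0.
      by rewrite lead_coef_eq0 -size_poly_eq0 sz.
    by rewrite lead_coefE sz /= pn eqxx.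
  exists ((x 0 1)^-1 *: homogenize n (dehom P)); first by rewrite rpredZ ?hom_homog.
  apply: (dehom_inj hP).
    have := dhomogM (line_form_homog x) (hom_homog n (dehom P)).
    by rewrite -scalerAr add1n => h; apply: rpredZ.
  rewrite rmorphM /= dehomZ dehom_hom // /line_form e scale0r subr0 dehomZ dehomX0.
  by rewrite -scalerAl mul1r scalerA divff // scale1r.
rewrite {1}(affine_point xn) (meval_scale _ _ hP) meval_dehom => /eqP.
rewrite mulf_eq0 expf_eq0 (negPf xn) andbF /= => /factor_theorem[q eq].
have sq : (size q <= n.+1)%N.
  have [->|q0] := eqVneq q 0; first by rewrite size_poly0.
  by have := size_dehom hP; rewrite eq size_Mmonic ?monicXsubC // size_XsubC addn2.
exists (- (x 0 0)^-1 *: homogenize n q); first by rewrite rpredZ ?hom_homog.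
apply: (dehom_inj hP).
  have := dhomogM (line_form_homog x) (hom_homog n q).
  by rewrite -scalerAr add1n => h; apply: rpredZ.
rewrite rmorphM /= dehomZ dehom_hom // eq mulrC -scalerAr scalerAl.
congr (_ * _); rewrite /line_form rmorphB /= !dehomZ dehomX0 dehomX1.
rewrite scalerBr !scalerA [_ * x 0 0]mulNr mulVf // scaleN1r opprK mulNr.
by rewrite alg_polyC polyCN addrC [_^-1 * _]mulrC.
Qed.

(** * Divisibility without common zeros *)

(** The linear factors of C are cancelled one by one: a zero of C is a zero of G
    because some H i does not vanish there. *)
Lemma form_dvd (I : Type) c m (C G : S) (Z H : I -> S) :
  C \is c.-homog -> C != 0 -> G \is m.-homog ->
  (forall i, C * Z i = G * H i) ->
  (forall x, x != 0 -> C.@[x 0] = 0 -> exists i, (H i).@[x 0] != 0) ->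
  exists2 E, E \is (m - c).-homog & G = E * C.
Proof.
elim: c m C G => [|c IH] m C G hC C0 hG eZ zC.
  have [a ea] := form_const hC.
  have a0 : a != 0 by apply: contraNneq C0 => a0; rewrite ea a0 mpolyC0.
  exists (a^-1 *: G); first by rewrite subn0 rpredZ.
  by rewrite ea mulrC mul_mpolyC scalerA divff // scale1r.
have [x x0 Cx] := form_root (ltn0Sn c) hC.
have [C' hC' eC] := form_factor hC x0 Cx.
have [i Hi] := zC x x0 Cx.
have Gx : G.@[x 0] = 0.
  have /(congr1 (meval (x 0))) := eZ i; rewrite !mevalM Cx mul0r => /esym/eqP.
  by rewrite mulf_eq0 (negPf Hi) orbF => /eqP.
have [G' hG' eG] := form_factor hG x0 Gx.
have [|||E hE eE] := IH m.-1 C' G' hC' _ hG'.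
- by apply: contraNneq C0 => e; rewrite eC e mulr0.
- move=> j; apply: (mulfI (line_form_neq0 x0)).
  by rewrite !mulrA -eC -eG.
- by move=> y y0 e; apply: zC => //; rewrite eC mevalM e mulr0.
exists E; last by rewrite eG eC eE; ring.
by move: hE; rewrite -subn1 subnAC subn1 -subnS.
Qed.

End BinaryForms.

(** * Rows of binary forms *)

Section FormRows.
Variable K : closedFieldType.
Local Notation S := {mpoly K[2]}.
Implicit Types (P Q : S) (x y : 'rV[K]_2).

Definition form_row r (n : nat) (w : 'rV[S]_r) := forall i, w 0 i \is n.-homog.

(** A row of forms of the same degree with this property is a morphism on P^1. *)
Definition base_point_free r (w : 'rV[S]_r) := forall x, x != 0 -> ev w x != 0.

Lemma evE r (w : 'rV[S]_r) x i : ev w x 0 i = (w 0 i).@[x 0].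
Proof. by rewrite mxE. Qed.

Lemma ev0 r x : ev (0 : 'rV[S]_r) x = 0.
Proof. by apply/rowP=> i; rewrite evE !mxE meval0. Qed.

Lemma evD r (w w' : 'rV[S]_r) x : ev (w + w') x = ev w x + ev w' x.
Proof. by apply/rowP=> i; rewrite evE !mxE mevalD. Qed.

Lemma evZ r P (w : 'rV[S]_r) x : ev (P *: w) x = P.@[x 0] *: ev w x.
Proof. by apply/rowP=> i; rewrite evE !mxE mevalM. Qed.

Lemma ev_mul r s (w : 'rV[S]_r) (M : 'M[K]_(r, s)) x :
  ev (w *m map_mx (@mpolyC 2 K) M) x = ev w x *m M.
Proof.
apply/rowP=> i; rewrite evE !mxE rmorph_sum /=; apply: eq_bigr => j _.
by rewrite mevalM !mxE mevalC.
Qed.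

Lemma ev_scale r n (w : 'rV[S]_r) c x : form_row n w ->
  ev w (c *: x) = c ^+ n *: ev w x.
Proof.
by move=> hw; apply/rowP=> i; rewrite evE mxE evE (meval_scale _ _ (hw i)).
Qed.

Lemma ev_same_point r n (w : 'rV[S]_r) x y : form_row n w ->
  x != 0 -> (x == y)%MS -> (ev w x == ev w y)%MS.
Proof.
move=> hw x0 /(same_pointP _ x0)[c c0 ->]; rewrite (ev_scale _ _ hw).
by apply/eqmxP; apply: eqmx_scale; rewrite expf_neq0.
Qed.

Lemma form_rowD r n (w w' : 'rV[S]_r) :
  form_row n w -> form_row n w' -> form_row n (w + w').
Proof. by move=> h h' i; rewrite mxE rpredD. Qed.

Lemma form_rowB r n (w w' : 'rV[S]_r) :
  form_row n w -> form_row n w' -> form_row n (w - w').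
Proof. by move=> h h' i; rewrite !mxE rpredB. Qed.

Lemma form_rowZ r m n P (w : 'rV[S]_r) :
  P \is m.-homog -> form_row n w -> form_row (m + n) (P *: w).
Proof. by move=> hP h i; rewrite mxE; apply: dhomogM. Qed.

Lemma form_row_mul r s n (w : 'rV[S]_r) (M : 'M[K]_(r, s)) :
  form_row n w -> form_row n (w *m map_mx (@mpolyC 2 K) M).
Proof.
move=> hw i; rewrite mxE; apply: rpred_sum => j _.
by rewrite mxE mulrC mul_mpolyC rpredZ.
Qed.

Lemma form_row_eq r n (w w' : 'rV[S]_r) : form_row n w -> form_row n w' ->
  (forall x, x != 0 -> ev w x = ev w' x) -> w = w'.
Proof.
move=> h h' e; apply/rowP=> i; apply: (form_eq (h i) (h' i)) => x x0.
by rewrite -!evE e.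
Qed.

Lemma row_neq0 (R : nzRingType) r (w : 'rV[R]_r) : w != 0 -> exists i, w 0 i != 0.
Proof.
move=> w0; apply: NNPP => H; case/eqP: w0; apply/rowP=> i; rewrite mxE.
by apply/eqP; apply: contraT => wi; case: H; exists i.
Qed.

Lemma point_exists : exists x : 'rV[K]_2, x != 0.
Proof. by exists (pt 1 0); rewrite pt_neq0 ?oner_eq0. Qed.

Lemma bpf_neq0 r (w : 'rV[S]_r) : base_point_free w -> w != 0.
Proof.
move=> h; have [x x0] := point_exists; apply: contraNneq (h x x0) => ->.
by rewrite ev0.
Qed.

Lemma factor_degree m c (E C : S) : E \is (m - c).-homog -> C \is c.-homog ->
  E * C \is m.-homog -> E * C != 0 -> (c <= m)%N.
Proof.
move=> hE hC h n0; have := dhomog_uniq n0 h (dhomogM hE hC); lia.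
Qed.

(** A nonzero entry of g divides the corresponding entry of w, since its zeros are
    not zeros of all the entries of g. *)
Lemma parallel_multiple r m n (w g : 'rV[S]_r) : form_row m w -> form_row n g ->
  base_point_free g -> (forall i j, w 0 i * g 0 j = w 0 j * g 0 i) ->
  exists2 E, E \is (m - n).-homog & w = E *: g.
Proof.
move=> hw hg bg e; have [j gj] := row_neq0 (bpf_neq0 bg).
have [|x x0 _|E hE eE] :=
    @form_dvd K 'I_r n m (g 0 j) (w 0 j) (w 0) (g 0) (hg j) gj (hw j).
- by move=> i; rewrite mulrC e.
- by have [i] := row_neq0 (bg x x0); rewrite evE; exists i.
exists E => //; apply/rowP=> i; rewrite mxE; apply: (mulIf gj).
by rewrite e eE; ring.
Qed.

Lemma multiple_degree r m n E (g : 'rV[S]_r) : E \is (m - n).-homog ->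
  form_row n g -> form_row m (E *: g) -> E *: g != 0 -> (n <= m)%N.
Proof.
move=> hE hg h /row_neq0[i ni]; have := h i; rewrite mxE => hi.
by move: ni; rewrite mxE; apply: factor_degree.
Qed.

(** The common zeros are divided out one linear factor at a time. *)
Lemma primitive_part r n (w : 'rV[S]_r) : form_row n w -> w != 0 ->
  exists e E (g : 'rV[S]_r), [/\ E \is e.-homog, E != 0, (e <= n)%N,
    form_row (n - e) g & base_point_free g /\ w = E *: g].
Proof.
elim: n w => [|n IH] w hw w0.
  exists 0, 1, w; split; rewrite ?oner_eq0 ?dhomog1 ?scale1r //; split=> // x x0.
  have [i wi] := row_neq0 w0; apply: contraNneq wi => e.
  have [c ec] := form_const (hw i).
  by have := evE w x i; rewrite e ec mevalC mxE => <-; rewrite mpolyC0.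
case: (classic (base_point_free w)) => [bw|nb].
  exists 0, 1, w; split; rewrite ?oner_eq0 ?dhomog1 ?scale1r ?subn0 //.
have [x [x0 ex]] : exists x, x != 0 /\ ev w x = 0.
  apply: NNPP => H; apply: nb => x x0; apply/eqP => e.
  by apply: H; exists x.
have fac i : exists2 Q, Q \is n.-homog & w 0 i = line_form x * Q.
  by apply: (form_factor (hw i) x0); rewrite -evE ex mxE.
have [u hu eu] := fin_all_exists2 fac.
pose w' := \row_i u i.
have ew : w = line_form x *: w' by apply/rowP=> i; rewrite !mxE.
have [||e [E [g [hE E0 le hg [bg eg]]]]] := IH w'.
- by move=> i; rewrite mxE.
- by apply: contraNneq w0 => e; rewrite ew e scaler0.
exists e.+1, (line_form x * E), g; split=> //.
- exact: (dhomogM (line_form_homog x) hE).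
- by rewrite mulf_neq0 ?line_form_neq0.
- by split=> //; rewrite ew eg scalerA.
Qed.

(** K is algebraically closed: forms of positive degree have zeros. *)
Lemma form_no_zero n P : P \is n.-homog ->
  (forall x, x != 0 -> P.@[x 0] != 0) -> n = 0%N /\ exists2 c, c != 0 & P = c%:MP.
Proof.
case: n => [|n] hP nz.
  have [c e] := form_const hP; split=> //; exists c => //.
  have [x x0] := point_exists.
  by have := nz x x0; rewrite e mevalC.
by have [x x0 e] := form_root (ltn0Sn n) hP; have := nz x x0; rewrite e eqxx.
Qed.

Lemma form_neq0_of_bpf r E (g : 'rV[S]_r) : base_point_free (E *: g) ->
  forall x, x != 0 -> E.@[x 0] != 0.
Proof.
move=> b x x0; have := b x x0; rewrite evZ.
by apply: contraNneq => ->; rewrite scale0r.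
Qed.

End FormRows.

(** * Cross products *)

Section Cross.
Variable R : comNzRingType.
Implicit Types (u v w : 'rV[R]_3) (c : R).

Lemma ord3_case (i : 'I_3) : [\/ i = 0, i = 1 | i = ord_max].
Proof.
case: i => [[|[|[|//]]] H].
- by constructor 1; apply: val_inj.
- by constructor 2; apply: val_inj.
- by constructor 3; apply: val_inj.
Qed.

Lemma row3P u v : u 0 0 = v 0 0 -> u 0 1 = v 0 1 -> u 0 ord_max = v 0 ord_max ->
  u = v.
Proof. by move=> e0 e1 e2; apply/rowP=> i; case: (ord3_case i) => ->. Qed.

Definition dot u v : R := (u *m v^T) 0 0.

Lemma dotE u v :
  dot u v = u 0 0 * v 0 0 + u 0 1 * v 0 1 + u 0 ord_max * v 0 ord_max.
Proof.
rewrite /dot mxE !big_ord_recl big_ord0 !mxE addr0 addrA.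
have -> : lift ord0 ord0 = 1 :> 'I_3 by apply: val_inj.
by have -> : lift ord0 (lift ord0 ord0) = ord_max :> 'I_3 by apply: val_inj.
Qed.

Lemma mulmx_dot u v : (u *m v^T == 0) = (dot u v == 0).
Proof.
apply/eqP/eqP => [|e]; first by rewrite /dot => ->; rewrite mxE.
by apply/matrixP=> i j; rewrite !ord1 [RHS]mxE.
Qed.

Definition cross u v : 'rV[R]_3 := \row_i
  (if i == 0 then u 0 1 * v 0 ord_max - u 0 ord_max * v 0 1
   else if i == 1 then u 0 ord_max * v 0 0 - u 0 0 * v 0 ord_max
   else u 0 0 * v 0 1 - u 0 1 * v 0 0).

Lemma cross0 u v : cross u v 0 0 = u 0 1 * v 0 ord_max - u 0 ord_max * v 0 1.
Proof. by rewrite mxE. Qed.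
Lemma cross1 u v : cross u v 0 1 = u 0 ord_max * v 0 0 - u 0 0 * v 0 ord_max.
Proof. by rewrite mxE. Qed.
Lemma cross2 u v : cross u v 0 ord_max = u 0 0 * v 0 1 - u 0 1 * v 0 0.
Proof. by rewrite mxE. Qed.
Definition crossE := (cross0, cross1, cross2).

Lemma dotC u v : dot u v = dot v u. Proof. by rewrite !dotE; ring. Qed.
Lemma dotDl u v w : dot (u + v) w = dot u w + dot v w.
Proof. by rewrite !dotE !mxE; ring. Qed.
Lemma dotZl c u v : dot (c *: u) v = c * dot u v.
Proof. by rewrite !dotE !mxE; ring. Qed.
Lemma dotDr u v w : dot w (u + v) = dot w u + dot w v.
Proof. by rewrite !dotE !mxE; ring. Qed.
Lemma dotZr c u v : dot v (c *: u) = c * dot v u.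
Proof. by rewrite !dotE !mxE; ring. Qed.

Lemma dot_crossl u v : dot u (cross u v) = 0.
Proof. by rewrite dotE !crossE; ring. Qed.
Lemma dot_crossr u v : dot v (cross u v) = 0.
Proof. by rewrite dotE !crossE; ring. Qed.

Lemma cross_cross u v w : cross (cross u v) w = dot u w *: v - dot v w *: u.
Proof. by apply: row3P; rewrite !crossE !mxE !dotE; ring. Qed.

Lemma crossC u v : cross u v = - cross v u.
Proof.
have N (w : 'rV[R]_3) i : (- w) 0 i = - w 0 i by rewrite mxE.
by apply: row3P; rewrite N !crossE; ring.
Qed.
Lemma crossvv u : cross u u = 0.
Proof. by apply: row3P; rewrite [RHS]mxE !crossE; ring. Qed.
Lemma crossDl u v w : cross (u + v) w = cross u w + cross v w.
Proof. by apply: row3P; rewrite [RHS]mxE !crossE !mxE; ring. Qed.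
Lemma crossZl c u v : cross (c *: u) v = c *: cross u v.
Proof. by apply: row3P; rewrite [RHS]mxE !crossE !mxE; ring. Qed.
Lemma crossZr c u v : cross v (c *: u) = c *: cross v u.
Proof. by apply: row3P; rewrite [RHS]mxE !crossE !mxE; ring. Qed.

Lemma cross_eq0 u v : cross u v = 0 -> forall i j, u 0 i * v 0 j = u 0 j * v 0 i.
Proof.
move=> e; have := cross0 u v; have := cross1 u v; have := cross2 u v.
rewrite e !mxE => /esym/eqP; rewrite subr_eq0 => /eqP e2.
move=> /esym/eqP; rewrite subr_eq0 => /eqP e1.
move=> /esym/eqP; rewrite subr_eq0 => /eqP e0 i j.
by case: (ord3_case i) => ->; case: (ord3_case j) => ->; rewrite ?e0 ?e1 ?e2.
Qed.

End Cross.

Section CrossForms.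
Variable K : closedFieldType.
Local Notation S := {mpoly K[2]}.

Lemma ev_cross (u v : 'rV[S]_3) (x : 'rV[K]_2) :
  ev (cross u v) x = cross (ev u x) (ev v x).
Proof. by apply: row3P; rewrite evE !crossE mevalB !mevalM !evE. Qed.

Lemma form_row_cross m n (u v : 'rV[S]_3) :
  form_row m u -> form_row n v -> form_row (m + n) (cross u v).
Proof.
move=> hu hv i.
by case: (ord3_case i) => ->; rewrite crossE rpredB // dhomogM.
Qed.

Lemma dot_homog m n (u v : 'rV[S]_3) :
  form_row m u -> form_row n v -> dot u v \is (m + n).-homog.
Proof. by move=> hu hv; rewrite dotE !rpredD // dhomogM. Qed.

Lemma scale_row_eq0 (R : idomainType) r E (w : 'rV[R]_r) :
  w != 0 -> E *: w = 0 -> E = 0.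
Proof.
move=> /row_neq0[i wi] e; have := congr1 (fun v : 'rV[R]_r => v 0 i) e.
by rewrite !mxE => /eqP; rewrite mulf_eq0 (negPf wi) orbF => /eqP.
Qed.

Lemma cross_free (R : idomainType) (u v : 'rV[R]_3) (a b : R) :
  cross u v != 0 -> a *: u + b *: v = 0 -> a = 0 /\ b = 0.
Proof.
move=> n0 e; split; apply: (scale_row_eq0 n0).
  rewrite -crossZl -[a *: u](addrK (b *: v)) e sub0r -scaleNr crossZl.
  by rewrite crossvv scaler0.
rewrite -crossZr -[b *: v](addKr (a *: u)) e addr0 -scaleNr crossZr.
by rewrite crossvv scaler0.
Qed.

End CrossForms.

(** * Syzygies of triples of binary forms *)

Section Syzygies.
Variable K : closedFieldType.
Local Notation S := {mpoly K[2]}.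
Local Notation forms n := (dhomog 2 K n).

Lemma dim_forms n : dim (forms n) = n.+1.
Proof. by have -> : dim (forms n) = 'C(n + 1, n) by []; rewrite addn1 binSn. Qed.

Definition triples n := (forms n * forms n * forms n)%type.
HB.instance Definition _ n := Vector.on (triples n).

Lemma dim_triples n : dim (triples n) = (3 * n.+1)%N.
Proof.
have -> : dim (triples n) = (dim (forms n) + dim (forms n) + dim (forms n))%N by [].
by rewrite dim_forms; lia.
Qed.

Definition row_of n (t : triples n) : 'rV[S]_3 :=
  \row_i (if i == 0 then val t.1.1 else if i == 1 then val t.1.2 else val t.2).

Lemma row_of_homog n (t : triples n) : form_row n (row_of t).
Proof.
move=> i; rewrite mxE; case: ifP => _; first exact: dhomog_is_dhomog.
by case: ifP => _; apply: dhomog_is_dhomog.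
Qed.

Lemma row_of_eq0 n (t : triples n) : row_of t = 0 -> t = 0.
Proof.
move=> e; have := congr1 (fun w : 'rV[S]_3 => w 0 0) e.
have := congr1 (fun w : 'rV[S]_3 => w 0 1) e.
have := congr1 (fun w : 'rV[S]_3 => w 0 ord_max) e.
rewrite !mxE /=; case: t {e} => [[a b] c] /= ec eb ea.
by congr (_, _, _); apply: val_inj.
Qed.

Lemma row_ofP n c (t u : triples n) :
  row_of (c *: t + u) = c%:MP *: row_of t + row_of u.
Proof.
apply/rowP=> i; rewrite !mxE mul_mpolyC.
by case: ifP => _ //; case: ifP => _ //.
Qed.

Variables (n : nat) (g : 'rV[S]_3).
Hypothesis hg : form_row n g.

Definition form_of d (P : S) : forms d := insubd 0 P.
Lemma form_ofK d (P : S) : P \is d.-homog -> val (form_of d P) = P.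
Proof. by move=> hP; rewrite insubdK. Qed.

Definition pairing m (t : triples m) : forms (m + n) :=
  form_of (m + n) (dot (row_of t) g).

Lemma pairingE m (t : triples m) : val (pairing t) = dot (row_of t) g.
Proof. by rewrite form_ofK // dot_homog //; apply: row_of_homog. Qed.

Fact pairing_is_linear m : linear (@pairing m).
Proof.
move=> c t u; apply: val_inj; apply: etrans (pairingE _) _.
by rewrite row_ofP dotDl dotZl mul_mpolyC -(pairingE t) -(pairingE u).
Qed.
HB.instance Definition _ m :=
  GRing.isLinear.Build K (triples m) (forms (m + n)) _ (@pairing m)
    (@pairing_is_linear m).

(** Counting dimensions, 3 (m + 1) > (m + n) + 1 as soon as 2 m + 2 > n. *)
Lemma syzygy_exists : exists A, A != 0 /\ syzygy n./2 A g.
Proof.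
pose m := n./2; pose L := linfun (@pairing m).
have lt0 : (0 < \dim (lker L))%N.
  have := limg_ker_dim L fullv; rewrite capfv => e.
  have le : (\dim (limg L) <= (m + n).+1)%N.
    by have := dimvS (subvf (limg L)); rewrite dimvf dim_forms.
  move: e; rewrite dimvf dim_triples /=.
  have : (n <= m.*2.+1)%N by rewrite /m -[n in (n <= _)%N]odd_double_half; case: (odd n) => /=; lia.
  lia.
have k0 : lker L != 0%VS by rewrite -dimv_eq0 -lt0n.
pose t := vpick (lker L); exists (row_of t); split.
  apply: contraNneq k0 => /row_of_eq0 /eqP.
  by rewrite vpick0.
split; first exact: row_of_homog.
apply/eqP; rewrite mulmx_dot -pairingE.
have : t \in lker L by apply: memv_pick.
by rewrite memv_ker lfunE /= => /eqP->.
Qed.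

(** Again by a dimension count: the syzygies of degree n - h are more than the
    multiples of a given syzygy of degree h. *)
Lemma second_syzygy_exists h b : form_row h b -> b != 0 -> (2 * h <= n)%N ->
  exists A, syzygy (n - h) A g /\
    ~ exists2 E, E \is (n - 2 * h).-homog & A = E *: b.
Proof.
move=> hb b0 le2; pose m := (n - h)%N; pose d := (n - 2 * h)%N.
pose L := linfun (@pairing m).
pose mul (E : forms d) : triples m :=
  (form_of m (val E * b 0 0), form_of m (val E * b 0 1), form_of m (val E * b 0 ord_max)).
have hE (E : forms d) i : val E * b 0 i \is m.-homog.
  have -> : m = (d + h)%N by rewrite /m /d; lia.
  by apply: dhomogM => //; apply: dhomog_is_dhomog.
have mulE E : row_of (mul E) = val E *: b.
  by apply: row3P; rewrite !mxE /= form_ofK //; apply: hE.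
have valD k c (E F : forms k) : val (c *: E + F) = c *: val E + val F by [].
have mul_lin : linear mul.
  move=> c E F; rewrite /mul; congr (_, _, _); apply: val_inj;
  by rewrite form_ofK ?hE // !valD !form_ofK ?hE // mulrDl scalerAl.
pose mulL : {linear forms d -> triples m} := HB.pack mul
  (GRing.isLinear.Build K _ _ _ mul mul_lin).
pose T := linfun mulL.
have : ~~ (lker L <= limg T)%VS.
  apply/negP => /dimvS.
  have := limg_ker_dim L fullv; rewrite capfv => e.
  have le : (\dim (limg L) <= (m + n).+1)%N.
    by have := dimvS (subvf (limg L)); rewrite dimvf dim_forms.
  have := limg_ker_dim T fullv; rewrite !dimvf dim_forms.
  have mh : (m + h = n)%N by rewrite /m; lia.
  have dh : (d + 2 * h = n)%N by rewrite /d; lia.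
  by move: e; rewrite dimvf dim_triples; lia.
case/subvPn=> t tL tT; exists (row_of t); split.
  split; first exact: row_of_homog.
  apply/eqP; rewrite mulmx_dot -pairingE.
  by move: tL; rewrite memv_ker lfunE /= => /eqP->.
move=> [E hEd e]; case/negP: tT.
suff -> : t = T (form_of d E) by apply: memv_img; apply: memvf.
apply/eqP; rewrite -subr_eq0; apply/eqP; apply: row_of_eq0.
rewrite -scaleN1r addrC row_ofP e lfunE /= mulE form_ofK //.
by rewrite mpolyCN mpolyC1 scaleN1r addNr.
Qed.

End Syzygies.

(** * Bases of syzygy modules *)

Section HilbertBurch.
Variable K : closedFieldType.
Local Notation S := {mpoly K[2]}.
Implicit Types (A b c f g : 'rV[S]_3) (E : S).

Lemma syzygyP m A g : syzygy m A g <-> form_row m A /\ dot A g = 0.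
Proof.
split=> [[hA /eqP]|[hA /eqP]]; first by rewrite mulmx_dot => /eqP.
by rewrite -mulmx_dot => /eqP.
Qed.

Lemma homog_cast m n E : m = n -> E \is m.-homog -> E \is n.-homog.
Proof. by move->. Qed.

Lemma form_row_cast r m n (w : 'rV[S]_r) : m = n -> form_row m w -> form_row n w.
Proof. by move->. Qed.

Lemma bpf_crossl b c : base_point_free (cross b c) -> base_point_free b.
Proof.
move=> h x x0; have := h x x0; rewrite ev_cross; apply: contraNneq => ->.
by apply/eqP; apply: row3P; rewrite crossE !mxE; ring.
Qed.

Lemma bpf_scaleC r (e : K) (w : 'rV[S]_r) : e != 0 -> base_point_free w ->
  base_point_free (e%:MP *: w).
Proof.
by move=> e0 h x x0; rewrite evZ mevalC scaler_eq0 negb_or e0 h.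
Qed.

(** A syzygy without zeros is part of a basis: crossing it with any syzygy of
    the complementary degree that is not a multiple of it gives g up to a
    constant. *)
Lemma complementary_syzygy n h g b : form_row n g -> base_point_free g ->
  form_row h b -> base_point_free b -> dot b g = 0 -> (2 * h <= n)%N ->
  exists2 c, form_row (n - h) c & cross b c = g.
Proof.
move=> hg bg hb bb bg0 le; have b0 := bpf_neq0 bb.
have [A [/syzygyP[hA Ag] nA]] := second_syzygy_exists hg hb b0 le.
have hw : form_row n (cross A b).
  by have := form_row_cross hA hb; rewrite subnK //; lia.
have [|E hE eE] := parallel_multiple hw hg bg.
  apply: cross_eq0; rewrite cross_cross Ag bg0 !scale0r subrr //.
have [e ee] := form_const (homog_cast (subnn n) hE).
have e0 : e != 0.
  apply/eqP => e0; apply: nA.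
  have [|F hF ->] := parallel_multiple hA hb bb.
    by apply: cross_eq0; rewrite eE ee e0 mpolyC0 scale0r.
  by exists F => //; rewrite mul2n -addnn subnDA.
exists ((- e^-1)%:MP *: A).
  by have := form_rowZ (dhomogC 2 (- e^-1)) hA.
rewrite crossZr crossC eE ee scalerN scalerA -mpolyCM mulNr mulVf //.
by rewrite mpolyCN mpolyC1 scaleN1r opprK.
Qed.

(** If b x c has no zeros, then b and c generate its syzygies: crossing a
    syzygy with b gives a multiple of b x c, hence its c-coordinate. *)
Lemma homog_syzygy_decomposition p q m b c A : form_row p b -> form_row q c ->
  base_point_free (cross b c) -> form_row m A -> dot A (cross b c) = 0 ->
  exists x y, [/\ x \is (m - p).-homog, y \is (m - q).-homog,
    A = x *: b + y *: c, (m < p)%N -> x = 0 & (m < q)%N -> y = 0].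
Proof.
move=> hb hc bg hA Ag; set g := cross b c in bg Ag.
have hg : form_row (p + q) g by apply: form_row_cross.
have g0 := bpf_neq0 bg; have bb := bpf_crossl bg.
have hw := form_row_cross hA hb.
have [|E hE eE] := parallel_multiple hw hg bg.
  apply: cross_eq0; rewrite cross_cross Ag.
  by rewrite [dot b g]dot_crossl !scale0r subrr.
have hE' : E \is (m - q).-homog.
  by apply: homog_cast hE; lia.
have Eq : (m < q)%N -> E = 0.
  move=> lt; apply: (scale_row_eq0 g0); apply/eqP; apply: contraT => n0.
  have := multiple_degree hE hg; rewrite -eE => /(_ hw).
  by rewrite eE => /(_ n0); lia.
have hEc : form_row m (E *: c).
  case: (leqP q m) => [le|/Eq ->]; last first.
    by move=> i; rewrite scale0r mxE; apply: dhomog0.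
  by have := form_rowZ hE' hc; rewrite subnK.
have hAE : form_row m (A + E *: c) by apply: form_rowD.
have [|F hF eF] := parallel_multiple hAE hb bb.
  apply: cross_eq0; rewrite crossDl crossZl eE (crossC c) -/g.
  by rewrite scalerN subrr.
exists F, (- E); split=> //.
- by rewrite rpredN.
- by rewrite -eF scaleNr addrK.
- move=> lt; apply: (scale_row_eq0 (bpf_neq0 bb)); apply/eqP.
  apply: contraT => n0; have := multiple_degree hF hb; rewrite -eF => /(_ hAE).
  by rewrite eF => /(_ n0); lia.
- by move=> /Eq ->; rewrite oppr0.
Qed.

Lemma pihomogM n d (P Q : S) : Q \is n.-homog ->
  pihomog mdeg (d + n) (P * Q) = pihomog mdeg d P * Q.
Proof.
move=> hQ; rewrite {1}(pihomog_partitionE (leqnn (mmeasure mdeg P))).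
rewrite mulr_suml raddf_sum /=; set N := mmeasure _ _.
have [lt|le] := ltnP d N.
  rewrite (bigD1 (Ordinal lt)) //= pihomog_dE; last first.
    by apply: dhomogM => //; apply: pihomogP.
  rewrite big1 ?addr0 // => i ne; apply: (@pihomog_ne0 _ _ _ (i + n)%N).
    rewrite eqn_add2r; apply: contraNneq ne => e.
    by apply/eqP/val_inj.
  by apply: dhomogM => //; apply: pihomogP.
rewrite big1 => [|i _].
  rewrite {1}(pihomog_partitionE (leqnn (mmeasure mdeg P))) raddf_sum /=.
  rewrite big1 ?mul0r // => i _; apply: (@pihomog_ne0 _ _ _ i); last exact: pihomogP.
  by apply: contraTneq le => <-; rewrite -ltnNge.
apply: (@pihomog_ne0 _ _ _ (i + n)%N); last by apply: dhomogM => //; apply: pihomogP.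
by rewrite eqn_add2r; apply: contraTneq le => <-; rewrite -ltnNge.
Qed.

(** The homogeneous components of a syzygy of a row of forms are syzygies. *)
Lemma syzygy_decomposition p q b c A : form_row p b -> form_row q c ->
  base_point_free (cross b c) -> dot A (cross b c) = 0 ->
  exists x y, A = x *: b + y *: c.
Proof.
move=> hb hc bg Ag; set g := cross b c in bg Ag.
have hg : form_row (p + q) g by apply: form_row_cross.
pose Ad d : 'rV[S]_3 := \row_i pihomog mdeg d (A 0 i).
have hAd d : form_row d (Ad d) by move=> i; rewrite mxE; apply: pihomogP.
have Adg d : dot (Ad d) g = 0.
  have eAd i : Ad d 0 i = pihomog mdeg d (A 0 i) by rewrite mxE.
  rewrite dotE !eAd -(pihomogM d _ (hg 0)) -(pihomogM d _ (hg 1)).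
  rewrite -(pihomogM d _ (hg ord_max)) -!pihomogD -dotE Ag.
  exact: pihomog0.
have dec (d : nat) : exists xy : S * S, Ad d = xy.1 *: b + xy.2 *: c.
  have [x [y [_ _ e _ _]]] := homog_syzygy_decomposition hb hc bg (hAd d) (Adg d).
  by exists (x, y).
pose N := \max_i mmeasure mdeg (A 0%R i).
have eA : A = \sum_(d < N) Ad d.
  apply/rowP=> i; rewrite summxE.
  have le : (mmeasure mdeg (A 0%R i) <= N)%N.
    exact: (leq_bigmax (F := fun i => mmeasure mdeg (A 0%R i)) i).
  rewrite [LHS](pihomog_partitionE le).
  by apply: eq_bigr => d _; rewrite mxE.
have [xy exy] := fin_all_exists (fun d : 'I_N => dec d).
exists (\sum_d (xy d).1), (\sum_d (xy d).2); rewrite eA !scaler_suml -big_split /=.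
by apply: eq_bigr => d _; rewrite exy.
Qed.

Lemma splitting_type_cross p q b c : form_row p b -> form_row q c ->
  base_point_free (cross b c) -> splitting_type (cross b c) p q.
Proof.
move=> hb hc bg; exists b, c; split.
- by apply/syzygyP; split; rewrite ?dot_crossl.
- by apply/syzygyP; split; rewrite ?dot_crossr.
move=> A /eqP; rewrite mulmx_dot => /eqP Ag.
have [x [y e]] := syzygy_decomposition hb hc bg Ag.
exists (x, y); split=> // -[x' y'] /= e'.
have := @cross_free _ b c (x - x') (y - y') (bpf_neq0 bg).
rewrite !scalerBl addrACA -opprD -e -e' subrr => /(_ erefl)[/eqP + /eqP].
by rewrite !subr_eq0 => /eqP -> /eqP ->.
Qed.

(** A combination of the basis has no component of degree less than k. *)
Lemma splitting_type_min k l f : (k <= l)%N -> splitting_type f k l ->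
  min_syzygy_degree k f.
Proof.
move=> le [a [b [[ha af] [hb bf] H]]]; split.
  exists a => //; apply/eqP => a0.
  have [c [_ u]] := H 0 (mul0mx _ _).
  have e0 : c = (0, 0) by apply: u; rewrite /= !scale0r addr0.
  have e1 : c = (1, 0) by apply: u; rewrite /= a0 scaler0 scale0r addr0.
  by move/(congr1 fst): e1; rewrite e0 /= => /esym/eqP; rewrite oner_eq0.
move=> m A A0 [hA Af]; rewrite leqNgt; apply: contra A0 => lt.
have [[x y] [e _]] := H A Af; apply/eqP/rowP=> i; rewrite [RHS]mxE.
have low n (P Q : S) : (m < n)%N -> Q \is n.-homog -> pihomog mdeg m (P * Q) = 0.
  move=> mn hQ; rewrite (pihomog_partitionE (leqnn (mmeasure mdeg P))).
  rewrite mulr_suml raddf_sum big1 // => j _.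
  apply: (@pihomog_ne0 _ _ _ (j + n)%N); first by lia.
  by apply: dhomogM => //; apply: pihomogP.
rewrite -(pihomog_dE (hA i)) e !mxE pihomogD.
by rewrite (low k) // (low l) ?addr0 // (leq_trans lt).
Qed.

(** Dividing out a common zero would lower the degree. *)
Lemma min_syzygy_bpf h b g : min_syzygy_degree h g -> b != 0 -> syzygy h b g ->
  base_point_free b.
Proof.
move=> [_ hmin] b0 /syzygyP[hb bg].
have [e [E [b' [hE E0 le hb' [bb' eb]]]]] := primitive_part hb b0.
have le' : (h <= h - e)%N.
  apply: (hmin _ b' (bpf_neq0 bb')); apply/syzygyP; split=> //.
  by apply/eqP; move/eqP: bg; rewrite eb dotZl mulf_eq0 (negPf E0).
have e0 : e = 0%N by lia.
have [a ea] := form_const (homog_cast e0 hE).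
by rewrite eb ea; apply: bpf_scaleC => //; apply: contraNneq E0 => a0; rewrite ea a0 mpolyC0.
Qed.

Lemma min_syzygy_half h n g : form_row n g -> min_syzygy_degree h g -> (2 * h <= n)%N.
Proof.
move=> hg [_ hmin]; have [A [A0 sA]] := syzygy_exists hg.
have := hmin _ _ A0 sA; have := odd_double_half n; lia.
Qed.

Lemma min_syzygy_degree_cross p q b c : (p <= q)%N -> form_row p b ->
  form_row q c -> base_point_free (cross b c) -> min_syzygy_degree p (cross b c).
Proof.
by move=> le hb hc bg; apply: (splitting_type_min le); apply: splitting_type_cross.
Qed.

Lemma min_syzygy_degree_ex n g : form_row n g -> exists h, min_syzygy_degree h g.
Proof.
move=> hg; have [A [A0 sA]] := syzygy_exists hg.
pose P m := exists2 A, A != 0 & syzygy m A g.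
have : P n./2 by exists A.
elim/ltn_ind: (n./2) => m IH Pm.
case: (classic (exists2 j, (j < m)%N & P j)) => [[j lt Pj]|no]; first exact: (IH j).
exists m; split=> // j B B0 sB; rewrite leqNgt; apply/negP => lt.
by apply: no; exists j => //; exists B.
Qed.

Lemma min_syzygy_degree_scale h g (c : K) : c != 0 ->
  min_syzygy_degree h g -> min_syzygy_degree h (c%:MP *: g).
Proof.
have imp (a : K) g' A m : syzygy m A g' -> syzygy m A (a%:MP *: g').
  by move=> /syzygyP[hA e]; apply/syzygyP; rewrite dotZr e mulr0.
move=> c0 [[A A0 sA] hmin]; split; first by exists A => //; apply: imp.
move=> m B B0 sB; apply: (hmin _ B) => //.
have := imp c^-1 _ _ _ sB; rewrite scalerA -mpolyCM mulVf //.
by rewrite mpolyC1 scale1r.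
Qed.

End HilbertBurch.

(** * Multiplicities *)

Section Multiplicity.
Variable K : closedFieldType.
Local Notation S := {mpoly K[2]}.

Definition constant_row r (p : 'rV[K]_r) : 'rV[S]_r := map_mx (@mpolyC 2 K) p.

Lemma form_row_constant r (p : 'rV[K]_r) : form_row 0 (constant_row p).
Proof. by move=> i; rewrite mxE; apply: dhomogC. Qed.

Lemma ev_constant r (p : 'rV[K]_r) x : ev (constant_row p) x = p.
Proof. by apply/rowP=> i; rewrite evE mxE mevalC. Qed.

(** In a pencil of hyperplanes through p each vector of s off p excludes at most
    one member, and K is infinite. *)
Lemma hyperplane_avoiding n (p : 'rV[K]_n) (s : seq 'rV[K]_n) :
  (forall v, v \in s -> ~~ (v <= p)%MS) ->
  exists2 l : 'cV[K]_n, p *m l = 0 & forall v, v \in s -> v *m l != 0.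
Proof.
elim: s => [|v s IH] H; first by exists 0; rewrite ?mulmx0.
have [|l pl sl] := IH; first by move=> w ws; apply: H; rewrite inE ws orbT.
have [j vj] : exists j, v *m col j (cokermx p) != 0.
  apply: NNPP => no; case/negP: (H v (mem_head _ _)); rewrite submxE.
  apply/eqP/rowP=> j; rewrite [RHS]mxE; apply/eqP; apply: contraT => nj.
  case: no; exists j; apply: contra nj => /eqP e.
  have := congr1 (fun M : 'M[K]_1 => M 0 0) e.
  rewrite !mxE => {2}<-; apply/eqP; apply: eq_bigr => i _.
  by rewrite !mxE.
pose l' := col j (cokermx p).
have pl' : p *m l' = 0.
  by rewrite /l' colE mulmxA mulmx_coker mul0mx.
have scal (w : 'rV[K]_n) (m : 'cV[K]_n) : (w *m m == 0) = ((w *m m) 0 0 == 0).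
  apply/eqP/eqP => [->|e]; first by rewrite mxE.
  by apply/matrixP=> a b; rewrite !ord1 e mxE.
have [c0|cn] := eqVneq (v *m l) 0; last first.
  by exists l => // w; rewrite inE => /orP[/eqP->|/sl].
pose q : {poly K} := 'X * \prod_(w <- s) (((w *m l') 0 0)%:P * 'X + ((w *m l) 0 0)%:P).
have q0 : q != 0.
  rewrite mulf_neq0 ?polyX_eq0 // prodf_seq_neq0; apply/allP => w ws /=.
  apply: contra (sl w ws) => /eqP e; rewrite scal.
  have /(congr1 (fun t => t.[0])) := e.
  by rewrite !hornerE ?mulr0 ?add0r => ->.
have [a aP] := closed_nonrootP q q0.
move: aP; rewrite /root hornerM hornerX mulf_eq0 negb_or horner_prod.
rewrite prodf_seq_neq0 => /andP[a0 /allP sa].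
exists (l + a *: l'); first by rewrite mulmxDr pl -scalemxAr pl' scaler0 addr0.
move=> w; rewrite inE => /orP[/eqP->|ws].
  by rewrite mulmxDr c0 add0r -scalemxAr scaler_eq0 negb_or a0.
have := sa w ws; rewrite /= !hornerE scal => wP.
have -> : (w *m (l + a *: l')) 0 0 = (w *m l) 0 0 + a * (w *m l') 0 0.
  by rewrite mulmxDr -scalemxAr mxE [X in _ + X]mxE.
by move: wP; apply: contraNneq => <-; apply/eqP; ring.
Qed.

Lemma mult_at_uniq n (phi : 'rV[S]_n.+1) p m m' :
  mult_at phi p m -> mult_at phi p m' -> m = m'.
Proof.
move=> [[l [l0 pl hl]] min] [[l' [l0' pl' hl']] min'].
by apply/eqP; rewrite eqn_leq (min l') // (min' l).
Qed.

Section Over.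
Variables (n c e : nat) (psi : 'rV[S]_n.+1) (p : 'rV[K]_n.+1).
Variables (B C : S) (gam : 'rV[S]_n.+1).
Hypotheses (epsi : psi = B *: constant_row p + C *: gam).
Hypotheses (hC : C \is c.-homog) (hgam : form_row e gam).
Hypotheses (bpsi : base_point_free psi) (p0 : p != 0).
Hypothesis gamp : forall x, x != 0 -> ~~ (ev gam x <= p)%MS.

Lemma over_pointP x : x != 0 -> (ev psi x == p)%MS = (C.@[x 0] == 0).
Proof.
move=> x0; have e1 : ev psi x = B.@[x 0] *: p + C.@[x 0] *: ev gam x.
  by rewrite epsi evD !evZ ev_constant.
apply/idP/eqP => [|Cx].
  move=> /(same_pointP _ (bpsi x0))[a _]; rewrite e1 => e2.
  apply/eqP; apply: contraT => C0; case/negP: (gamp x0).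
  apply/sub_rVP; exists ((C.@[x 0])^-1 * (a - B.@[x 0])).
  rewrite -scalerA scalerBl -e2 addrC addKr scalerA mulVf // scale1r //.
apply/(same_pointP _ (bpsi x0)); exists B.@[x 0]; last first.
  by rewrite e1 Cx scale0r addr0.
by apply: contraNneq (bpsi x0) => Bx; rewrite e1 Cx Bx !scale0r addr0.
Qed.

Lemma hyperplane_section (l : 'cV[K]_n.+1) : p *m l = 0 ->
  (psi *m map_mx (@mpolyC 2 K) l) 0 0 = C * (gam *m map_mx (@mpolyC 2 K) l) 0 0.
Proof.
move=> pl; rewrite epsi mulmxDl -!scalemxAl -map_mxM pl map_mx0 scaler0 add0r.
by rewrite mxE.
Qed.

(** Off the hyperplanes meeting one of the finitely many branches at p too
    much, the divisor cut on the branches at p is that of C; no hyperplane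
    cuts less, as C divides each section. *)
Lemma multiplicity_over : C != 0 -> mult_at psi p c.
Proof.
move=> C0; have [Z HZ] := generic_form hC C0; split.
  have [y y0] := point_exists K.
  have [|l pl gl] := @hyperplane_avoiding n.+1 p [seq ev gam z | z <- y :: Z & z != 0].
    by move=> v /mapP[z]; rewrite mem_filter => /andP[z0 _] ->; apply: gamp.
  have ge (x : 'rV[K]_2) : ((gam *m map_mx (@mpolyC 2 K) l) 0 0).@[x 0] = (ev gam x *m l) 0 0.
    by rewrite -ev_mul evE.
  exists l; split=> //.
    have : ev gam y *m l != 0 by apply/gl/map_f; rewrite mem_filter y0 mem_head.
    by apply: contraNneq => ->; rewrite mulmx0.
  exists C, ((gam *m map_mx (@mpolyC 2 K) l) 0 0); split=> //.
  - exact: hyperplane_section.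
  - by move=> x x0 /eqP; rewrite over_pointP.
  - move=> x x0; rewrite over_pointP // ge => Cx.
    have [z zZ xz] : exists2 z, z \in Z & (x == z)%MS.
      apply: NNPP => no; suff : C.@[x 0] != 0 by rewrite Cx.
      by apply: HZ => // z zZ; apply/negP => xz; apply: no; exists z.
    have [a a0 exz] := same_pointP z x0 xz.
    have z0 : z != 0 by apply: contraNneq x0 => z0; rewrite exz z0 scaler0.
    have := gl (ev gam z); rewrite map_f ?mem_filter ?z0 ?inE ?zZ ?orbT // => /(_ isT).
    rewrite exz (ev_scale _ _ hgam) -scalemxAl.
    apply: contra => /eqP e1; apply/eqP/matrixP => i j; rewrite !ord1 [RHS]mxE.
    by move: e1; rewrite mxE => /eqP; rewrite mulf_eq0 expf_eq0 (negPf a0) andbF => /eqP.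
move=> l m' l0 pl [G [H [eGH hG G0 H0]]].
have [||E hE eE] := @form_dvd K unit c m' C G
  (fun=> (gam *m map_mx (@mpolyC 2 K) l) 0 0) (fun=> H) hC C0 hG.
- by move=> _; rewrite -eGH hyperplane_section.
- by move=> x x0 Cx; exists tt; apply: H0 => //; rewrite over_pointP // Cx.
have [Gz|Gn] := eqVneq G 0; last by apply: (factor_degree hE hC); rewrite -eE.
case/eqP: C0; apply: (form_eq0 hC); exists [::] => x x0 _; apply/eqP.
by rewrite -over_pointP //; apply: G0; rewrite // Gz meval0.
Qed.

End Over.

(** Splitting off the branches at a point p of a curve: the zeros of C are
    the points over p. *)
Lemma split_at_point n d (psi : 'rV[S]_n) p : form_row d psi -> p != 0 ->
  (exists2 x, x != 0 & ~~ (ev psi x <= p)%MS) ->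
  exists c B C gam, [/\ psi = B *: constant_row p + C *: gam, C \is c.-homog,
    form_row (d - c) gam, (c <= d)%N &
    C != 0 /\ forall x, x != 0 -> ~~ (ev gam x <= p)%MS].
Proof.
move=> hpsi p0 [x x0 xp]; have [i pi] := row_neq0 p0.
pose B := (p 0 i)^-1 *: psi 0 i; pose w := psi - B *: constant_row p.
have hw : form_row d w.
  apply: form_rowB => //; rewrite -[d]addn0; apply: form_rowZ.
    exact: dhomogZ.
  exact: form_row_constant.
have wi : w 0 i = 0.
  by rewrite !mxE [_ * _]mulrC mul_mpolyC scalerA divff // scale1r subrr.
have w0 : w != 0.
  apply: contraNneq xp => e; apply/sub_rVP; exists B.@[x 0].
  have -> : psi = B *: constant_row p by apply/eqP; rewrite -subr_eq0 -/w e.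
  by rewrite evZ ev_constant.
have [c [C [gam [hC C0 le hg [bg eg]]]]] := primitive_part hw w0.
exists c, B, C, gam; split=> //; first by rewrite -eg addrC subrK.
split=> // y y0; apply/negP => /sub_rVP[a ea].
have gi : gam 0 i = 0.
  by move: wi; rewrite eg mxE => /eqP; rewrite mulf_eq0 (negPf C0) => /eqP.
have : ev gam y 0 i = a * p 0 i by rewrite ea mxE.
rewrite evE gi meval0 => /esym/eqP; rewrite mulf_eq0 (negPf pi) orbF => /eqP a0.
by have := bg y y0; rewrite ea a0 scale0r eqxx.
Qed.

Lemma rational_param_nonconstant n d (psi : 'rV[S]_n.+1) (p : 'rV[K]_n.+1) :
  rational_param d psi -> exists2 x, x != 0 & ~~ (ev psi x <= p)%MS.
Proof.
move=> [_ b inj _]; have [x x0 ix] := generic_ex inj.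
apply: NNPP => no.
have sub y : y != 0 -> (ev psi y == p)%MS.
  move=> y0; have : (ev psi y <= p)%MS.
    by apply: contraT => n0; case: no; exists y.
  by move/(sub_point (b y y0))=> [a a0 e]; apply/(same_pointP _ (b y y0)); exists a.
have all (y : 'rV[K]_2) : y != 0 -> (y == x)%MS.
  move=> y0; apply: ix => //; apply/eqmxP.
  exact: eqmx_trans (eqmxP (sub y y0)) (eqmx_sym (eqmxP (sub x x0))).
have := all _ (@pt_neq0 K 0 1 _); have := all _ (@pt_neq0 K 1 0 _).
rewrite !same_point2 ?pt_neq0 ?oner_eq0 ?orbT // !pt0 !pt1 !mul1r !mul0r.
move=> /(_ isT)/eqP e1 /(_ isT)/eqP e0.
by move/eqP: x0; apply; apply: row2P; rewrite mxE.
Qed.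

End Multiplicity.

(** * Ascenzi curves *)

Section Ascenzi.
Variable K : closedFieldType.
Local Notation S := {mpoly K[2]}.
Variables (d k : nat) (f : 'rV[S]_3).
Hypotheses (hf : form_row d f) (bf : base_point_free f).

Lemma cross_point_neq0 (p v : 'rV[K]_3) : p != 0 -> ~~ (v <= p)%MS -> cross p v != 0.
Proof.
move=> p0; apply: contraNneq => /cross_eq0 e.
have [i pi] := row_neq0 p0; apply/sub_rVP; exists (v 0 i / p 0 i).
by apply/rowP=> j; rewrite mxE mulrAC -(mulrC (p 0 j)) -e; field.
Qed.

(** The zeros of C are the branches at p, whose multiplicity is thus deg C. *)
Lemma cone_ascenzi c e B C gam p : (0 < c)%N -> (d <= 2 * c + 1)%N ->
  f = B *: constant_row p + C *: gam -> C \is c.-homog -> C != 0 ->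
  form_row e gam -> p != 0 -> (forall x, x != 0 -> ~~ (ev gam x <= p)%MS) ->
  ascenzi d f.
Proof.
move=> c0 le ef hC C0 hg p0 gp; exists p, c; split=> //.
  split=> //; have [x x0 Cx] := form_root c0 hC; exists x => //.
  have := over_pointP ef bf gp x0.
  by rewrite Cx eqxx => /eqmxP/eqmx_sym/eqmxP.
exact: (multiplicity_over ef hC hg bf gp).
Qed.

Hypotheses (Hf : @rational_param K 2 d f) (le2 : (2 * k <= d)%N).

(** The pencil of lines through a point of multiplicity c gives a syzygy of
    degree d - c; for c large it is one of minimal degree. *)
Lemma ascenzi_syzygy : splitting_type f k (d - k) -> ascenzi d f ->
  d <> (2 * k).+1 -> exists alpha, [/\ alpha != 0, syzygy k alpha f
    & min_syzygy_degree 0 alpha].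
Proof.
move=> spl [p [m [[p0 _] multm lem]]] dk.
have [c [B [C [gam [ef hC hg lec [C0 gp]]]]]] :=
  split_at_point hf p0 (rational_param_nonconstant p Hf).
have ec := mult_at_uniq multm (multiplicity_over ef hC hg bf gp C0).
subst m; pose al := cross (constant_row p) gam.
have hal : form_row (d - c) al by have := form_row_cross (form_row_constant p) hg.
have bal : base_point_free al.
  move=> x x0; rewrite ev_cross ev_constant.
  by apply: cross_point_neq0 => //; apply: gp.
have sal : dot al f = 0.
  rewrite ef dotDr !dotZr !(dotC al) dot_crossl dot_crossr !mulr0 addr0 //.
have minf := splitting_type_min (_ : k <= d - k)%N spl.
have {}minf : min_syzygy_degree k f by apply: minf; lia.
have al0 := bpf_neq0 bal.
have lek : (k <= d - c)%N by apply: (proj2 minf _ al) => //; apply/syzygyP.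
suff ek : (d - c)%N = k.
  exists al; split; rewrite -?ek //; first by apply/syzygyP.
  split=> //; exists (constant_row p).
    apply: contraNneq p0 => e.
    have [x x0] := point_exists K.
    by rewrite -(ev_constant p x) e ev0.
  by apply/syzygyP; split; [exact: form_row_constant|exact: dot_crossl].
have [lt|ge] := ltnP (d - c) (d - k); last by lia.
have [[a a0 sa] _] := minf.
have ba := min_syzygy_bpf minf a0 sa.
move/syzygyP: sa => [ha saf].
have [b hb eb] := complementary_syzygy hf bf ha ba saf le2.
have bab : base_point_free (cross a b) by rewrite eb.
have := homog_syzygy_decomposition ha hb bab hal; rewrite eb.
move=> /(_ sal)[x [y [hx hy ey _ /(_ lt) y0]]].
move: ey bal; rewrite y0 scale0r addr0 => -> /form_neq0_of_bpf nz.
have [] := form_no_zero hx nz; lia.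
Qed.

End Ascenzi.

(** * Zariski tangent spaces *)

Section Tangents.
Variables (K : closedFieldType).

Section Composition.
Variables m n : nat.
Implicit Types (P : {mpoly K[m]}) (L : 'I_m -> {mpoly K[n]}).

Definition subst L P : {mpoly K[n]} := mmap (@mpolyC n K) L P.

Lemma meval_subst L P (v : 'I_n -> K) :
  (subst L P).@[v] = P.@[fun i => (L i).@[v]].
Proof.
apply: (mpoly_ind_ring (P := fun P => (subst L P).@[v] = P.@[fun i => (L i).@[v]]))
  => [c|i|F G|F G].
- by rewrite /subst mmapC /= !mevalC.
- by rewrite /subst mmapXU mevalXU.
- by move=> e e'; rewrite /subst rmorphD !mevalD /= -e -e'.
- by move=> e e'; rewrite /subst rmorphM !mevalM /= -e -e'.
Qed.

Lemma subst_homog d r L P : P \is d.-homog -> (forall i, L i \is r.-homog) ->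
  subst L P \is (d * r).-homog.
Proof.
move=> /dhomogP hP hL; rewrite /subst /mmap big_seq; apply: rpred_sum => mm mP.
rewrite mul_mpolyC; apply: rpredZ; have <- : mdeg mm = d := hP mm mP.
rewrite mdegE /mmap1 big_distrl /=; elim/big_ind2: _ => [|x e y f hx hy|i _].
- exact: dhomog1.
- exact: dhomogM.
- by rewrite mulnC; apply: dhomogMn.
Qed.

End Composition.

Section Derivative.
Variable n : nat.
Implicit Types (F G : {mpoly K[n]}) (p v w : 'rV[K]_n).

Definition dirD F p v : K := \sum_i (F^`M(i)).@[p 0] * v 0 i.

Lemma dirDD F G p v : dirD (F + G) p v = dirD F p v + dirD G p v.
Proof.
rewrite /dirD -big_split /=; apply: eq_bigr => i _.
by rewrite mderivD mevalD mulrDl.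
Qed.

Lemma dirDN F p v : dirD (- F) p v = - dirD F p v.
Proof.
rewrite /dirD -sumrN; apply: eq_bigr => i _.
by rewrite mderivN mevalN mulNr.
Qed.

Lemma dirDM F G p v :
  dirD (F * G) p v = dirD F p v * G.@[p 0] + F.@[p 0] * dirD G p v.
Proof.
rewrite /dirD mulr_suml mulr_sumr -big_split /=; apply: eq_bigr => i _.
by rewrite mderivM mevalD !mevalM; ring.
Qed.

Lemma dirDC c p v : dirD c%:MP p v = 0.
Proof. by rewrite /dirD big1 // => i _; rewrite mderivC meval0 mul0r. Qed.

Lemma dirDX_eq0 e F p v : dirD F p v = 0 -> dirD (F ^+ e) p v = 0.
Proof.
move=> d0; elim: e => [|e IH]; first by rewrite expr0 -mpolyC1 dirDC.
by rewrite exprS dirDM d0 IH mul0r mulr0 addr0.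
Qed.

Lemma dirD_subst0 m (L : 'I_m -> {mpoly K[n]}) P p v :
  (forall i, dirD (L i) p v = 0) -> dirD (subst L P) p v = 0.
Proof.
move=> d0.
apply: (mpoly_ind_ring (P := fun P => dirD (subst L P) p v = 0)) => [c|i|F G|F G].
- by rewrite /subst mmapC /= dirDC.
- by rewrite /subst mmapXU.
- by move=> e e'; rewrite /subst rmorphD dirDD /= -/(subst L F) e -/(subst L G) e' addr0.
- by move=> e e'; rewrite /subst rmorphM dirDM /= -/(subst L F) e -/(subst L G) e' mul0r mulr0 addr0.
Qed.

Lemma dirD_lin F p a v w : dirD F p (a *: v + w) = a * dirD F p v + dirD F p w.
Proof.
rewrite /dirD mulr_sumr -big_split /=; apply: eq_bigr => i _.
by rewrite !mxE; ring.
Qed.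

Definition linear_form (c : 'cV[K]_n) : {mpoly K[n]} := \sum_i c i 0 *: 'X_i.

Lemma linear_form_homog c : linear_form c \is 1.-homog.
Proof. by apply: rpred_sum => i _; apply/rpredZ/dhomogXU. Qed.

Lemma meval_linear_form c p : (linear_form c).@[p 0] = (p *m c) 0 0.
Proof.
rewrite /linear_form raddf_sum mxE /=; apply: eq_bigr => i _.
by rewrite mevalZ mevalXU mulrC.
Qed.

Lemma dirD_linear_form c p v : dirD (linear_form c) p v = (v *m c) 0 0.
Proof.
rewrite /dirD mxE; apply: eq_bigr => i _; rewrite mulrC; congr (_ * _).
rewrite /linear_form (linear_sum (mderiv i)) /= (rmorph_sum (meval (p 0))) /=.
rewrite (bigD1 i) //= big1 ?addr0.
  rewrite mderivZ mderivX mnm1E eqxx scale1r -{1}[U_(i)%MM]add0m addmK.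
  by rewrite mpolyX0 mevalZ meval1 mulr1.
move=> j ji; rewrite mderivZ mderivX mnm1E (negPf ji) scale0r scaler0.
exact: meval0.
Qed.

End Derivative.

Section TangentSpace.
Variables (n : nat) (X : pset K n).
Implicit Types (p v w : 'rV[K]_n.+1).

Lemma tangent0 p : tangent X p 0.
Proof. by move=> e F _ _; rewrite big1 // => i _; rewrite mxE mulr0. Qed.

Lemma tangent_lin p a v w : tangent X p v -> tangent X p w ->
  tangent X p (a *: v + w).
Proof.
move=> tv tw e F hF F0; have := dirD_lin F p a v w; rewrite /dirD => ->.
by rewrite (tv e F hF F0) (tw e F hF F0) mulr0 addr0.
Qed.

(** A form vanishing on X vanishes along the arc, and its differential applied
    to the velocity of the arc is the linear term of its restriction. Finitely
    many parameters, the zeros of q, are left out since an arc of vectors may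
    pass through 0. *)
Lemma tangent_arc (P : 'rV[{poly K}]_n.+1) (q : {poly K}) : q != 0 ->
  (forall c, q.[c] != 0 -> X (\row_i (P 0 i).[c])) ->
  tangent X (\row_i (P 0 i)`_0) (\row_i (P 0 i)`_1).
Proof.
move=> q0 HX e F _ F0.
pose FP := mmap polyC (P 0) F.
have FPc c : FP.[c] = F.@[fun i => (P 0 i).[c]] := horner_mmap _ _ _.
have FP0 : FP = 0.
  apply/eqP; rewrite -(mulIr_eq0 _ (mulIf q0)); apply: contraT.
  move=> /closed_nonrootP[c]; rewrite /root hornerM.
  have [->|qc] := eqVneq q.[c] 0; first by rewrite mulr0 eqxx.
  rewrite FPc (_ : F.@[_] = 0) ?mul0r ?eqxx //.
  rewrite -[RHS](F0 _ (HX c qc)); apply: meval_eq => i; by rewrite mxE.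
pose a i := (P 0 i)`_0; pose w i := drop_poly 1 (P 0 i).
have eP i : P 0 i = (a i)%:P + 'X * w i.
  rewrite -{1}(poly_take_drop 1 (P 0 i)) mulrC expr1; congr (_ + _).
  apply/polyP=> j; rewrite coef_take_poly coefC /a.
  by case: j.
have [r er] := mmap_taylor polyC F 'X (fun i => (a i)%:P) w.
have ev0 G : mmap polyC (fun i => (a i)%:P) G = (G.@[a])%:P := mmap_point polyC G a.
have := congr1 (fun p : {poly K} => p`_1) er.
rewrite -(eq_mmap _ _ eP) -/FP FP0 coef0 !coefD ev0 coefC /= add0r.
rewrite coefXM /= (_ : ('X^2 * r)`_1 = 0) ?addr0; last by rewrite coefXnM.
move=> e1; rewrite [RHS]e1 coef_sum; apply: eq_bigr => i _.
rewrite ev0 coefCM coef_drop_poly mxE add0n; congr (_ * _).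
by apply: meval_eq => j; rewrite mxE.
Qed.

End TangentSpace.
End Tangents.

(** * Rational normal curves *)

Section Veronese.

Definition vrow (R : comNzRingType) m (a b : R) : 'rV[R]_m.+1 :=
  \row_(i < m.+1) (a ^+ (m - i) * b ^+ i).

(** The entries of qrow m a b are the common factors of consecutive entries of
    vrow m a b, which are in the ratio a : b. *)
Definition qrow (R : comNzRingType) m (a b : R) : 'rV[R]_m :=
  \row_(j < m) (a ^+ (m.-1 - j) * b ^+ j).

Definition lower (R : Type) m (v : 'rV[R]_m.+1) : 'rV[R]_m :=
  \row_j v 0 (widen_ord (leqnSn m) j).
Definition upper (R : Type) m (v : 'rV[R]_m.+1) : 'rV[R]_m :=
  \row_j v 0 (lift ord0 j).

Variable R : comNzRingType.

Lemma lower_vrow m (a b : R) : lower (vrow m a b) = a *: qrow m a b.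
Proof.
apply/rowP=> j; rewrite !mxE mulrA -exprS /=; congr (_ ^+ _ * _).
by have := ltn_ord j; lia.
Qed.

Lemma upper_vrow m (a b : R) : upper (vrow m a b) = b *: qrow m a b.
Proof.
apply/rowP=> j; rewrite !mxE mulrCA -exprS /=; congr (_ ^+ _ * _).
by rewrite /bump /=; have := ltn_ord j; lia.
Qed.

Lemma lowerZ m c (v : 'rV[R]_m.+1) : lower (c *: v) = c *: lower v.
Proof. by apply/rowP=> j; rewrite !mxE. Qed.
Lemma upperZ m c (v : 'rV[R]_m.+1) : upper (c *: v) = c *: upper v.
Proof. by apply/rowP=> j; rewrite !mxE. Qed.

Lemma map_vrow (R' : comNzRingType) (f : {rmorphism R -> R'}) m (a b : R) :
  map_mx f (vrow m a b) = vrow m (f a) (f b).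
Proof. by apply/rowP=> j; rewrite !mxE rmorphM !rmorphXn. Qed.

End Veronese.

Section VeronesePoints.
Variable K : closedFieldType.
Implicit Types x y : 'rV[K]_2.

Lemma veroneseE m x : veronese m x = vrow m (x 0 0) (x 0 1).
Proof. by []. Qed.

Lemma veronese_neq0 m x : x != 0 -> veronese m x != 0.
Proof.
move=> /row2_neq0[xn|xn]; apply/eqP => /rowP e; move/eqP: xn; apply.
  have := e ord0; rewrite !mxE /= expr0 mulr1 subn0 => /eqP.
  by rewrite expf_eq0 => /andP[_ /eqP].
have := e ord_max; rewrite !mxE /= subnn expr0 mul1r => /eqP.
by rewrite expf_eq0 => /andP[_ /eqP].
Qed.

Lemma qrow_neq0 m x : x != 0 -> (0 < m)%N -> qrow m (x 0 0) (x 0 1) != 0.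
Proof.
case: m => // m x0 _; have := veronese_neq0 m x0.
by apply: contra => /eqP/rowP e; apply/eqP/rowP=> j; rewrite -[RHS](e j) !mxE.
Qed.

(** Each entry determines the next one, or, for x at infinity, all entries but
    the last one vanish. *)
Lemma consecutive_ratio m x (v : 'rV[K]_m.+1) : x != 0 ->
  x 0 0 *: upper v = x 0 1 *: lower v -> exists a, v = a *: veronese m x.
Proof.
move=> x0 /rowP e.
have eI (i : nat) (lt1 : (i < m.+1)%N) (lt2 : (i.+1 < m.+1)%N) :
    x 0 0 * v 0 (Ordinal lt2) = x 0 1 * v 0 (Ordinal lt1).
  have lt : (i < m)%N by rewrite -ltnS.
  have := e (Ordinal lt); rewrite !mxE.
  rewrite (_ : lift _ _ = Ordinal lt2); last by apply: val_inj.
  by rewrite (_ : widen_ord _ _ = Ordinal lt1) //; apply: val_inj.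
have [x00|xn] := eqVneq (x 0 0) 0.
  have xn : x 0 1 != 0 by have [|//] := row2_neq0 x0; rewrite x00 eqxx.
  exists (v 0 ord_max / x 0 1 ^+ m); apply/rowP=> -[i lt]; rewrite !mxE /= x00.
  have [im|ne] := eqVneq i m.
    have -> : Ordinal lt = ord_max by apply: val_inj.
    by rewrite im subnn expr0 mul1r divfK ?expf_neq0.
  have lt2 : (i.+1 < m.+1)%N by lia.
  have /eqP := eI i lt lt2; rewrite x00 mul0r eq_sym mulf_eq0 (negPf xn) /= => /eqP->.
  by rewrite expr0n (_ : (m - i == 0)%N = false) ?mul0r ?mulr0 //; lia.
exists (v 0 ord0 / x 0 0 ^+ m); apply/rowP=> -[i lt]; rewrite !mxE /=.
elim: i lt => [|i IH] lt.
  rewrite subn0 expr0 mulr1 divfK ?expf_neq0 //; congr (v 0 _).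
  exact: val_inj.
have lt1 : (i < m.+1)%N by lia.
apply: (mulfI xn); rewrite (eI i lt1 lt) IH.
have -> : (m - i = (m - i.+1).+1)%N by lia.
by rewrite !exprS; ring.
Qed.

Lemma veronese_inj m x y a b : x != 0 -> y != 0 -> (0 < m)%N -> a != 0 ->
  a *: veronese m x = b *: veronese m y -> (x == y)%MS.
Proof.
move=> x0 y0 m0 a0 e.
have := congr1 (@upper K m) e; have := congr1 (@lower K m) e.
rewrite !upperZ !lowerZ !veroneseE !upper_vrow !lower_vrow.
set q := qrow m (x 0 0) _; set r := qrow m (y 0 0) _ => el eu.
rewrite same_point2 // -subr_eq0; have q0 : q != 0 by apply: qrow_neq0.
have : (x 0 0 * y 0 1 - x 0 1 * y 0 0) *: (a *: q) = 0.
  have -> : (x 0 0 * y 0 1 - x 0 1 * y 0 0) *: (a *: q)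
    = y 0 1 *: (a *: (x 0 0 *: q)) - y 0 0 *: (a *: (x 0 1 *: q)).
    by rewrite !scalerA -scalerBl; congr (_ *: _); ring.
  by rewrite el eu !scalerA -scalerBl; apply/eqP; rewrite scaler_eq0; apply/orP; left; apply/eqP; ring.
by move/eqP; rewrite !scaler_eq0 (negPf a0) (negPf q0) !orbF.
Qed.

End VeronesePoints.

(** * Scrolls *)

(** Points of a scroll are considered over extensions of K; those with
    coordinates in K are the points over the trivial extension. *)
Definition idr (K : closedFieldType) : {rmorphism K -> K} := idfun.

Section Frame.
Variables (K : closedFieldType) (k h : nat).
Variables (G1 : 'M[K]_(h.+1, k.+2)) (G2 : 'M[K]_((k - h).+1, k.+2)).

(** The inverse of the frame gives the coordinates on the two directrices. *)
Lemma dual_frame : (h <= k)%N -> scroll_frame G1 G2 ->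
  exists (R1 : 'M[K]_(k.+2, h.+1)) (R2 : 'M[K]_(k.+2, (k - h).+1)),
    [/\ G1 *m R1 = 1%:M, G1 *m R2 = 0, G2 *m R1 = 0, G2 *m R2 = 1%:M
      & R1 *m G1 + R2 *m G2 = 1%:M].
Proof.
move=> hk fr; set G := col_mx G1 G2; pose R := pinvmx G.
have GR : G *m R = 1%:M by apply: mulmxVp.
have full : row_full G by rewrite /row_full (eqP fr); apply/eqP; lia.
have RG : R *m G = 1%:M by apply: mulVpmx.
pose A := @lsubmx K k.+2 h.+1 (k - h).+1 R.
pose B := @rsubmx K k.+2 h.+1 (k - h).+1 R.
have eR : R = row_mx A B by rewrite hsubmxK.
have : block_mx (G1 *m A) (G1 *m B) (G2 *m A) (G2 *m B) = block_mx 1%:M 0 0 1%:M.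
  by rewrite -mul_col_row -eR -[RHS]scalar_mx_block.
case/eq_block_mx => e1 e2 e3 e4; exists A, B; split=> //.
by rewrite -mul_row_col -eR.
Qed.

Variables (R1 : 'M[K]_(k.+2, h.+1)) (R2 : 'M[K]_(k.+2, (k - h).+1)).
Hypotheses (G1R1 : G1 *m R1 = 1%:M) (G1R2 : G1 *m R2 = 0).
Hypotheses (G2R1 : G2 *m R1 = 0) (G2R2 : G2 *m R2 = 1%:M).
Hypothesis (RG : R1 *m G1 + R2 *m G2 = 1%:M).

Section OverRing.
Variables (R : comNzRingType) (f : {rmorphism K -> R}).

(** The point of the fiber over (s, t) with coordinates U, V in the basis given
    by the points of the two directrices. *)
Definition spoint (U V s t : R) : 'rV[R]_k.+2 :=
  U *: (vrow h s t *m map_mx f G1) + V *: (vrow (k - h) s t *m map_mx f G2).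

Lemma spoint_R1 U V s t : spoint U V s t *m map_mx f R1 = U *: vrow h s t.
Proof.
rewrite mulmxDl -!scalemxAl -!mulmxA -!map_mxM G1R1 G2R1 map_mx1 map_mx0.
by rewrite mulmx0 scaler0 addr0 mulmx1.
Qed.

Lemma spoint_R2 U V s t : spoint U V s t *m map_mx f R2 = V *: vrow (k - h) s t.
Proof.
rewrite mulmxDl -!scalemxAl -!mulmxA -!map_mxM G1R2 G2R2 map_mx1 map_mx0.
by rewrite mulmx0 scaler0 add0r mulmx1.
Qed.

Lemma coords_inj (v w : 'rV[R]_k.+2) : v *m map_mx f R1 = w *m map_mx f R1 ->
  v *m map_mx f R2 = w *m map_mx f R2 -> v = w.
Proof.
move=> e1 e2; rewrite -[v]mulmx1 -[w]mulmx1 -(map_mx1 f) -RG map_mxD !map_mxM.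
by rewrite !mulmxDr !mulmxA e1 e2.
Qed.

(** On each directrix all coordinates but the last, and all but the first: on
    the fiber over (s, t) they are in the ratio s : t, and their common factors
    are collected in ratios. *)
Definition lows (v : 'rV[R]_k.+2) : 'rV[R]_(h + (k - h)) :=
  row_mx (lower (v *m map_mx f R1)) (lower (v *m map_mx f R2)).
Definition highs (v : 'rV[R]_k.+2) : 'rV[R]_(h + (k - h)) :=
  row_mx (upper (v *m map_mx f R1)) (upper (v *m map_mx f R2)).
Definition ratios (U V s t : R) : 'rV[R]_(h + (k - h)) :=
  row_mx (U *: qrow h s t) (V *: qrow (k - h) s t).

Lemma lows_spoint U V s t : lows (spoint U V s t) = s *: ratios U V s t.
Proof.
rewrite /lows spoint_R1 spoint_R2 !lowerZ !lower_vrow scale_row_mx.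
by rewrite !scalerA ![_ * s]mulrC.
Qed.

Lemma highs_spoint U V s t : highs (spoint U V s t) = t *: ratios U V s t.
Proof.
rewrite /highs spoint_R1 spoint_R2 !upperZ !upper_vrow scale_row_mx.
by rewrite !scalerA ![_ * t]mulrC.
Qed.

End OverRing.

Notation spt u v x := (spoint (idr K) u v (x 0 0) (x 0 1)).

Lemma map_mx_idfun m n (A : 'M[K]_(m, n)) : map_mx (idr K) A = A.
Proof. by apply/matrixP=> i j; rewrite mxE. Qed.

Lemma sptE u v (x : 'rV[K]_2) :
  spt u v x = u *: (veronese h x *m G1) + v *: (veronese (k - h) x *m G2).
Proof. by rewrite /spoint !map_mx_idfun. Qed.

Lemma fiberP (x : 'rV[K]_2) p :
  fiber G1 G2 x p <-> p != 0 /\ exists u v, p = spt u v x.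
Proof.
split=> -[p0 H]; split=> //.
  have [[a b] /= ->] := sub_addsmxP H.
  exists (a 0 0), (b 0 0); rewrite sptE {1}[a]mx11_scalar {1}[b]mx11_scalar.
  by rewrite !mul_scalar_mx.
have [u [v ->]] := H; rewrite sptE; apply/sub_addsmxP.
by exists (u%:M, v%:M); rewrite !mul_scalar_mx.
Qed.

Lemma spt_eq0 u v (x : 'rV[K]_2) : x != 0 -> spt u v x = 0 -> u = 0 /\ v = 0.
Proof.
move=> x0 e; split; apply/eqP.
  have := spoint_R1 (idr K) u v (x 0 0) (x 0 1); rewrite e mul0mx => /esym/eqP.
  by rewrite scaler_eq0 (negPf (veronese_neq0 h x0)) orbF.
have := spoint_R2 (idr K) u v (x 0 0) (x 0 1); rewrite e mul0mx => /esym/eqP.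
by rewrite scaler_eq0 (negPf (veronese_neq0 (k - h) x0)) orbF.
Qed.

(** The coordinates of a point on a directrix form a multiple of the Veronese
    point of its fiber, and determine the fiber if that multiple is nonzero and
    the directrix is not the vertex. *)
Lemma fiber_uniq u v u' v' (x y : 'rV[K]_2) : x != 0 -> y != 0 ->
  ((0 < h)%N && (u != 0)) || ((0 < k - h)%N && (v != 0)) ->
  spt u v x = spt u' v' y -> (x == y)%MS.
Proof.
move=> x0 y0 n0 e; case/orP: n0 => /andP[m0 n0].
  apply: (veronese_inj x0 y0 m0 n0 (b := u')).
  by have := spoint_R1 (idr K) u v (x 0 0) (x 0 1); rewrite e spoint_R1 => <-.
apply: (veronese_inj x0 y0 m0 n0 (b := v')).
by have := spoint_R2 (idr K) u v (x 0 0) (x 0 1); rewrite e spoint_R2 => <-.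
Qed.

Lemma map_spoint (R R' : comNzRingType) (f : {rmorphism K -> R})
    (f' : {rmorphism K -> R'}) (g : {rmorphism R -> R'}) U V s t :
  (forall a, g (f a) = f' a) ->
  map_mx g (spoint f U V s t) = spoint f' (g U) (g V) (g s) (g t).
Proof.
move=> gf; have e m n (A : 'M[K]_(m, n)) : map_mx g (map_mx f A) = map_mx f' A.
  by apply/matrixP=> i j; rewrite !mxE gf.
by rewrite /spoint map_mxD !map_mxZ !map_mxM /= !map_vrow !e.
Qed.

Lemma map_ratios (R R' : comNzRingType) (g : {rmorphism R -> R'}) U V s t :
  map_mx g (ratios U V s t) = ratios (g U) (g V) (g s) (g t).
Proof.
rewrite /ratios map_row_mx !map_mxZ; congr (row_mx (_ *: _) (_ *: _));
by apply/rowP=> j; rewrite !mxE rmorphM !rmorphXn.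
Qed.

(** ** Tangent spaces of subsets of a scroll *)

Definition Lows := row_mx (\matrix_(i, j) R1 i (widen_ord (leqnSn h) j))
                          (\matrix_(i, j) R2 i (widen_ord (leqnSn (k - h)) j)).
Definition Highs := row_mx (\matrix_(i < k.+2, j < h) R1 i (lift ord0 j))
                           (\matrix_(i < k.+2, j < k - h) R2 i (lift ord0 j)).

Lemma lowsE (R : comNzRingType) (f : {rmorphism K -> R}) v :
  lows f v = v *m map_mx f Lows.
Proof.
rewrite /lows /Lows map_row_mx mul_mx_row; congr row_mx;
by apply/rowP=> j; rewrite !mxE; apply: eq_bigr => i _; rewrite !mxE.
Qed.

Lemma highsE (R : comNzRingType) (f : {rmorphism K -> R}) v :
  highs f v = v *m map_mx f Highs.
Proof.
rewrite /highs /Highs map_row_mx mul_mx_row; congr row_mx;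
by apply/rowP=> j; rewrite !mxE; apply: eq_bigr => i _; rewrite !mxE.
Qed.

(** The deviation of w from the fiber over (s, t): it vanishes on that fiber. *)
Definition deviation (R : comNzRingType) (f : {rmorphism K -> R}) (s t : R) w :=
  s *: highs f w - t *: lows f w.

Lemma deviation_spoint (R : comNzRingType) (f : {rmorphism K -> R}) U V a b s t :
  deviation f a b (spoint f U V s t) = (a * t - b * s) *: ratios U V s t.
Proof.
by rewrite /deviation highs_spoint lows_spoint !scalerA -scalerBl.
Qed.

Lemma deviation_lin a (w w' : 'rV[K]_k.+2) s t :
  deviation (idr K) s t (a *: w + w') =
  a *: deviation (idr K) s t w + deviation (idr K) s t w'.
Proof.
rewrite /deviation !highsE !lowsE !mulmxDl -!scalemxAl !scalerDr !scalerA.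
by rewrite scalerN !scalerA ![_ * a]mulrC opprD addrACA.
Qed.

Lemma deviation_eq0 (x : 'rV[K]_2) w : x != 0 ->
  deviation (idr K) (x 0 0) (x 0 1) w = 0 -> exists u v, w = spt u v x.
Proof.
move=> x0 /eqP; rewrite subr_eq0 /highs /lows !scale_row_mx => /eqP.
move=> /eq_row_mx[e1 e2].
have [u eu] := consecutive_ratio x0 e1; have [v ev] := consecutive_ratio x0 e2.
exists u, v; apply: (coords_inj (f := (idr K))); first by rewrite spoint_R1.
by rewrite spoint_R2.
Qed.

Section TangentBound.
Variable X : pset K k.+1.
Hypothesis XS : forall p, X p -> scroll G1 G2 p.

(** The quadrics cutting out the scroll confine the deviation of a tangent
    vector to a line. *)
Lemma tangent_deviation u v (x : 'rV[K]_2) w :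
  ratios u v (x 0 0) (x 0 1) != 0 -> tangent X (spt u v x) w ->
  exists c, deviation (idr K) (x 0 0) (x 0 1) w = c *: ratios u v (x 0 0) (x 0 1).
Proof.
set Q := ratios _ _ _ _; set D := deviation _ _ _ _ => Q0 tw.
pose lo i := linear_form (col i Lows); pose hi i := linear_form (col i Highs).
have loE i (p : 'rV[K]_k.+2) : (lo i).@[p 0] = (lows (idr K) p) 0 i.
  by rewrite meval_linear_form lowsE map_mx_idfun colE mulmxA -colE mxE.
have hiE i (p : 'rV[K]_k.+2) : (hi i).@[p 0] = (highs (idr K) p) 0 i.
  by rewrite meval_linear_form highsE map_mx_idfun colE mulmxA -colE mxE.
have dloE i p : dirD (lo i) p w = (lows (idr K) w) 0 i.
  by rewrite dirD_linear_form -meval_linear_form loE.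
have dhiE i p : dirD (hi i) p w = (highs (idr K) w) 0 i.
  by rewrite dirD_linear_form -meval_linear_form hiE.
have par i j : Q 0 i * D 0 j = Q 0 j * D 0 i.
  pose F := lo i * hi j - hi i * lo j.
  have hF : F \is 2.-homog.
    by apply: rpredB; apply: (@dhomogM _ _ _ 1 _ 1); apply: linear_form_homog.
  have FX q : X q -> F.@[q 0] = 0.
    move=> /XS[y y0 /fiberP[_ [u' [v' ->]]]].
    rewrite mevalB !mevalM !loE !hiE lows_spoint highs_spoint !mxE; ring.
  have : dirD F (spt u v x) w = 0 := tw _ F hF FX.
  rewrite dirDD dirDN !dirDM !dloE !dhiE !loE !hiE lows_spoint highs_spoint -/Q.
  rewrite [(_ *: Q) 0 i]mxE [(_ *: Q) 0 j]mxE [(_ *: Q) 0 i]mxE [(_ *: Q) 0 j]mxE => e.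
  apply/eqP; rewrite -subr_eq0; apply/eqP; rewrite -[RHS]e /D /deviation.
  rewrite !mxE; ring.
have [i Qi] := row_neq0 Q0; exists (D 0 i / Q 0 i).
apply/rowP=> j; rewrite [RHS]mxE; apply: (mulfI Qi); rewrite par.
by field.
Qed.

End TangentBound.

(** ** Arcs on a scroll *)

Section Arcs.
Variables (x y : 'rV[K]_2) (U V : {poly K}).

(** The arc moves within the fibers by U and V, and across them along the line
    through x with direction y. *)
Definition sarc := spoint polyC U V ((x 0 0)%:P + y 0 0 *: 'X)
                                    ((x 0 1)%:P + y 0 1 *: 'X).

Lemma sarc_horner c :
  \row_i (sarc 0 i).[c] = spt U.[c] V.[c] (x + c *: y).
Proof.
have -> : \row_i (sarc 0 i).[c] = map_mx (horner_eval c) sarc.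
  by apply/rowP=> i; rewrite !mxE.
rewrite (map_spoint (f' := (idr K))); last by move=> a; exact: hornerC.
congr (spoint (idr K) _ _ _ _); rewrite /= /horner_eval ?hornerE // !mxE; ring.
Qed.

Lemma sarc_start : \row_i (sarc 0 i)`_0 = spt U`_0 V`_0 x.
Proof.
have := sarc_horner 0; rewrite scale0r addr0 !horner_coef0 => <-.
by apply/rowP=> i; rewrite !mxE horner_coef0.
Qed.

Lemma sarc_velocity :
  deviation (idr K) (x 0 0) (x 0 1) (\row_i (sarc 0 i)`_1) =
  (x 0 0 * y 0 1 - x 0 1 * y 0 0) *: ratios U`_0 V`_0 (x 0 0) (x 0 1).
Proof.
have co (M : 'M[K]_(k.+2, h + (k - h))) : (\row_i (sarc 0 i)`_1) *m M =
    \row_j ((sarc *m map_mx polyC M) 0 j)`_1.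
  apply/rowP=> j; rewrite !mxE coef_sum; apply: eq_bigr => i _.
  by rewrite !mxE coefMC.
have dev : deviation (idr K) (x 0 0) (x 0 1) (\row_i (sarc 0 i)`_1) =
    \row_j ((deviation polyC (x 0 0)%:P (x 0 1)%:P sarc) 0 j)`_1.
  rewrite /deviation !highsE !lowsE !map_mx_idfun !co.
  by apply/rowP=> j; rewrite !mxE coefB !coefCM.
rewrite dev deviation_spoint; apply/rowP=> j; rewrite [LHS]mxE [RHS]mxE.
rewrite [(_ *: ratios U V _ _) 0 j]mxE.
set r := ratios U V _ _ 0 j; set r' := ratios _ _ _ _ 0 j.
have -> : r' = r`_0.
  have := map_ratios (horner_eval 0) U V ((x 0 0)%:P + y 0 0 *: 'X)
     ((x 0 1)%:P + y 0 1 *: 'X).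
  rewrite /= /horner_eval !hornerE ?mulr0 ?addr0 !horner_coef0 => /rowP/(_ j) e.
  by rewrite /r' -e mxE /horner_eval horner_coef0.
have -> : (x 0 0)%:P * ((x 0 1)%:P + y 0 1 *: 'X) - (x 0 1)%:P * ((x 0 0)%:P + y 0 0 *: 'X)
   = (x 0 0 * y 0 1 - x 0 1 * y 0 0)%:P * 'X :> {poly K}.
  by rewrite -!mul_polyC polyCB !polyCM; ring.
by rewrite -mulrA coefCM coefXM.
Qed.

End Arcs.

End Frame.

(** * Smoothness *)

Section SmoothAt.
Variables (K : closedFieldType) (n : nat) (X : pset K n) (p : 'rV[K]_n.+1).
Implicit Types v w z : 'rV[K]_n.+1.

Lemma smooth_at1 v w :
  (forall a b, a *: v + b *: w = 0 -> a = 0 /\ b = 0) ->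
  tangent X p v -> tangent X p w ->
  (forall z, tangent X p z -> exists a b, z = a *: v + b *: w) ->
  smooth_at 1 X p.
Proof.
move=> free tv tw span.
pose W : 'M[K]_(2, n.+1) := \matrix_(i, j) (if i == 0 then v 0 j else w 0 j).
have mulW (u : 'rV_2) : u *m W = u 0 0 *: v + u 0 1 *: w.
  apply/rowP=> j; rewrite !mxE !big_ord_recl big_ord0 !mxE /= addr0.
  by congr (_ + u 0 _ * _); apply: val_inj.
exists W.
  apply: inj_row_free => u; rewrite mulW => /free[e0 e1].
  by apply: row2P; rewrite mxE.
move=> z; split=> [/span[a [b ->]]|/submxP[u ->]].
  by apply/submxP; exists (pt a b); rewrite mulW pt0 pt1.
rewrite mulW; apply: tangent_lin => //; rewrite -[_ *: w]addr0.
by apply: tangent_lin => //; apply: tangent0.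
Qed.

Lemma smooth_at2 v w z :
  (forall a b c, a *: v + b *: w + c *: z = 0 -> [/\ a = 0, b = 0 & c = 0]) ->
  tangent X p v -> tangent X p w -> tangent X p z ->
  (forall y, tangent X p y -> exists a b c, y = a *: v + b *: w + c *: z) ->
  smooth_at 2 X p.
Proof.
move=> free tv tw tz span.
pose W : 'M[K]_(3, n.+1) := \matrix_(i, j)
  (if i == 0 then v 0 j else if i == 1 then w 0 j else z 0 j).
have mulW (u : 'rV_3) : u *m W = u 0 0 *: v + u 0 1 *: w + u 0 ord_max *: z.
  apply/rowP=> j; rewrite !mxE !big_ord_recl big_ord0 !mxE /= addr0 addrA.
  by congr (_ + u 0 _ * _ + u 0 _ * _); apply: val_inj.
exists W.
  apply: inj_row_free => u; rewrite mulW => /free[e0 e1 e2].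
  by apply: row3P; rewrite mxE.
move=> y; split=> [/span[a [b [c ->]]]|/submxP[u ->]].
  apply/submxP; exists (\row_i (if i == 0 then a else if i == 1 then b else c)).
  by rewrite mulW !mxE.
rewrite mulW -addrA; apply: tangent_lin => //; apply: tangent_lin => //.
rewrite -[_ *: z]addr0.
by apply: tangent_lin => //; apply: tangent0.
Qed.

End SmoothAt.

Section ScrollSmoothness.
Variables (K : closedFieldType) (k h : nat).
Variables (G1 : 'M[K]_(h.+1, k.+2)) (G2 : 'M[K]_((k - h).+1, k.+2)).
Variables (R1 : 'M[K]_(k.+2, h.+1)) (R2 : 'M[K]_(k.+2, (k - h).+1)).
Hypotheses (G1R1 : G1 *m R1 = 1%:M) (G1R2 : G1 *m R2 = 0).
Hypotheses (G2R1 : G2 *m R1 = 0) (G2R2 : G2 *m R2 = 1%:M).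
Hypothesis (RG : R1 *m G1 + R2 *m G2 = 1%:M).
Implicit Types x y : 'rV[K]_2.
Local Notation spt u v x := (spoint G1 G2 (idr K) u v (x 0 0) (x 0 1)).
Local Notation dev x w := (deviation R1 R2 (idr K) (x 0 0) (x 0 1) w).
Local Notation ratio u v x := (ratios k h u v (x 0 0) (x 0 1)).

Lemma spt_basis u v x : spt u v x = u *: spt 1 0 x + v *: spt 0 1 x.
Proof.
by rewrite !sptE !scale1r !scale0r addr0 add0r.
Qed.

Lemma dev_spt u v x : dev x (spt u v x) = 0.
Proof.
by rewrite (deviation_spoint G1R1 G1R2 G2R1 G2R2) mulrC subrr scale0r.
Qed.

Lemma dev0 x : dev x 0 = 0.
Proof. by rewrite -(dev_spt 0 0 x) sptE !scale0r addr0. Qed.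

Lemma scroll_spt u v x : x != 0 -> (u != 0) || (v != 0) ->
  scroll G1 G2 (spt u v x).
Proof.
move=> x0 n0; exists x => //; apply/fiberP; split; last by exists u, v.
apply: contraTneq n0 => /(spt_eq0 G1R1 G1R2 G2R1 G2R2 x0)[-> ->].
by rewrite eqxx.
Qed.

Lemma ratio_neq0 u v x : x != 0 ->
  ((0 < h)%N && (u != 0)) || ((0 < k - h)%N && (v != 0)) -> ratio u v x != 0.
Proof.
move=> x0 n0; apply/eqP; rewrite /ratios -(row_mx0 _ _ h (k - h)) => /eq_row_mx[/eqP + /eqP].
rewrite !scaler_eq0; case/orP: n0 => /andP[m0 n0].
  by rewrite (negPf n0) (negPf (qrow_neq0 x0 m0)).
by rewrite (negPf n0) (negPf (qrow_neq0 x0 m0)).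
Qed.

Lemma transversal_vector x : x != 0 -> exists y, x 0 0 * y 0 1 - x 0 1 * y 0 0 != 0.
Proof.
move=> /row2_neq0[xn|xn].
  by exists (pt 0 1); rewrite pt0 pt1 mulr1 mulr0 subr0.
by exists (pt 1 0); rewrite pt0 pt1 mulr1 mulr0 sub0r oppr_eq0.
Qed.

Lemma moving_point x y c : x 0 0 * y 0 1 - x 0 1 * y 0 0 != 0 -> x + c *: y != 0.
Proof.
apply: contraNneq => e; have e0 : x 0 0 = - c * y 0 0.
  by apply/eqP; rewrite mulNr -addr_eq0; have /rowP/(_ 0) := e; rewrite !mxE => ->.
have e1 : x 0 1 = - c * y 0 1.
  by apply/eqP; rewrite mulNr -addr_eq0; have /rowP/(_ 1) := e; rewrite !mxE => ->.
by rewrite e0 e1; apply/eqP; ring.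
Qed.

Lemma fixed_fiber_velocity x U V :
  \row_i (sarc G1 G2 x 0 U V 0 i)`_1 = spt U`_1 V`_1 x.
Proof.
apply/rowP=> i; rewrite mxE /sarc !mxE !scale0r !addr0 coefD /spoint.
have e m (G : 'M[K]_(m.+1, k.+2)) : \sum_j vrow m (x 0 0)%:P (x 0 1)%:P 0 j * map_mx polyC G j i
    = ((vrow m (x 0 0) (x 0 1) *m G) 0 i)%:P.
  rewrite mxE rmorph_sum /=; apply: eq_bigr => j _.
  by rewrite !mxE !polyCM !rmorphXn.
by rewrite !e !coefMC !map_mx_idfun [in LHS]mxE [X in _ + V`_1 * X = _]mxE.
Qed.

(** The tangent space at a point is spanned by the fiber and by the velocity of an
    arc transversal to it. *)
Lemma smooth_scroll : (0 < h)%N -> (0 < k - h)%N -> smooth 2 (scroll G1 G2).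
Proof.
move=> h0 kh0 p [x x0 /fiberP[p0 [u [v ep]]]].
have n0 : (u != 0) || (v != 0).
  apply: contraNT p0; rewrite negb_or !negbK => /andP[/eqP u0 /eqP v0].
  by rewrite ep u0 v0 sptE !scale0r addr0.
have Q0 : ratio u v x != 0 by apply: ratio_neq0; rewrite // h0 kh0.
have [y yx] := transversal_vector x0.
pose w := \row_i (sarc G1 G2 x y u%:P v%:P 0 i)`_1.
have devw : dev x w = (x 0 0 * y 0 1 - x 0 1 * y 0 0) *: ratio u v x.
  by rewrite (sarc_velocity G1R1 G1R2 G2R1 G2R2) !coefC.
apply: (smooth_at2 (v := spt 1 0 x) (w := spt 0 1 x) (z := w)).
- move=> a b c; rewrite -spt_basis addrC => e.
  have : dev x (c *: w + spt a b x) = 0 by rewrite e dev0.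
  rewrite deviation_lin dev_spt addr0 devw.
  move=> /eqP; rewrite !scaler_eq0 (negPf yx) (negPf Q0) !orbF => /eqP c0.
  move: e; rewrite c0 scale0r add0r => /(spt_eq0 G1R1 G1R2 G2R1 G2R2 x0)[-> ->].
  by [].
- have := @tangent_arc _ _ (scroll G1 G2) (sarc G1 G2 x 0 (u%:P + 'X) v%:P) ('X + u%:P).
  rewrite sarc_start fixed_fiber_velocity !coefD !coefC !coefX /= addr0 add0r -ep.
  apply; first by rewrite -size_poly_eq0 size_XaddC.
  move=> c; rewrite !hornerE => uc; rewrite sarc_horner scaler0 addr0 !hornerE.
  by apply: scroll_spt; rewrite // addrC uc.
- have := @tangent_arc _ _ (scroll G1 G2) (sarc G1 G2 x 0 u%:P (v%:P + 'X)) ('X + v%:P).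
  rewrite sarc_start fixed_fiber_velocity !coefD !coefC !coefX /= addr0 add0r -ep.
  apply; first by rewrite -size_poly_eq0 size_XaddC.
  move=> c; rewrite !hornerE => uc; rewrite sarc_horner scaler0 addr0 !hornerE.
  by apply: scroll_spt; rewrite // [v + c]addrC uc orbT.
- have := @tangent_arc _ _ (scroll G1 G2) (sarc G1 G2 x y u%:P v%:P) 1.
  rewrite sarc_start !coefC /= -ep; apply; first exact: oner_neq0.
  move=> c _; rewrite sarc_horner !hornerE; apply: scroll_spt => //.
  exact: moving_point.
move=> z; rewrite ep => tz.
have [c ec] := tangent_deviation G1R1 G1R2 G2R1 G2R2 (fun p => id) Q0 tz.
pose b := c / (x 0 0 * y 0 1 - x 0 1 * y 0 0).
have [|u' [v' e]] := deviation_eq0 G1R1 G1R2 G2R1 G2R2 RG x0 (w := - b *: w + z).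
  by rewrite deviation_lin ec devw scalerA -scalerDl mulNr divfK // addNr scale0r.
exists u', v', b; rewrite -spt_basis -e scaleNr addrAC addNr add0r //.
Qed.

(** Modulo the velocity w of a branch transversal to the fibers, tangent vectors
    lie in the fiber, where the differential of F leaves only the
    multiples of the point itself. *)
Lemma smooth_curve (D : pset K k.+1) u v x w F e :
  (forall p, D p -> scroll G1 G2 p) -> x != 0 -> ratio u v x != 0 ->
  tangent D (spt u v x) (spt u v x) -> tangent D (spt u v x) w ->
  (exists2 a, a != 0 & dev x w = a *: ratio u v x) ->
  F \is e.-homog -> (forall q, D q -> F.@[q 0] = 0) ->
  (u != 0 /\ dirD F (spt u v x) (spt 0 1 x) != 0) \/
  (v != 0 /\ dirD F (spt u v x) (spt 1 0 x) != 0) ->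
  smooth_at 1 D (spt u v x).
Proof.
set p := spt u v x => DS x0 Q0 tp tw [a a0 devw] hF FD nF.
have dp : dirD F p p = 0 := tp e F hF FD.
have dw : dirD F p w = 0 := tw e F hF FD.
have p0 : (u != 0) || (v != 0) by case: nF => -[->]; rewrite ?orbT.
apply: (smooth_at1 _ tp tw) => [b c|z tz].
  rewrite addrC => E.
  have : dev x (c *: w + b *: p) = 0 by rewrite E dev0.
  rewrite deviation_lin -[b *: p]addr0 deviation_lin dev_spt devw dev0.
  rewrite scaler0 !addr0 => /eqP; rewrite !scaler_eq0 (negPf a0) (negPf Q0) !orbF => /eqP c0.
  split=> //; move: E; rewrite c0 scale0r add0r => /eqP; rewrite scaler_eq0.
  case/orP=> [/eqP//|/eqP /(spt_eq0 G1R1 G1R2 G2R1 G2R2 x0)[u0 v0]].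
  by move: p0; rewrite u0 v0 eqxx.
have [c ec] := tangent_deviation G1R1 G1R2 G2R1 G2R2 DS Q0 tz.
have [|u' [v' E]] := deviation_eq0 G1R1 G1R2 G2R1 G2R2 RG x0 (w := - (c / a) *: w + z).
  by rewrite deviation_lin ec devw scalerA -scalerDl mulNr divfK // addNr scale0r.
have dz : dirD F p (spt u' v' x) = 0.
  by rewrite -E dirD_lin dw (tz e F hF FD : dirD F p z = 0) mulr0 addr0.
have lin b b' : dirD F p (spt b b' x) = b * dirD F p (spt 1 0 x) + b' * dirD F p (spt 0 1 x).
  rewrite spt_basis dirD_lin; congr (_ + _).
  rewrite -[b' *: _]addr0 dirD_lin [X in _ + X](_ : _ = 0) ?addr0 //.
  by rewrite /dirD big1 // => i _; rewrite mxE mulr0.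
rewrite lin in dz; have {}dp := etrans (esym (lin u v)) dp.
have ez : z = (c / a) *: w + spt u' v' x.
  by rewrite -E scaleNr addrA subrr add0r.
have key t : u' = t * u -> v' = t * v -> exists b c, z = b *: p + c *: w.
  move=> e1 e2; exists t, (c / a); rewrite ez addrC; congr (_ + _).
  by rewrite e1 e2 /p !sptE scalerDr !scalerA.
case: nF => -[un dn].
  apply: (key (u' / u)); first by rewrite divfK.
  apply: (mulIf dn); apply: (mulfI un).
  have -> : u * (u' / u * v * dirD F p (spt 0 1 x)) = u' * (v * dirD F p (spt 0 1 x)).
    by field.
  move/eqP: dp; rewrite addrC addr_eq0 => /eqP ->.
  move/eqP: dz; rewrite addrC addr_eq0 => /eqP ->; ring.
apply: (key (v' / v)); last by rewrite divfK.
apply: (mulIf dn); apply: (mulfI un).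
have -> : v * (v' / v * u * dirD F p (spt 1 0 x)) = v' * (u * dirD F p (spt 1 0 x)).
  by field.
move/eqP: dp; rewrite addr_eq0 => /eqP ->.
move/eqP: dz; rewrite addr_eq0 => /eqP ->; ring.
Qed.

End ScrollSmoothness.

(** * Unisecant curves on scrolls *)

Section ExtremeColumns.
Variables (K : closedFieldType) (n m : nat) (R : 'M[K]_(n, m.+1)) (z : 'I_2).

(** The coordinates of a Veronese point that are pure powers of one coordinate
    of the parameter do not vanish where the latter does not. *)
Lemma extreme_column : exists A : 'cV[K]_n, forall p u (x : 'rV[K]_2),
  p *m R = u *: vrow m (x 0 0) (x 0 1) -> (p *m A) 0 0 = u * x 0 z ^+ m.
Proof.
pose i : 'I_m.+1 := if z == 0 then ord0 else ord_max.
exists (col i R) => p u x e; rewrite colE mulmxA e -colE !mxE /i.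
case: (ord2_case z) => -> /=; first by rewrite subn0 mulr1.
by rewrite subnn mul1r.
Qed.

Lemma extreme_pair : (0 < m)%N -> exists L H : 'cV[K]_n, forall p u (x : 'rV[K]_2),
  p *m R = u *: vrow m (x 0 0) (x 0 1) ->
  (p *m L) 0 0 = u * x 0 z ^+ m.-1 * x 0 0 /\ (p *m H) 0 0 = u * x 0 z ^+ m.-1 * x 0 1.
Proof.
move=> m0; have [j ej] : exists j : 'I_m, forall (x : 'rV[K]_2),
    qrow m (x 0 0) (x 0 1) 0 j = x 0 z ^+ m.-1.
  case: m m0 => // m' _; exists (if z == 0 then ord0 else ord_max) => x.
  rewrite mxE; case: (ord2_case z) => -> /=; first by rewrite subn0 mulr1.
  by rewrite subnn mul1r.
exists (col (widen_ord (leqnSn m) j) R), (col (lift ord0 j) R) => p u x e.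
have elo := congr1 (fun w : 'rV[K]_m => w 0 j) (lower_vrow m (x 0 0) (x 0 1)).
have eup := congr1 (fun w : 'rV[K]_m => w 0 j) (upper_vrow m (x 0 0) (x 0 1)).
rewrite [LHS]mxE [RHS]mxE ej in elo; rewrite [LHS]mxE [RHS]mxE ej in eup.
have val i : (p *m col i R) 0 0 = u * vrow m (x 0 0) (x 0 1) 0 i.
  by rewrite colE mulmxA -colE e !mxE.
rewrite !val elo eup.
by split; ring.
Qed.

End ExtremeColumns.

Lemma vrow_vertex (K : fieldType) (R : comNzRingType) (f : {rmorphism K -> R})
    n h (G : 'M[K]_(h.+1, n)) (s t : R) : h = 0%N ->
  vrow h s t *m map_mx f G = map_mx f (row 0 G).
Proof.
move=> h0; subst h; apply/rowP=> j; rewrite !mxE big_ord1 !mxE.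
by rewrite !expr0 !mul1r.
Qed.

Lemma mderiv_homog (K : fieldType) n e (F : {mpoly K[n]}) i :
  F \is e.-homog -> F^`M(i) \is e.-1.-homog.
Proof.
move=> /dhomogP hF; apply/dhomogP => m; rewrite mcoeff_msupp mcoeff_deriv => mF.
have : (m + U_(i))%MM \in msupp F.
  by rewrite mcoeff_msupp; apply: contraNneq mF => ->; rewrite mul0rn.
by move/hF => /= e'; rewrite -e' mdegD mdeg1 addn1.
Qed.

Section Exponents.
Variables k h d : nat.
Hypotheses (h2k : (2 * h <= k)%N) (k2d : (2 * k <= d)%N).

(* The degree conditions on the equation of the curve given below, in its two
   instances: Q = B, m = k - 2h + 1, n = 0 and Q = C, m = 1, n = k - 2h. *)
Lemma degrees_eq1 : ((k - 2 * h).+1 + (d - (k - h)) = 1 + (d - h))%N.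
Proof. lia. Qed.

Lemma exponents_eq1 : (0 < h)%N ->
  (h.-1.+1 * (k - 2 * h).+1 + h.-1 * (d - (k - h)) =
   k - h + h.-1.+1 * 0 + h.-1 * (d - h))%N.
Proof.
move=> h0; rewrite prednK // muln0 addn0.
have -> : (d - h = d - (k - h) + (k - 2 * h))%N by lia.
have -> : (k - h = h + (k - 2 * h))%N by lia.
by rewrite mulnDr mulnS; case: (h) h0 => // h' _ /=; rewrite mulSn; lia.
Qed.

Lemma exponents_eq2 : (0 < k - h)%N ->
  ((k - h).-1.+1 * 1 + (k - h).-1 * (d - h) =
   h + (k - h).-1.+1 * (k - 2 * h) + (k - h).-1 * (d - (k - h)))%N.
Proof.
move=> kh0; rewrite prednK // muln1.
have -> : (d - h = d - (k - h) + (k - 2 * h))%N by lia.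
rewrite mulnDr; have e1 : (k - h = h + (k - 2 * h))%N by lia.
have -> : ((k - h) * (k - 2 * h) = (k - 2 * h) + (k - h).-1 * (k - 2 * h))%N.
  by rewrite -{1}(prednK kh0) mulSn.
by lia.
Qed.

End Exponents.

Lemma vrow_homog (K : closedFieldType) m (s t : {mpoly K[2]}) :
  s \is 1.-homog -> t \is 1.-homog -> form_row m (vrow m s t).
Proof.
move=> hs ht i; rewrite mxE.
apply: (homog_cast _ (dhomogM (dhomogMn (m - i) hs) (dhomogMn i ht))).
by have := ltn_ord i; lia.
Qed.

Section UnisecantCurve.
Variables (K : closedFieldType) (d k h : nat).
Local Notation S := {mpoly K[2]}.
Variables (G1 : 'M[K]_(h.+1, k.+2)) (G2 : 'M[K]_((k - h).+1, k.+2)).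
Variables (R1 : 'M[K]_(k.+2, h.+1)) (R2 : 'M[K]_(k.+2, (k - h).+1)).
Hypotheses (G1R1 : G1 *m R1 = 1%:M) (G1R2 : G1 *m R2 = 0).
Hypotheses (G2R1 : G2 *m R1 = 0) (G2R2 : G2 *m R2 = 1%:M).
Hypothesis (RG : R1 *m G1 + R2 *m G2 = 1%:M).
Implicit Types x y : 'rV[K]_2.
Local Notation spt u v x := (spoint G1 G2 (idr K) u v (x 0 0) (x 0 1)).
Local Notation mpC := (@mpolyC 2 K).

Lemma ev_spoint (B C s t : S) x :
  ev (spoint G1 G2 mpC B C s t) x =
  spoint G1 G2 (idr K) B.@[x 0] C.@[x 0] s.@[x 0] t.@[x 0].
Proof. by apply: map_spoint => a; apply: mevalC. Qed.

Variables (B C : S) (phi : 'rV[S]_k.+2).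
Hypothesis ephi : phi = spoint G1 G2 mpC B C 'X_0 'X_1.
Hypotheses (hB : B \is (d - h).-homog) (hC : C \is (d - (k - h)).-homog).
Hypotheses (h2k : (2 * h <= k)%N) (k0 : (0 < k)%N) (k2d : (2 * k <= d)%N).
Hypothesis bphi : base_point_free phi.

Local Notation D := (@curve K k.+1 phi).

Lemma ev_phi x : ev phi x = spt B.@[x 0] C.@[x 0] x.
Proof. by rewrite ephi ev_spoint !mevalXU. Qed.

Lemma phi_homog : form_row d phi.
Proof.
have homv := vrow_homog.
rewrite ephi; apply: form_rowD.
  apply: (form_row_cast _ (form_rowZ hB (form_row_mul _ (homv K h _ _ _ _))));
  by [lia|apply: dhomogXU].
apply: (form_row_cast _ (form_rowZ hC (form_row_mul _ (homv K (k - h)%N _ _ _ _))));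
by [lia|apply: dhomogXU].
Qed.

Lemma coprime_BC x : x != 0 -> (B.@[x 0] != 0) || (C.@[x 0] != 0).
Proof.
move=> x0; apply: contraNT (bphi x0); rewrite negb_or !negbK => /andP[/eqP B0 /eqP C0].
by rewrite ev_phi B0 C0 sptE !scale0r addr0.
Qed.

Lemma curve_phiP p : D p <->
  exists a x, [/\ a != 0, x != 0 & p = spt (a * B.@[x 0]) (a * C.@[x 0]) x].
Proof.
have sc a x : spt (a * B.@[x 0]) (a * C.@[x 0]) x = a *: ev phi x.
  by rewrite ev_phi !sptE scalerDr !scalerA.
split=> [[p0 [x x0 /(same_pointP _ p0)[a a0 e]]]|[a [x [a0 x0 e]]]].
  by exists a, x; split; rewrite // sc.
have p0 : p != 0 by rewrite e sc scaler_eq0 negb_or a0; apply: bphi.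
split=> //; exists x => //; apply/(same_pointP _ p0).
by exists a; rewrite // e sc.
Qed.

Lemma curve_on_scroll p : D p -> scroll G1 G2 p.
Proof.
move=> /curve_phiP[a [x [a0 x0 ->]]].
apply: (scroll_spt G1R1 G1R2 G2R1 G2R2 x0).
by rewrite !mulf_eq0 (negPf a0) coprime_BC.
Qed.

(** Equations of the curve: coordinates whose values on it are Q z^(m1+1) (for
    A), Q z^m1 s and Q z^m1 t (for L and H) and P z^m2 (for Y), where Q and P are
    B and C in some order, satisfy
      A^m P(L, H) = Y A^n Q(L, H)
    for suitable m and n; this is linear in Y. *)
Section Equation.
Variables (P Q : S) (dp dq m1 m2 m n : nat) (z : 'I_2).
Variables (A L H Y : 'cV[K]_k.+2).
Hypotheses (hP : P \is dp.-homog) (hQ : Q \is dq.-homog).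
Hypotheses (deg1 : (m + dp = n.+1 + dq)%N)
  (deg2 : (m1.+1 * m + m1 * dp = m2 + m1.+1 * n + m1 * dq)%N).
Hypothesis vA : forall x, (ev phi x *m A) 0 0 = Q.@[x 0] * x 0 z ^+ m1.+1.
Hypothesis vL : forall x, (ev phi x *m L) 0 0 = Q.@[x 0] * x 0 z ^+ m1 * x 0 0.
Hypothesis vH : forall x, (ev phi x *m H) 0 0 = Q.@[x 0] * x 0 z ^+ m1 * x 0 1.
Hypothesis vY : forall x, (ev phi x *m Y) 0 0 = P.@[x 0] * x 0 z ^+ m2.

Local Notation lf c := (linear_form c).
Let LH (i : 'I_2) := if i == 0 then lf L else lf H.

Definition curve_equation : {mpoly K[k.+2]} :=
  lf A ^+ m * subst LH P - lf Y * (lf A ^+ n * subst LH Q).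

Lemma curve_equation_homog : curve_equation \is (m + dp).-homog.
Proof.
have hA e : lf A ^+ e \is e.-homog.
  by have := dhomogMn e (linear_form_homog A); rewrite mul1n.
have hLH i : LH i \is 1.-homog by rewrite /LH; case: ifP; rewrite linear_form_homog.
have hs e R : R \is e.-homog -> subst LH R \is e.-homog.
  by move=> hR; have := subst_homog hR hLH; rewrite muln1.
apply: rpredB; first exact: dhomogM (hA m) (hs _ _ hP).
have := dhomogM (linear_form_homog Y) (dhomogM (hA n) (hs _ _ hQ)).
have -> : (m + dp = 1 + (n + dq))%N by move: deg1; clear; lia.
by [].
Qed.

Lemma scaled_coord a x (c : 'cV[K]_k.+2) :
  ((a *: ev phi x) *m c) 0 0 = a * (ev phi x *m c) 0 0.
Proof. by rewrite -scalemxAl mxE. Qed.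

Lemma subst_LH e (R : S) (a : K) x : R \is e.-homog ->
  (subst LH R).@[(a *: ev phi x) 0] =
  (a * (Q.@[x 0] * x 0 z ^+ m1)) ^+ e * R.@[x 0].
Proof.
move=> hR; rewrite meval_subst -(meval_scale _ _ hR); apply: meval_eq => i.
rewrite mxE /LH; case: (ord2_case i) => -> /=; rewrite meval_linear_form scaled_coord.
  by rewrite vL; ring.
by rewrite vH; ring.
Qed.

Lemma curve_equation_vanishes p : D p -> curve_equation.@[p 0] = 0.
Proof.
case=> p0 [x x0 /(same_pointP _ p0)[a a0 ->]].
rewrite mevalB !mevalM !rmorphXn /= !meval_linear_form (subst_LH _ _ hP).
rewrite (subst_LH _ _ hQ) !scaled_coord vA vY.
set q := Q.@[x 0]; set r := P.@[x 0]; set zz := x 0 z.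
have pw j : zz ^+ m1.+1 ^+ j = zz ^+ j * zz ^+ m1 ^+ j by rewrite exprS exprMn.
rewrite !exprMn.
apply/eqP; rewrite subr_eq0; apply/eqP.
have -> : a ^+ m * (q ^+ m * (zz ^+ m1.+1) ^+ m) * (a ^+ dp * (q ^+ dp * (zz ^+ m1) ^+ dp) * r)
  = a ^+ (m + dp) * q ^+ (m + dp) * zz ^+ (m1.+1 * m + m1 * dp) * r.
  rewrite pw !exprD !exprM; move: (a ^+ m) (a ^+ dp) (q ^+ m) (q ^+ dp) (zz ^+ m).
  by move: ((zz ^+ m1) ^+ m) ((zz ^+ m1) ^+ dp) => *; ring.
rewrite deg1 deg2 pw !exprD !exprM (exprS a n) (exprS q n).
move: (a ^+ n) (a ^+ dq) (q ^+ n) (q ^+ dq) (zz ^+ n).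
by move: ((zz ^+ m1) ^+ n) ((zz ^+ m1) ^+ dq) (zz ^+ m2) => *; ring.
Qed.

Lemma curve_equation_derivative a x e : a != 0 -> Q.@[x 0] != 0 -> x 0 z != 0 ->
  (e *m A) 0 0 = 0 -> (e *m L) 0 0 = 0 -> (e *m H) 0 0 = 0 -> (e *m Y) 0 0 != 0 ->
  dirD curve_equation (a *: ev phi x) e != 0.
Proof.
move=> a0 q0 z0 eA eL eH eY; rewrite /curve_equation.
have dA r p : dirD (lf A ^+ r) p e = 0.
  by apply: dirDX_eq0; rewrite dirD_linear_form.
have dS (R : S) p : dirD (subst LH R) p e = 0.
  apply: dirD_subst0 => i; rewrite /LH; case: ifP => _;
  by rewrite dirD_linear_form.
rewrite dirDD dirDN !dirDM !dA !dS dirD_linear_form !mul0r !mulr0 !addr0.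
rewrite add0r oppr_eq0 mulr0 addr0 mulf_neq0 // mevalM rmorphXn /= meval_linear_form.
rewrite (subst_LH _ _ hQ) scaled_coord vA.
by do ?[done | apply: mulf_neq0 | apply: expf_neq0].
Qed.

End Equation.

(** Where C does not vanish, the equation is used with Q = C; where it does, B
    does not, and h > 0 allows for Q = B. Either way the equation is of degree 1
    in the direction of the fiber. *)
Lemma smooth_curve_at p a x : a != 0 -> x != 0 ->
  p = spt (a * B.@[x 0]) (a * C.@[x 0]) x -> (0 < h)%N || (C.@[x 0] != 0) ->
  smooth_at 1 D p.
Proof.
move=> a0 x0 ep off; set u := a * _ in ep; set v := a * C.@[x 0] in ep.
have ephix : p = a *: ev phi x by rewrite ep ev_phi !sptE scalerDr !scalerA.
have kh0 : (0 < k - h)%N by lia.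
have bc := coprime_BC x0.
have Q0 : ratios k h u v (x 0 0) (x 0 1) != 0.
  apply: ratio_neq0 => //; rewrite kh0 !mulf_eq0 (negPf a0) /=.
  by case/orP: off => [->|->]; rewrite ?orbT //.
have [y yx] := transversal_vector x0.
pose arc (P : S) : {poly K} := mmap polyC (fun i => (x 0 i)%:P + y 0 i *: 'X) P.
have arcE P c : (arc P).[c] = P.@[(x + c *: y) 0].
  by rewrite /arc horner_mmap; apply: meval_eq => i; rewrite !hornerE !mxE mulrC.
have arc0 P : (arc P)`_0 = P.@[x 0].
  by rewrite -horner_coef0 arcE scale0r addr0.
rewrite ep.
have tp : tangent D (spt u v x) (spt u v x).
  have := @tangent_arc _ _ D (sarc G1 G2 x 0 (u *: ('X + 1)) (v *: ('X + 1))) ('X + 1).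
  rewrite sarc_start fixed_fiber_velocity !coefZ !coefD !coefX !coefC /= addr0 add0r !mulr1.
  apply; first by rewrite -size_poly_eq0 size_XaddC.
  move=> c; rewrite !hornerE => c0; rewrite sarc_horner scaler0 addr0 !hornerE.
  apply/curve_phiP; exists (a * (c + 1)), x; split=> //; first by rewrite mulf_neq0.
  by congr (spoint _ _ _ _ _ _); rewrite /u /v; ring.
pose w := \row_i (sarc G1 G2 x y (a *: arc B) (a *: arc C) 0 i)`_1.
have tw : tangent D (spt u v x) w.
  have := @tangent_arc _ _ D (sarc G1 G2 x y (a *: arc B) (a *: arc C)) 1.
  rewrite sarc_start !coefZ !arc0; apply; first exact: oner_neq0.
  move=> c _; rewrite sarc_horner !hornerE !arcE; apply/curve_phiP.
  by exists a, (x + c *: y); split=> //; apply: moving_point.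
have dw : exists2 b, b != 0 &
    deviation R1 R2 (idr K) (x 0 0) (x 0 1) w = b *: ratios k h u v (x 0 0) (x 0 1).
  exists (x 0 0 * y 0 1 - x 0 1 * y 0 0) => //.
  by rewrite (sarc_velocity G1R1 G1R2 G2R1 G2R2) !coefZ !arc0.
have [z xz] : exists z : 'I_2, x 0 z != 0.
  by case: (row2_neq0 x0) => xn; [exists 0|exists 1].
have c1 u' v' y' : spt u' v' y' *m R1 = u' *: vrow h (y' 0 0) (y' 0 1).
  by rewrite -{1}(map_mx_idfun R1) spoint_R1.
have c2 u' v' y' : spt u' v' y' *m R2 = v' *: vrow (k - h) (y' 0 0) (y' 0 1).
  by rewrite -{1}(map_mx_idfun R2) spoint_R2.
have [A1 vA1] := extreme_column R1 z; have [A2 vA2] := extreme_column R2 z.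
have vphi1 y' : ev phi y' *m R1 = B.@[y' 0] *: vrow h (y' 0 0) (y' 0 1).
  by rewrite ev_phi c1.
have vphi2 y' : ev phi y' *m R2 = C.@[y' 0] *: vrow (k - h) (y' 0 0) (y' 0 1).
  by rewrite ev_phi c2.
have fin F e : F \is e.-homog -> (forall q, D q -> F.@[q 0] = 0) ->
  (u != 0 /\ dirD F (spt u v x) (spt 0 1 x) != 0) \/
  (v != 0 /\ dirD F (spt u v x) (spt 1 0 x) != 0) -> smooth_at 1 D (spt u v x).
  move=> hF FD; apply: (smooth_curve G1R1 G1R2 G2R1 G2R2 RG _ x0 Q0 tp tw dw hF FD).
  exact: curve_on_scroll.
have [C0|Cn] := eqVneq C.@[x 0] 0.
  have h0 : (0 < h)%N by case/orP: off => //; rewrite C0 eqxx.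
  have Bn : B.@[x 0] != 0 by move: bc; rewrite C0 eqxx orbF.
  have [L [H vLH]] := extreme_pair R1 z h0.
  have vA y' : (ev phi y' *m A1) 0 0 = B.@[y' 0] * y' 0 z ^+ h.-1.+1.
    by rewrite prednK // (vA1 _ _ _ (vphi1 y')).
  have vL y' := (vLH _ _ _ (vphi1 y')).1; have vH y' := (vLH _ _ _ (vphi1 y')).2.
  have vY y' := vA2 _ _ _ (vphi2 y').
  have dg1 := degrees_eq1 h2k k2d; have dg2 := exponents_eq1 h2k k2d h0.
  apply: (fin _ _ (curve_equation_homog A1 L H A2 hC hB dg1)
              (curve_equation_vanishes hC hB dg1 dg2 vA vL vH vY)).
  left; split; first by rewrite mulf_neq0.
  rewrite -ep ephix; apply: (curve_equation_derivative _ _ _ hB vA vL vH) => //.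
  - by rewrite (vA1 _ _ _ (c1 _ _ _)) mul0r.
  - by rewrite (vLH _ _ _ (c1 _ _ _)).1 !mul0r.
  - by rewrite (vLH _ _ _ (c1 _ _ _)).2 !mul0r.
  - by rewrite (vA2 _ _ _ (c2 _ _ _)) mul1r expf_neq0.
have [L [H vLH]] := extreme_pair R2 z kh0.
have vA y' : (ev phi y' *m A2) 0 0 = C.@[y' 0] * y' 0 z ^+ (k - h).-1.+1.
  by rewrite prednK // (vA2 _ _ _ (vphi2 y')).
have vL y' := (vLH _ _ _ (vphi2 y')).1; have vH y' := (vLH _ _ _ (vphi2 y')).2.
have vY y' := vA1 _ _ _ (vphi1 y').
have dg1 := esym (degrees_eq1 h2k k2d); have dg2 := exponents_eq2 h2k k2d kh0.
apply: (fin _ _ (curve_equation_homog A2 L H A1 hB hC dg1)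
            (curve_equation_vanishes hB hC dg1 dg2 vA vL vH vY)).
right; split; first by rewrite mulf_neq0.
rewrite -ep ephix; apply: (curve_equation_derivative _ _ _ hC vA vL vH) => //.
- by rewrite (vA2 _ _ _ (c2 _ _ _)) mul0r.
- by rewrite (vLH _ _ _ (c2 _ _ _)).1 !mul0r.
- by rewrite (vLH _ _ _ (c2 _ _ _)).2 !mul0r.
- by rewrite (vA1 _ _ _ (c1 _ _ _)) mul1r expf_neq0.
Qed.

(** The fiber over x contains phi(x); the other points of the curve are on other
    fibers, except at the vertex. *)
Lemma curve_unisecant : C != 0 -> unisecant G1 G2 D.
Proof.
move=> C0; apply: generic_impl (generic_form hC C0) => x x0 Cx.
have kh0 : (0 < k - h)%N by move: h2k k0; clear; lia.
have bx := bphi x0.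
exists (ev phi x) => // q; split=> [[Dq fq nv]|[q0 /(same_pointP _ q0)[a a0 e]]].
  have q0 : q != 0 by case: Dq.
  split=> //; case: Dq => _ [y y0 /(same_pointP _ q0)[a a0 e]].
  have eq : q = spt (a * B.@[y 0]) (a * C.@[y 0]) y.
    by rewrite e ev_phi !sptE scalerDr !scalerA.
  have [_ [u [v eq']]] := (fiberP G1 G2 x q).1 fq.
  have xy : (y == x)%MS.
    apply: (fiber_uniq G1R1 G1R2 G2R1 G2R2 y0 x0 _ (etrans (esym eq) eq')).
    rewrite kh0 !mulf_eq0 (negPf a0) /=.
    have [Cy|] := eqVneq C.@[y 0] 0; last by rewrite orbT.
    have By : B.@[y 0] != 0 by have := coprime_BC y0; rewrite Cy eqxx orbF.
    rewrite By andbT orbF lt0n; apply/negP => /eqP h0; apply: nv; split=> //.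
    apply/(same_pointP _ q0); exists (a * B.@[y 0]); first by rewrite mulf_neq0.
    rewrite eq Cy mulr0 /spoint scale0r addr0 (vrow_vertex _ _ _ _ h0).
    by rewrite map_mx_idfun.
  apply/(same_pointP _ q0); have [b b0 exy] := same_pointP x y0 xy.
  exists (a * b ^+ d); first by rewrite mulf_neq0 ?expf_neq0.
  by rewrite e exy (ev_scale _ _ phi_homog) scalerA.
have eq : q = spt (a * B.@[x 0]) (a * C.@[x 0]) x.
  by rewrite e ev_phi !sptE scalerDr !scalerA.
split.
- by split=> //; exists x => //; apply/(same_pointP _ q0); exists a.
- by apply/fiberP; split=> //; rewrite eq; do 2!eexists.
move=> [h0 /(same_pointP _ q0)[b b0 ev]].
have := spoint_R2 G1R2 G2R2 (idr K) (a * B.@[x 0]) (a * C.@[x 0]) (x 0 0) (x 0 1).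
rewrite -eq map_mx_idfun ev /vertex rowE -scalemxAl -mulmxA G1R2 mulmx0 scaler0.
move=> /esym/eqP; rewrite scaler_eq0 mulf_eq0 (negPf a0) (negPf Cx) /=.
by rewrite (negPf (veronese_neq0 (k - h) x0)).
Qed.

Section Cone.
Hypothesis h0 : h = 0%N.
Local Notation V := (vertex G1).
Let gam : 'rV[S]_k.+2 := vrow (k - h) 'X_0 'X_1 *m map_mx mpC G2.

Lemma cone_phi : phi = B *: constant_row V + C *: gam.
Proof. by rewrite ephi /spoint; congr (_ *: _ + _); apply: vrow_vertex. Qed.

Lemma vertex_R2 : V *m R2 = 0.
Proof. by rewrite /vertex rowE -mulmxA G1R2 mulmx0. Qed.

Lemma vertex_R1 : V *m R1 != 0.
Proof.
rewrite /vertex rowE -mulmxA G1R1 mulmx1; apply/eqP => /rowP/(_ 0).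
by rewrite !mxE !eqxx => /eqP; rewrite oner_eq0.
Qed.

Lemma vertex_neq0 : V != 0.
Proof. by apply: contraNneq vertex_R1 => ->; rewrite mul0mx. Qed.

Lemma gam_homog : form_row (k - h) gam.
Proof.
by apply: form_row_mul; apply: vrow_homog; apply: dhomogXU.
Qed.

Lemma ev_gam x : ev gam x = veronese (k - h) x *m G2.
Proof.
rewrite /gam ev_mul; congr (_ *m _).
by apply/rowP=> i; rewrite !mxE rmorphM !rmorphXn /= !mevalXU.
Qed.

Lemma gam_off_vertex x : x != 0 -> ~~ (ev gam x <= V)%MS.
Proof.
move=> x0; apply/negP => /sub_rVP[a e]; have := congr1 (mulmx^~ R2) e.
rewrite ev_gam -mulmxA G2R2 mulmx1 -scalemxAl vertex_R2 scaler0 => /eqP.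
by rewrite (negPf (veronese_neq0 (k - h) x0)).
Qed.

Lemma vertex_multiplicity : C != 0 -> mult_at phi V (d - (k - h)).
Proof.
exact: (multiplicity_over cone_phi hC gam_homog bphi gam_off_vertex).
Qed.

(** The differential at the vertex of a form vanishing on the curve restricts to
    a binary form of degree k divisible by C, whose degree is at least k: the
    tangent space at the vertex contains a hyperplane. *)
Lemma singular_vertex : C != 0 -> (1 < d - (k - h))%N -> ~ smooth_at 1 D V.
Proof.
move=> C0 dk [W Wf HW].
have ekh : (k - h = k)%N by rewrite h0 subn0.
have [x0 x00 Cx0] : exists2 x : 'rV[K]_2, x != 0 & C.@[x 0] = 0.
  by apply: (form_root _ hC); apply: ltnW.
have V0 := vertex_neq0.
have DV a : a != 0 -> D (a *: V).
  move=> a0; have aV0 : a *: V != 0 by rewrite scaler_eq0 negb_or a0.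
  split=> //; exists x0 => //.
  have Bx : B.@[x0 0] != 0 by have := coprime_BC x00; rewrite Cx0 eqxx orbF.
  apply/(same_pointP _ aV0); exists (a / B.@[x0 0]).
    by rewrite mulf_neq0 ?invr_eq0.
  rewrite cone_phi evD !evZ ev_constant Cx0 scale0r addr0 scalerA divfK //.
(* The differential at the vertex of a form vanishing on the curve is proportional
   to the coefficients of C if C has degree k, and is 0 if C has larger degree. *)
pose c : 'cV[K]_(k - h).+1 := \col_j (if (d - (k - h) == k - h)%N then (dehom C)`_j else 0).
have tan v : v *m (R2 *m c) = 0 -> tangent D V v.
  move=> vc e F hF FD.
  have FV : F.@[V 0] = 0 by rewrite -[V]scale1r; apply/FD/DV/oner_neq0.
  have dVV : dirD F V V = 0.
    have := @tangent_arc _ _ D (sarc G1 G2 x0 0 ('X + 1) 0) ('X + 1).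
    rewrite sarc_start fixed_fiber_velocity !coefD !coefX !coefC /= addr0 add0r.
    have eV : spt 1 0 x0 = V.
      by rewrite /spoint scale0r addr0 scale1r (vrow_vertex _ _ _ _ h0) map_mx_idfun.
    rewrite eV => H; apply: (H _ _ e F hF FD).
      by rewrite -size_poly_eq0 size_XaddC.
    move=> b; rewrite !hornerE => b0; rewrite sarc_horner scaler0 addr0 !hornerE.
    rewrite /spoint scale0r addr0 (vrow_vertex _ _ _ _ h0) map_mx_idfun.
    exact: DV.
  pose l : 'cV[K]_(k - h).+1 := \col_j dirD F V (row j G2).
  pose Lp : S := \sum_j (l j 0)%:MP * vrow (k - h) 'X_0 'X_1 0 j.
  have eLp : Lp = \sum_i (F^`M(i)).@[V 0]%:MP * gam 0 i.
    rewrite /Lp.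
    under eq_bigr => j _.
      rewrite mxE /dirD rmorph_sum mulr_suml /=; over.
    rewrite exchange_big; apply: eq_bigr => i _ /=.
    rewrite /gam mxE mulr_sumr; apply: eq_bigr => j _.
    by rewrite !mxE mpolyCM; ring.
  have hLp : Lp \is (k - h).-homog.
    apply: rpred_sum => j _; rewrite mul_mpolyC; apply: rpredZ.
    by apply: vrow_homog; apply: dhomogXU.
  have [r er] := mmap_taylor mpC F C (fun i => B * (V 0 i)%:MP) (gam 0).
  have hd : subst (phi 0) F \is (e * d).-homog by apply: subst_homog hF phi_homog.
  have Fphi : mmap mpC (phi 0) F = 0.
    apply: (form_eq0 hd); exists [::] => x x0' _.
    rewrite meval_subst -[RHS](FD (ev phi x)); last first.
      have bx := bphi x0'; split=> //; exists x => //.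
      by apply/(same_pointP _ bx); exists 1; rewrite ?oner_eq0 ?scale1r.
    by apply: meval_eq => i; rewrite evE.
  have constE (m : nat) (H : {mpoly K[k.+2]}) : H \is m.-homog ->
      mmap mpC (fun i => B * (V 0 i)%:MP) H = B ^+ m * H.@[V 0]%:MP.
    by move=> hH; rewrite (mmap_homog_scale _ _ _ hH) (mmap_point mpC).
  have ephi0 : (fun i => B * (V 0 i)%:MP + C * gam 0 i) =1 phi 0.
    by move=> i; rewrite cone_phi !mxE.
  move: er; rewrite (eq_mmap _ _ ephi0) Fphi (constE _ _ hF) FV mpolyC0 mulr0 add0r.
  under eq_bigr => i _ do rewrite (constE _ _ (mderiv_homog i hF)) -mulrA.
  rewrite -mulr_sumr -eLp expr2 -mulrA -mulrDr => /esym/eqP.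
  rewrite mulf_eq0 (negPf C0) /= addrC addr_eq0 => /eqP er.
  have [||E hE eE] := @form_dvd K unit _ _ C Lp (fun=> - r) (fun=> B ^+ e.-1) hC C0 hLp.
  - by move=> _; rewrite mulrN er opprK mulrC.
  - move=> x x0' Cx; exists tt; rewrite rmorphXn /= expf_neq0 //.
    by have := coprime_BC x0'; rewrite Cx eqxx orbF.
  have coefL j : (dehom Lp)`_j = if (j < (k - h).+1)%N then l (inord j) 0 else 0.
    have -> : dehom Lp = \poly_(j < (k - h).+1) l (inord j) 0.
      rewrite poly_def /Lp rmorph_sum /=; apply: eq_bigr => i _.
      rewrite mul_mpolyC dehomZ [vrow _ _ _ 0 i]mxE rmorphM !rmorphXn /=.
      by rewrite dehomX0 dehomX1 expr1n mul1r inord_val.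
    by rewrite coef_poly.
  have lc : exists b, l = b *: c.
    have [L0|Ln] := eqVneq Lp 0.
      exists 0; apply/colP=> j; have := coefL j.
      by rewrite L0 rmorph0 coef0 ltn_ord inord_val !mxE mul0r => <-.
    have le := factor_degree hE hC; rewrite -eE in le.
    have {}le := le hLp Ln.
    have dk2 : (d - (k - h) = k - h)%N by move: le k2d ekh; clear; lia.
    have [b eb] := form_const (homog_cast (etrans (f_equal _ dk2) (subnn _)) hE).
    exists b; apply/colP=> j; have := coefL j.
    rewrite ltn_ord inord_val eE eb mul_mpolyC dehomZ coefZ => <-.
    by rewrite !mxE dk2 eqxx.
  have [b eb] := lc.
  have ev : v = (v *m R1) 0 0 *: V + \sum_j (v *m R2) 0 j *: row j G2.
    rewrite -{1}[v]mulmx1 -RG mulmxDr !mulmxA -mulmx_sum_row; congr (_ + _).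
    have := vrow_vertex (idr K) G1 0 0 h0; rewrite !map_mx_idfun => eV.
    have hh : (h - 0 = 0)%N by rewrite subn0.
    have -> : v *m R1 = (v *m R1) 0 0 *: vrow h 0 0.
      apply/rowP=> i; rewrite [RHS]mxE [vrow _ _ _ _ _]mxE.
      have i0 : i = 0 by apply: val_inj => /=; have := ltn_ord i; move: h0; clear; lia.
      by rewrite i0 /= hh !expr0 !mulr1.
    by rewrite -scalemxAl eV /vertex; congr (_ *: _); rewrite !mxE /= hh !expr0 !mulr1.
  have lin (u w : 'rV[K]_k.+2) a : dirD F V (a *: u + w) = a * dirD F V u + dirD F V w.
    exact: dirD_lin.
  have dsum : dirD F V (\sum_j (v *m R2) 0 j *: row j G2) = (v *m R2 *m l) 0 0.
    rewrite [RHS]mxE; elim/big_ind2: _ => [|u a w b' eu ew|j _].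
    - by rewrite /dirD big1 // => i _; rewrite mxE mulr0.
    - by have := lin a b' 1; rewrite scale1r mul1r eu ew.
    - have -> : l j 0 = dirD F V (row j G2) by rewrite mxE.
      rewrite -[_ *: _]addr0 lin [dirD F V 0](_ : _ = 0) ?addr0 //.
      by rewrite /dirD big1 // => i _; rewrite mxE mulr0.
  have : dirD F V v = 0.
    by rewrite ev lin dVV mulr0 add0r dsum eb -scalemxAr -mulmxA vc scaler0 mxE.
  by [].
have sub : (kermx (R2 *m c) <= W)%MS.
  apply/row_subP => i; apply/HW/tan.
  by rewrite -row_mul mulmx_ker row0.
have := mxrankS sub; rewrite mxrank_ker (eqP Wf).
have := rank_leq_col (R2 *m c).
have [ek|nek] := eqVneq (d - (k - h))%N (k - h)%N.
  by move: ek dk ekh k0; clear; lia.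
have -> : c = 0 by apply/colP=> j; rewrite !mxE (negPf nek).
by rewrite mulmx0 mxrank0; move: k0; clear; lia.
Qed.

End Cone.
End UnisecantCurve.

(** * From syzygies to curves on scrolls *)

Section Frames.
Variable K : closedFieldType.

Lemma basis_of_rank m n r (A : 'M[K]_(m, n)) : r = \rank A ->
  exists2 Q : 'M[K]_(r, n), row_free Q & (A == Q)%MS.
Proof.
move=> ->; exists (row_base A); first exact: row_base_free.
by apply/eqmxP/eqmx_sym/eq_row_base.
Qed.

(** Any frame will do, the projection being determined by the images of its
    vectors; for k = 1, however, the projection has to be the identity, so that
    the frame consists of the rows of M0. *)
Lemma frame_exists k h (M0 : 'M[K]_(h.+1 + (k - h).+1, 3)) : (h <= k)%N ->
  \rank M0 = 3%N ->
  exists G1 : 'M[K]_(h.+1, k.+2), exists G2 : 'M[K]_((k - h).+1, k.+2),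
  exists M : 'M[K]_(k.+2, 3),
    [/\ scroll_frame G1 G2, col_mx G1 G2 *m M = M0 &
        k = 1%N -> forall i j, M i j = (i == j :> nat)%:R].
Proof.
move=> hk rM.
suff [T [M [fT TM kM]]] : exists T : 'M[K]_(h.+1 + (k - h).+1, k.+2),
    exists M : 'M[K]_(k.+2, 3), [/\ row_free T, T *m M = M0 &
      k = 1%N -> forall i j, M i j = (i == j :> nat)%:R].
  by exists (usubmx T), (dsubmx T), M; rewrite /scroll_frame vsubmxK.
have e : (h.+1 + (k - h).+1 = k.+2)%N by move: hk; clear; lia.
have [k1|nk1] := eqVneq k 1%N.
  pose T : 'M[K]_(h.+1 + (k - h).+1, k.+2) := \matrix_(i, j) M0 i (inord j).
  pose M : 'M[K]_(k.+2, 3) := \matrix_(i, j) (i == j :> nat)%:R.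
  have TM : T *m M = M0.
    apply/matrixP=> i j; rewrite mxE.
    have lt : (j < k.+2)%N by have := ltn_ord j; move: k1; clear; lia.
    rewrite (bigD1 (Ordinal lt)) //= !mxE eqxx mulr1 big1 ?addr0.
      by congr (M0 i _); apply: val_inj; rewrite /= inordK.
    move=> l ne; rewrite !mxE (_ : _ == _ :> nat = false) ?mulr0 //.
    by apply: contraNF ne => /eqP E; apply/eqP/val_inj.
  exists T, M; split=> //; last by move=> _ i j; rewrite mxE.
  rewrite /row_free eqn_leq rank_leq_row /=.
  have := mxrankM_maxl T M; rewrite TM rM; apply: leq_trans.
  by move: hk k1; clear; lia.
pose T : 'M[K]_(h.+1 + (k - h).+1, k.+2) := \matrix_(i, j) (i == j :> nat)%:R.
exists T, (\matrix_(i, j) M0 (cast_ord (esym e) i) j); split.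
- apply/row_freeP; exists T^T; apply/matrixP=> i j.
  rewrite !mxE (bigD1 (cast_ord e i)) //= !mxE eqxx mul1r big1 ?addr0.
    by rewrite /= eq_sym.
  move=> l ne; rewrite !mxE (_ : _ == _ :> nat = false) ?mul0r //.
  by apply: contraNF ne => /eqP E; apply/eqP/val_inj.
- apply/matrixP=> i j; rewrite mxE (bigD1 (cast_ord e i)) //= !mxE eqxx mul1r.
  rewrite cast_ordK big1 ?addr0 // => l ne; rewrite !mxE.
  rewrite (_ : _ == _ :> nat = false) ?mul0r //.
  by apply: contraNF ne => /eqP E; apply/eqP/val_inj.
- by move=> k1; rewrite k1 eqxx in nk1.
Qed.

Lemma form_row_coefs n r (w : 'rV[{mpoly K[2]}]_r) : form_row n w ->
  exists N : 'M[K]_(n.+1, r), w = vrow n 'X_0 'X_1 *m map_mx (@mpolyC 2 K) N.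
Proof.
move=> hw; exists (\matrix_(i, j) (dehom (w 0 j))`_i); apply/rowP=> j.
rewrite -(hom_dehom (hw j)) mxE /homogenize; apply: eq_bigr => i _.
by rewrite !mxE [RHS]mulrC mul_mpolyC.
Qed.

Lemma jac_mul r s (w : 'rV[{mpoly K[2]}]_r) (M : 'M[K]_(r, s)) x :
  jac (w *m map_mx (@mpolyC 2 K) M) x = jac w x *m M.
Proof.
apply/matrixP=> i j; rewrite !mxE (linear_sum (mderiv i)) /= (rmorph_sum (meval (x 0))) /=.
apply: eq_bigr => l _; rewrite !mxE mulrC mderiv_mulC mevalM mevalC mulrC.
by [].
Qed.

End Frames.

Section ModelConstruction.
Variables (K : closedFieldType) (d k : nat).
Local Notation S := {mpoly K[2]}.
Local Notation mpC := (@mpolyC 2 K).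
Variable f : 'rV[S]_3.
Hypotheses (Hf : @rational_param K 2 d f) (k0 : (0 < k)%N) (k2d : (2 * k <= d)%N).

(** The curve is the section of the scroll given by the coordinates of f in a
    basis of the syzygies of alpha; the projection maps the two directrices to
    that basis. *)
Lemma model_of_syzygy alpha h : splitting_type f k (d - k) ->
  alpha != 0 -> syzygy k alpha f -> min_syzygy_degree h alpha ->
  exists (G1 : 'M[K]_(h.+1, k.+2)) (G2 : 'M[K]_((k - h).+1, k.+2))
         (phi : 'rV[S]_k.+2) (Q : 'M[K]_(k.-1, k.+2)) (M : 'M[K]_(k.+2, 3)),
    on_scroll d f G1 G2 phi Q M /\
    (smooth_case G1 G2 phi \/ cone_case d G1 phi).
Proof.
move=> spl al0 sal minal; have [hf bf inj imm] := Hf.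
have minf : min_syzygy_degree k f.
  by apply: (splitting_type_min _ spl); move: k2d; clear; lia.
have bal := min_syzygy_bpf minf al0 sal.
have [hal alf] := (syzygyP k alpha f).1 sal.
have h2k := min_syzygy_half hal minal.
have [[b b0 sb] _] := minal.
have bb := min_syzygy_bpf minal b0 sb.
have [hb bal0] := (syzygyP h b alpha).1 sb.
have [g hg eg] := complementary_syzygy hal bal hb bb bal0 h2k.
have bbg : base_point_free (cross b g) by rewrite eg.
have [B [C [hB hC ef _ _]]] : exists B C : S, [/\ B \is (d - h).-homog,
    C \is (d - (k - h)).-homog, f = B *: b + C *: g, (d < h)%N -> B = 0
    & (d < k - h)%N -> C = 0].
  by apply: (homog_syzygy_decomposition hb hg bbg hf); rewrite eg dotC.
have C0 : C != 0.
  apply/eqP => C0; rewrite C0 scale0r addr0 in ef.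
  have nz : forall x : 'rV[K]_2, x != 0 -> B.@[x 0] != 0.
    by apply: (@form_neq0_of_bpf _ _ B b); rewrite -ef.
  by have [] := form_no_zero hB nz; move: h2k k2d k0; clear; lia.
have [N1 e1] := form_row_coefs hb; have [N2 e2] := form_row_coefs hg.
pose M0 := col_mx N1 N2.
(* A vector orthogonal to all coefficients of b and g would be a syzygy of f of
   degree 0, which is less than k. *)
have full : row_full M0.
  rewrite /row_full -mxrank_tr; change (row_free M0^T); apply: inj_row_free => v vM.
  have [e3 e4] : N1 *m v^T = 0 /\ N2 *m v^T = 0.
    by apply: eq_col_mx; rewrite -mul_col_mx col_mx0 -[LHS]trmxK trmx_mul trmxK vM trmx0.
  have fv : dot (constant_row v) f = 0.
    have bv m (w : 'rV[S]_3) (N : 'M_(m.+1, 3)) : w = vrow m 'X_0 'X_1 *m map_mx mpC N ->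
        N *m v^T = 0 -> dot w (constant_row v) = 0.
      move=> -> Nv; rewrite /dot /constant_row -mulmxA map_trmx -map_mxM Nv.
      by rewrite map_mx0 mulmx0 mxE.
    by rewrite dotC ef dotDl !dotZl (bv _ _ _ e1 e3) (bv _ _ _ e2 e4) !mulr0 addr0.
  apply/eqP; apply: contraT => v0.
  have cv0 : constant_row v != 0.
    have [x x0] := point_exists K.
    by apply: contraNneq v0 => E; rewrite -(ev_constant v x) E ev0.
  have := minf.2 0%N _ cv0; rewrite leqNgt k0 => /(_ _)/negP; case=> //.
  by apply/syzygyP; split=> //; apply: form_row_constant.
have hk : (h <= k)%N by move: h2k; clear; lia.
have [G1 [G2 [M [fr GM kM]]]] := frame_exists hk (eqP full).
have [R1 [R2 [G1R1 G1R2 G2R1 G2R2 RG]]] := dual_frame hk fr.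
move: GM; rewrite mul_col_mx => /eq_col_mx[G1M G2M].
pose phi := spoint G1 G2 mpC B C 'X_0 'X_1.
have fphi : f = phi *m map_mx mpC M.
  rewrite /phi /spoint mulmxDl -!scalemxAl -!mulmxA -!map_mxM G1M G2M.
  by rewrite -e1 -e2.
have evf x : ev f x = ev phi x *m M by rewrite fphi ev_mul.
have bphi : base_point_free phi.
  by move=> x x0; apply: contraNneq (bf x x0) => E; rewrite evf E mul0mx.
have hphi : form_row d phi := phi_homog (erefl phi) hB hC h2k k0 k2d.
have rM : \rank M = 3%N.
  apply/eqP; rewrite eqn_leq rank_leq_col /=.
  have := mxrankM_maxr (col_mx G1 G2) M.
  by rewrite mul_col_mx G1M G2M -[col_mx _ _]/M0 (eqP full).
have [|Q fQ eQ] := @basis_of_rank _ _ _ k.-1 (kermx M).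
  by rewrite mxrank_ker rM; move: k0; clear; lia.
have rphi : @rational_param K k.+1 d phi.
  split=> //.
    apply: generic_impl inj => x x0 H y y0 E; apply: H => //.
    rewrite !evf; apply/eqmxP; apply: eqmxMr; exact/eqmxP.
  apply: generic_impl imm => x x0; rewrite fphi jac_mul => r2.
  apply/eqP; rewrite eqn_leq rank_leq_row /= -{1}r2.
  exact: mxrankM_maxl.
exists G1, G2, phi, Q, M; split.
  split=> //; first exact: (curve_on_scroll G1R1 G1R2 G2R1 G2R2 (erefl phi) bphi).
  split=> //.
  - move=> p [x x0 /fiberP[p0 [u [v ep]]]]; apply/negP => pQ.
    have pM : p *m M = 0.
      by apply/sub_kermxP; rewrite (eqmxP eQ).
    have evc := bbg x x0; rewrite ev_cross in evc.
    have [|u0 v0] := cross_free (a := u) (b := v) evc.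
      rewrite -[RHS]pM ep sptE mulmxDl -!scalemxAl -!mulmxA G1M G2M.
      have ver m : ev (vrow m 'X_0 'X_1) x = veronese m x.
        by apply/rowP=> i; rewrite !mxE rmorphM !rmorphXn /= !mevalXU.
      by rewrite [in ev b]e1 [in ev g]e2 !ev_mul !ver.
    by move: p0; rewrite ep u0 v0 sptE !scale0r addr0 eqxx.
  - move=> p; split=> [[p0 [x x0 /(same_pointP _ p0)[a a0 E]]]|[p0 [q [q0 [x x0]]]]].
      split=> //; have bx := bphi x x0.
      exists (a *: ev phi x).
        have aphi : a *: ev phi x != 0 by rewrite scaler_eq0 negb_or a0.
        by split=> //; exists x => //; apply/(same_pointP _ aphi); exists a.
      by rewrite E evf scalemxAl; apply/eqmxP.
    move=> /(same_pointP _ q0)[a a0 ->] /(same_pointP _ p0)[c c0 E].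
    split=> //; exists x => //; apply/(same_pointP _ p0); exists (c * a).
      by rewrite mulf_neq0.
    by rewrite E -scalemxAl scalerA evf.
have [h0|hp] := posnP h.
  have edk : (d - (k - h) = d - k)%N by rewrite h0 subn0.
  right; split=> //.
  - have := vertex_multiplicity G1R2 G2R2 (erefl phi) hC bphi h0 C0.
    by rewrite edk.
  - move=> p Dp nv; have [a [x [a0 x0 ep]]] := (curve_phiP (erefl phi) bphi p).1 Dp.
    apply: (smooth_curve_at G1R1 G1R2 G2R1 G2R2 RG (erefl phi) hB hC h2k k0 k2d bphi a0 x0 ep).
    apply/orP; right; apply: contraNN nv => /eqP Cx.
    have p0 : p != 0 by case: Dp.
    have Bx : B.@[x 0] != 0.
      by have := coprime_BC (erefl phi) bphi x0; rewrite Cx eqxx orbF.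
    apply/(same_pointP _ p0); exists (a * B.@[x 0]); first by rewrite mulf_neq0.
    by rewrite ep Cx mulr0 /spoint scale0r addr0 (vrow_vertex _ _ _ _ h0) map_mx_idfun.
  - have := singular_vertex G1R1 RG (erefl phi) hB hC h2k k0 k2d bphi h0 C0.
    by rewrite edk.
left; split=> //.
- by apply: (smooth_scroll G1R1 G1R2 G2R1 G2R2 RG hp); move: h2k hp; clear; lia.
- move=> p Dp; have [a [x [a0 x0 ep]]] := (curve_phiP (erefl phi) bphi p).1 Dp.
  apply: (smooth_curve_at G1R1 G1R2 G2R1 G2R2 RG (erefl phi) hB hC h2k k0 k2d bphi a0 x0 ep).
  by rewrite hp.
- exact: (curve_unisecant G1R1 G1R2 G2R1 G2R2 (erefl phi) hB hC h2k k0 k2d bphi C0).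
Qed.

End ModelConstruction.

(** * Comparing parametrizations of a curve *)

Section GcdOverDomain.
Variable A : idomainType.
Implicit Types p q r s : {poly A}.

Lemma gcd_two p q : exists r a b e, [/\ e != 0, e *: r = a * p + b * q,
  exists c p', c != 0 /\ c *: p = p' * r & exists c q', c != 0 /\ c *: q = q' * r].
Proof.
have [[a b] /= /eqpP[[c1 c2] /= /andP[c10 c20] e]] := Bezoutp p q.
exists (gcdp p q), (c1 *: a), (c1 *: b), c2; split=> //.
- by rewrite -e scalerDr !scalerAl.
- by have /Pdiv.Idomain.dvdpP[[c u] /= c0 E] := dvdp_gcdl p q; exists c, u.
- by have /Pdiv.Idomain.dvdpP[[c u] /= c0 E] := dvdp_gcdr p q; exists c, u.
Qed.

(** For A = K[y] the relations specialize to the values of y at which none of the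
    scalars vanishes. *)
Lemma gcd_three p q s : exists r a b c e, [/\ e != 0,
  e *: r = a * p + b * q + c * s,
  exists l p', l != 0 /\ l *: p = p' * r,
  exists l q', l != 0 /\ l *: q = q' * r & exists l s', l != 0 /\ l *: s = s' * r].
Proof.
have [t [a [b [e [e0 E [l1 [p' [l10 Ep]]] [l2 [q' [l20 Eq]]]]]]]] := gcd_two p q.
have [r [u [c [f [f0 F [m1 [t' [m10 Et]]] [m2 [s' [m20 Es]]]]]]]] := gcd_two t s.
exists r, (u * a), (u * b), (e *: c), (e * f); split.
- by rewrite mulf_neq0.
- rewrite -scalerA F scalerDr scalerAr E mulrDr !mulrA; congr (_ + _).
  by rewrite scalerAl.
- exists (m1 * l1), (p' * t'); split; first by rewrite mulf_neq0.
  by rewrite -scalerA Ep scalerAr Et mulrA.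
- exists (m1 * l2), (q' * t'); split; first by rewrite mulf_neq0.
  by rewrite -scalerA Eq scalerAr Et mulrA.
- by exists m2, s'.
Qed.

End GcdOverDomain.

Section LinearSubstitution.
Variable K : closedFieldType.
Local Notation S := {mpoly K[2]}.

Definition linsub (N : 'M[K]_2) (P : S) : S :=
  subst (fun i => linear_form (col i N)) P.

Lemma meval_linsub N P (x : 'rV[K]_2) : (linsub N P).@[x 0] = P.@[(x *m N) 0].
Proof.
rewrite meval_subst; apply: meval_eq => i.
by rewrite meval_linear_form colE mulmxA -colE mxE.
Qed.

Lemma linsub_homog N n P : P \is n.-homog -> linsub N P \is n.-homog.
Proof.
by move=> hP; have := subst_homog hP (fun i => linear_form_homog (col i N)); rewrite muln1.
Qed.

Lemma unit_point (N : 'M[K]_2) (x : 'rV[K]_2) : N \in unitmx -> x != 0 -> x *m N != 0.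
Proof.
by move=> uN; apply: contraNneq => e; rewrite -[x](mulmxK uN) e mul0mx.
Qed.

(** A vector in the kernel of the matrix of tau would be a base point. *)
Lemma linear_pair (tau : 'rV[S]_2) : form_row 1 tau -> base_point_free tau ->
  exists2 N : 'M[K]_2, N \in unitmx & forall x, ev tau x = x *m N.
Proof.
move=> ht bt; pose N : 'M[K]_2 := \matrix_(i, j) (dehom (tau 0 j))`_i.
have evN x : ev tau x = x *m N.
  apply/rowP=> j; rewrite evE -(hom_dehom (ht j)) meval_hom mxE !big_ord_recl !big_ord0 !mxE.
  rewrite /= !addr0; congr (_ + _); first by rewrite expr0 mulr1 expr1 mulrC.
  by rewrite expr0 mul1r expr1 mulrC; congr (x 0 _ * _); apply: val_inj.
exists N => //; rewrite -row_free_unit; apply: inj_row_free => v vN.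
by apply/eqP; apply: contraT => /bt; rewrite evN vN eqxx.
Qed.

End LinearSubstitution.

Section GenericPoints.
Variable K : closedFieldType.
Local Notation S := {mpoly K[2]}.

Lemma row_parallel n (v w : 'rV[K]_n) : w != 0 ->
  (forall i j, v 0 i * w 0 j = v 0 j * w 0 i) -> exists c, v = c *: w.
Proof.
move=> /row_neq0[i wi] e; exists (v 0 i / w 0 i); apply/rowP=> j.
by rewrite mxE; apply: (mulIf wi); rewrite e; field.
Qed.

Lemma finite_fiber r d (g : 'rV[S]_r) (p : 'rV[K]_r) : (0 < d)%N -> form_row d g ->
  base_point_free g -> p != 0 -> generic (fun y => ~~ (ev g y == p)%MS).
Proof.
move=> d0 hg bg p0.
case: (classic (exists ij, g 0 ij.1 * (p 0 ij.2)%:MP != g 0 ij.2 * (p 0 ij.1)%:MP)).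
  move=> [[i j] /= n0]; pose m := g 0 i * (p 0 j)%:MP - g 0 j * (p 0 i)%:MP.
  have hm : m \is d.-homog.
    by apply: rpredB; rewrite mulrC mul_mpolyC; apply: rpredZ.
  have m0 : m != 0 by rewrite subr_eq0.
  apply: generic_impl (generic_form hm m0) => y y0.
  apply: contra => /(same_pointP _ (bg y y0))[c c0 e].
  rewrite mevalB !mevalM !mevalC -!evE e !mxE; apply/eqP; ring.
move=> no; exfalso.
have cp : base_point_free (constant_row p) by move=> x x0; rewrite ev_constant.
have [|E hE eE] := parallel_multiple hg (form_row_constant p) cp.
  move=> i j; rewrite !mxE; apply/eqP; apply: contraT => n0.
  by case: no; exists (i, j).
have nz : forall x : 'rV[K]_2, x != 0 -> E.@[x 0] != 0.
  by apply: (@form_neq0_of_bpf _ _ E (constant_row p)); rewrite -eE.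
by have [] := form_no_zero hE nz; rewrite subn0 => dz; rewrite dz in d0.
Qed.

Lemma generic_all (T : eqType) (l : seq T) (P : T -> 'rV[K]_2 -> Prop) :
  (forall z, z \in l -> generic (P z)) ->
  generic (fun x => forall z, z \in l -> P z x).
Proof.
elim: l => [|z l IH] H; first by exists [::] => x x0 _ z.
have g1 := H z (mem_head _ _).
have g2 : generic (fun x => forall z, z \in l -> P z x).
  by apply: IH => w wl; apply: H; rewrite inE wl orbT.
apply: generic_impl (generic_and g1 g2) => x x0 [Pz Pl] w.
by rewrite inE => /orP[/eqP->|/Pl].
Qed.

Lemma generic_poly (q : {poly K}) : q != 0 ->
  generic (fun y => y 0 0 != 0 /\ q.[y 0 1 / y 0 0] != 0).
Proof.
move=> q0; pose n := size q; pose P : S := 'X_0 * homogenize n q.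
have hP : P \is (1 + n).-homog by apply: dhomogM; [exact: dhomogXU|exact: hom_homog].
have dP : dehom P = q by rewrite rmorphM /= dehomX0 mul1r dehom_hom.
have P0 : P != 0 by apply: contraNneq q0 => e; rewrite -dP e rmorph0.
apply: generic_impl (generic_form hP P0) => y y0 Py.
have yn : y 0 0 != 0.
  by apply: contraNneq Py => e; rewrite mevalM mevalXU e mul0r.
split=> //; apply: contraNneq Py => e.
by rewrite (affine_point yn) (meval_scale _ _ hP) meval_dehom dP e mulr0.
Qed.

Lemma euler n (F : {mpoly K[n]}) e (x : 'rV[K]_n) : F \is e.-homog ->
  dirD F x x = e%:R * F.@[x 0].
Proof.
move=> hF; have [r er] := mmap_taylor polyC F 'X (fun i => (x 0 i)%:P) (fun i => (x 0 i)%:P).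
have cE G : mmap polyC (fun i => (x 0 i)%:P) G = (G.@[x 0])%:P := mmap_point polyC G _.
have sE : (fun i => (x 0 i)%:P + 'X * (x 0 i)%:P) =1 (fun i => (1 + 'X) * (x 0 i)%:P).
  by move=> i; rewrite mulrDl mul1r.
move: er; rewrite (eq_mmap _ _ sE) (mmap_homog_scale _ _ _ hF) cE => er.
have := congr1 (fun p : {poly K} => p`_1) er.
rewrite coefMC !coefD coefC /= add0r coefXM /= (_ : ('X^2 * r)`_1 = 0); last by rewrite coefXnM.
rewrite addr0 (_ : ((1 + 'X) ^+ e)`_1 = e%:R :> K) => [->|].
  by rewrite coef_sum; apply: eq_bigr => i _; rewrite cE -polyCM coefC.
have := coef_deriv ((1 + 'X : {poly K}) ^+ e) 0; rewrite mulr1n => <-.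
rewrite -horner_coef0 deriv_exp derivD derivX derivC add0r ?mulr1 ?mul1r hornerMn.
by rewrite horner_exp !hornerE expr1n.
Qed.

Lemma dehom_mderiv (P : S) : dehom (P^`M(1)) = (dehom P)^`().
Proof.
apply: (mpoly_ind_ring (P := fun P => dehom (P^`M(1)) = (dehom P)^`())) => [c|i|F G|F G].
- by rewrite mderivC rmorph0 /dehom mmapC /= derivC.
- case: (ord2_case i) => ->.
    by rewrite mderivX mnm1E scale0r rmorph0 dehomX0 derivC.
  rewrite mderivX mnm1E eqxx scale1r -{1}[U_(1)%MM]add0m addmK mpolyX0.
  by rewrite rmorph1 dehomX1 derivX.
- by move=> e e'; rewrite mderivD !rmorphD derivD /= e e'.
- by move=> e e'; rewrite mderivM !rmorphD !rmorphM derivM /= e e'.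
Qed.

End GenericPoints.

Section Reparametrization.
Variable K : closedFieldType.
Local Notation S := {mpoly K[2]}.
Variables (d : nat) (f g : 'rV[S]_3).
Hypotheses (d0 : (0 < d)%N) (hf : form_row d f) (hg : form_row d g).
Hypotheses (bf : base_point_free f) (bg : base_point_free g).
Hypothesis inj : generic (fun x => forall y, y != 0 ->
  (ev f y == ev f x)%MS -> (y == x)%MS).
Hypothesis imm : generic (fun x => \rank (jac f x) = 2%N).
Hypothesis sub : forall y, y != 0 -> exists2 x, x != 0 & (ev g y == ev f x)%MS.

(** For general y the point g(y) is not among the values of f at the finitely
    many points to be avoided. *)
Lemma generic_preimage : generic (fun y => forall x, x != 0 ->
  (ev g y == ev f x)%MS -> [/\ x 0 0 != 0, \rank (jac f x) = 2%N &
    forall z, z != 0 -> (ev f z == ev f x)%MS -> (z == x)%MS]).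
Proof.
have [Z HZ] := generic_and inj imm; pose Z' := [seq z <- pt 0 1 :: Z | z != 0].
have gen : generic (fun y => forall z, z \in Z' -> ~~ (ev g y == ev f z)%MS).
  apply: generic_all => z; rewrite mem_filter => /andP[z0 _].
  exact: (finite_fiber d0 hg bg (bf z0)).
apply: generic_impl gen => y y0 H x x0 yx.
have nZ z : z \in pt 0 1 :: Z -> ~~ (x == z)%MS.
  move=> zZ; apply/negP => xz.
  have z0 : z != 0.
    have [c c0 e] := same_pointP z x0 xz.
    by apply: contraNneq x0 => z0; rewrite e z0 scaler0.
  have := H z; rewrite mem_filter z0 zZ => /(_ isT)/negP; apply.
  apply/eqmxP; apply: eqmx_trans (eqmxP yx) _.
  exact: (eqmxP (ev_same_point hf x0 xz)).
have [|] := HZ x x0.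
  by move=> z zZ; apply: nZ; rewrite inE zZ orbT.
split=> //; have := nZ _ (mem_head _ _).
rewrite same_point2 ?pt_neq0 ?oner_eq0 ?orbT // pt0 pt1 mulr1 mulr0.
by [].
Qed.

Let F i := dehom (f 0 i).
Let G i := dehom (g 0 i).

(** The main variable is x; the coefficients are polynomials in y. *)
Definition minor i j : {poly {poly K}} :=
  map_poly polyC (F i) * (G j)%:P - map_poly polyC (F j) * (G i)%:P.

Local Notation spec eta := (map_poly (horner_eval eta)).

Lemma spec_minor eta i j :
  spec eta (minor i j) = (G j).[eta] *: F i - (G i).[eta] *: F j.
Proof.
have sF i' : spec eta (map_poly polyC (F i')) = F i'.
  rewrite -map_poly_comp; apply/polyP=> l.
  by rewrite coef_map_id0; rewrite /= /horner_eval hornerC.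
rewrite /minor rmorphB !rmorphM /= !sF !map_polyC /= ![_ * _%:P]mulrC.
by rewrite !mul_polyC.
Qed.

Lemma spec_scale eta (c : {poly K}) (p : {poly {poly K}}) :
  spec eta (c *: p) = c.[eta] *: spec eta p.
Proof. by rewrite -[c *: p]mul_polyC rmorphM /= map_polyC /= mul_polyC. Qed.

(** For general y the minors of the 2 x 3 matrix with rows f(x) and g(y), as
    polynomials in x, have a single common zero, which is simple since f is an
    immersion there. Hence their greatest common divisor over K(y) has degree 1
    and x is a rational function of y. *)
Lemma rational_preimage : exists t0 t1 : {poly K},
  generic (fun y => y 0 0 != 0 /\ exists x c, [/\ x != 0, c != 0,
    (ev g y == ev f x)%MS, t0.[y 0 1 / y 0 0] = c * x 0 0 &
    t1.[y 0 1 / y 0 0] = c * x 0 1]).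
Proof.
have [r [a [b [c [e [e0 E [l1 [q1 [l10 E1]]] [l2 [q2 [l20 E2]]] [l3 [q3 [l30 E3]]]]]]]]] :=
  gcd_three (minor 0 1) (minor 0 ord_max) (minor 1 ord_max).
(* At a general y the gcd r is a constant multiple of 'X - xi, xi being the affine
   coordinate of x. *)
exists r`_1, (- r`_0).
have g1 := generic_and (generic_poly e0) (generic_and (generic_poly l10)
  (generic_and (generic_poly l20) (generic_poly l30))).
apply: generic_impl (generic_and generic_preimage g1).
move=> y y0 [good [[yn en] [[_ l1n] [[_ l2n] [_ l3n]]]]]; split=> //.
set eta := y 0 1 / y 0 0 in en l1n l2n l3n *.
have [x x0 yx] := sub y0.
have [xn rk uniq] := good x x0 yx.
pose xi := x 0 1 / x 0 0; pose x' := pt 1 xi.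
have x'0 : x' != 0 by rewrite pt_neq0 ?oner_eq0.
have ex : x = x 0 0 *: x' := affine_point xn.
have evf i t : ev f (pt 1 t) 0 i = (F i).[t] by rewrite evE meval_dehom.
have evg i : ev g y 0 i = y 0 0 ^+ d * (G i).[eta].
  by rewrite evE {1}(affine_point yn) (meval_scale _ _ (hg i)) meval_dehom.
pose gy : 'rV[K]_3 := \row_i (G i).[eta].
have egy : ev g y = y 0 0 ^+ d *: gy by apply/rowP=> i; rewrite evg !mxE.
have gy0 : gy != 0.
  by apply: contraNneq (bg y0) => e'; rewrite egy e' scaler0.
have par t : (forall i j, (spec eta (minor i j)).[t] = 0) <->
    (ev g y == ev f (pt 1 t))%MS.
  have t0 : pt 1 t != 0 :> 'rV[K]_2 by rewrite pt_neq0 ?oner_eq0.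
  split=> [H|].
    have [|b' eb] := @row_parallel K 3 (ev f (pt 1 t)) gy gy0.
      move=> i j; have := H i j; rewrite spec_minor !hornerE => /eqP.
      by rewrite subr_eq0 !evf !mxE mulrC => /eqP ->; rewrite mulrC.
    have b0 : b' != 0 by apply: contraNneq (bf t0) => b0; rewrite eb b0 scale0r.
    apply/(same_pointP _ (bg y0)); exists (y 0 0 ^+ d / b').
      by rewrite mulf_neq0 ?invr_eq0 ?expf_neq0.
    by rewrite eb scalerA divfK.
  move=> /(same_pointP _ (bg y0))[b' b0 eb] i j; rewrite spec_minor !hornerE.
  have eG i' : y 0 0 ^+ d * (G i').[eta] = b' * (F i').[t].
    by rewrite -evg eb mxE evf.
  apply: (mulfI (expf_neq0 d yn)); rewrite mulrBr !mulrA !eG mulr0.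
  by apply/eqP; rewrite subr_eq0; apply/eqP; ring.
have parx : forall i j, (spec eta (minor i j)).[xi] = 0.
  apply/par; apply/eqmxP; apply: eqmx_trans (eqmxP yx) _.
  have xx' : (x == x')%MS by apply/(same_pointP _ x0); exists (x 0 0).
  exact: (eqmxP (ev_same_point hf x0 xx')).
pose rho := spec eta r.
have rho_xi : rho.[xi] = 0.
  have := congr1 (fun p => (spec eta p).[xi]) E.
  rewrite spec_scale !rmorphD !rmorphM /= hornerZ !hornerD !hornerM !parx !mulr0 !addr0.
  by move/eqP; rewrite mulf_eq0 (negPf en) => /eqP.
have minor_rho i j : exists l q, l != 0 /\ l *: spec eta (minor i j) = q * rho.
  have sp l q m : l.[eta] != 0 -> l *: m = q * r ->
      exists l' q', l' != 0 /\ l' *: spec eta m = q' * rho.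
    move=> ln e'; exists l.[eta], (spec eta q); split=> //.
    by rewrite -spec_scale e' rmorphM.
  have nil i' : minor i' i' = 0 by rewrite /minor subrr.
  have opp i' j' : (exists l' q', l' != 0 /\ l' *: spec eta (minor i' j') = q' * rho) ->
      exists l' q', l' != 0 /\ l' *: spec eta (minor j' i') = q' * rho.
    move=> [l' [q' [l0 e']]]; exists l', (- q'); split=> //.
    have -> : minor j' i' = - minor i' j' by rewrite /minor opprB.
    by rewrite rmorphN /= scalerN e' mulNr.
  have zz i' : exists l' q', l' != 0 /\ l' *: spec eta (minor i' i') = q' * rho.
    by exists 1, 0; rewrite oner_neq0 nil rmorph0 scaler0 mul0r.
  have s1 := sp _ _ _ l1n E1; have s2 := sp _ _ _ l2n E2; have s3 := sp _ _ _ l3n E3.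
  by case: (ord3_case i) => ->; case: (ord3_case j) => ->;
    [exact: zz | exact: s1 | exact: s2 | exact: (opp _ _ s1) | exact: zz
    | exact: s3 | exact: (opp _ _ s2) | exact: (opp _ _ s3) | exact: zz].
have /factor_theorem[q eq] : root rho xi by apply/eqP.
(* Another root of rho would give a second point of the fiber of f, and a double
   root at xi would make the Jacobian matrix there of rank at most 1. *)
have nroot : ~ exists z, root q z.
  move=> [z /eqP qz].
  have rz : rho.[z] = 0 by rewrite eq hornerM qz mul0r.
  have pz i j : (spec eta (minor i j)).[z] = 0.
    have [l [q' [l0 e']]] := minor_rho i j.
    have := congr1 (fun p => p.[z]) e'; rewrite hornerZ hornerM rz mulr0 => /eqP.
    by rewrite mulf_eq0 (negPf l0) => /eqP.
  have z0 : pt 1 z != 0 by rewrite pt_neq0 ?oner_eq0.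
  have zx : (pt 1 z == x)%MS.
    apply: uniq => //; apply/eqmxP; apply: eqmx_trans (eqmxP yx).
    by apply: eqmx_sym; apply/eqmxP/par.
  have ezx : z = xi.
    move: zx; rewrite same_point2 // pt0 pt1 mul1r => /eqP E4.
    by rewrite /xi E4 mulfK.
  subst z; have /factor_theorem[q' eq'] : root q xi by apply/eqP.
  have dz i j : (spec eta (minor i j))^`().[xi] = 0.
    have [l [s [l0 e']]] := minor_rho i j.
    have := congr1 (fun p => p^`().[xi]) e'; rewrite derivZ hornerZ eq eq'.
    rewrite !derivM !(hornerXsubC, hornerM, hornerD) subrr !(mulr0, mul0r, addr0) => /eqP.
    by rewrite mulf_eq0 (negPf l0) => /eqP.
  have bx := bf x0.
  pose v : 'rV[K]_3 := \row_j ((f 0 j)^`M(1)).@[x' 0].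
  have [|s es] := @row_parallel K 3 v gy gy0.
    move=> i j; have := dz i j; rewrite spec_minor derivB !derivZ !hornerE => /eqP.
    rewrite subr_eq0 !mxE !meval_dehom !dehom_mderiv mulrC => /eqP ->.
    by rewrite mulrC.
  have [m em] : exists m, ev f x' = m *: gy.
    have [|m em] := @row_parallel K 3 (ev f x') gy gy0; last by exists m.
    move=> i j; have := parx i j; rewrite spec_minor !hornerE => /eqP.
    by rewrite subr_eq0 !evf !mxE mulrC => /eqP ->; rewrite mulrC.
  have rk1 : (\rank (jac f x') <= 1)%N.
    have sub1 : (jac f x' <= gy)%MS.
      apply/row_subP => i; case: (ord2_case i) => ->; last first.
        have -> : row 1 (jac f x') = v by apply/rowP=> j; rewrite !mxE.
        by rewrite es; apply: scalemx_sub.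
      have -> : row 0 (jac f x') = d%:R *: ev f x' - xi *: v.
        apply/rowP=> j; have := euler x' (hf j).
        rewrite /dirD !big_ord_recl big_ord0 addr0.
        have -> : lift ord0 ord0 = 1 :> 'I_2 by apply: val_inj.
        rewrite pt0 pt1 mulr1 !mxE => <-; rewrite mulrC addrK //.
      rewrite em es; apply: addmx_sub; first by do 2!apply: scalemx_sub.
      by rewrite -scaleNr; do 2!apply: scalemx_sub.
    by apply: leq_trans (mxrankS sub1) (rank_leq_row _).
  have jx : jac f x = x 0 0 ^+ d.-1 *: jac f x'.
    apply/matrixP=> i j; rewrite !mxE {1}ex.
    by rewrite (meval_scale _ _ (mderiv_homog i (hf j))).
  by move: rk1; rewrite -(eqmx_scale (jac f x') (expf_neq0 d.-1 xn)) -jx rk.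
have sq : size q = 1%N.
  apply/eqP; apply: contraT => sz; case: nroot.
  by apply/closed_rootP.
have [w w0 ew] : exists2 w, w != 0 & q = w%:P.
  exists q`_0; last by apply: size1_polyC; rewrite sq.
  have : lead_coef q != 0 by rewrite lead_coef_eq0 -size_poly_eq0 sq.
  by rewrite lead_coefE sq.
exists x', w; split=> //.
  apply/eqmxP; apply: eqmx_trans (eqmxP yx) _.
  have xx' : (x == x')%MS by apply/(same_pointP _ x0); exists (x 0 0).
  exact: (eqmxP (ev_same_point hf x0 xx')).
- rewrite pt0 mulr1 -[(r`_1).[eta]]/(horner_eval eta r`_1) -coef_map -/rho eq ew.
  by rewrite coefCM coefB coefX coefC subr0 mulr1.
- rewrite pt1 hornerN -[(r`_0).[eta]]/(horner_eval eta r`_0) -coef_map -/rho eq ew.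
  by rewrite coefCM coefB coefX coefC sub0r mulrN opprK.
Qed.

End Reparametrization.

Section LinearReparametrization.
Variable K : closedFieldType.
Local Notation S := {mpoly K[2]}.

Definition subst_row r (tau : 'rV[S]_2) (w : 'rV[S]_r) : 'rV[S]_r :=
  \row_i subst (tau 0) (w 0 i).

Lemma ev_subst_row r (tau : 'rV[S]_2) (w : 'rV[S]_r) x :
  ev (subst_row tau w) x = ev w (ev tau x).
Proof.
apply/rowP=> i; rewrite !evE mxE meval_subst; apply: meval_eq => j.
by rewrite mxE.
Qed.

Lemma subst_row_homog r m n (tau : 'rV[S]_2) (w : 'rV[S]_r) :
  form_row m tau -> form_row n w -> form_row (n * m) (subst_row tau w).
Proof. by move=> ht hw i; rewrite mxE; apply: subst_homog. Qed.

(** The rational preimage extends to a morphism theta of P^1, and f(theta) is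
    proportional to g at general points, hence everywhere; as f and g have the
    same degree, theta is linear. *)
Lemma reparametrization d (f g : 'rV[S]_3) :
  (0 < d)%N -> form_row d f -> form_row d g -> base_point_free f ->
  base_point_free g ->
  generic (fun x => forall y, y != 0 -> (ev f y == ev f x)%MS -> (y == x)%MS) ->
  generic (fun x => \rank (jac f x) = 2%N) ->
  (forall y, y != 0 -> exists2 x, x != 0 & (ev g y == ev f x)%MS) ->
  exists (N : 'M[K]_2) (e : K), [/\ N \in unitmx, e != 0 &
    forall x, ev f (x *m N) = e *: ev g x].
Proof.
move=> d0 hf hg bf bg inj imm sub.
have [t0 [t1 gen]] := rational_preimage d0 hf hg bf bg inj imm sub.
pose b := maxn (size t0) (size t1).
pose w : 'rV[S]_2 := \row_i (if i == 0 then homogenize b t0 else homogenize b t1).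
have hw : form_row b w by move=> i; rewrite mxE; case: ifP => _; apply: hom_homog.
have evw (y : 'rV[K]_2) : y 0 0 != 0 -> ev w y =
    y 0 0 ^+ b *: pt t0.[y 0 1 / y 0 0] t1.[y 0 1 / y 0 0].
  move=> yn; apply: row2P; rewrite evE {1}(affine_point yn) (meval_scale _ _ (hw _));
  rewrite !mxE /= meval_dehom dehom_hom //; rewrite /b; move: (size t0) (size t1) => *; lia.
have w0 : w != 0.
  have [y y0 [yn [x [c [x0 c0 _ e0 e1]]]]] := generic_ex gen.
  have : ev w y != 0.
    rewrite evw // e0 e1 scaler_eq0 negb_or expf_neq0 //=.
    by rewrite pt_neq0 // !mulf_eq0 (negPf c0) /=; case: (row2_neq0 x0) => ->; rewrite ?orbT.
  by apply: contraNneq => ->; rewrite ev0.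
have [e [E [th [hE E0 le hth [bth eth]]]]] := primitive_part hw w0.
set beta := (b - e)%N in hth.
pose ft := subst_row th f.
have hft : form_row (d * beta) ft by apply: subst_row_homog.
have bft : base_point_free ft.
  by move=> x x0; rewrite ev_subst_row; apply/bf/bth.
have parg : generic (fun y => (ev ft y == ev g y)%MS).
  apply: generic_impl gen => y y0 [yn [x [c [x0 c0 yx e0 e1]]]].
  have thx : (ev th y == x)%MS.
    have Ewy : E.@[y 0] *: ev th y = (y 0 0 ^+ b * c) *: x.
      rewrite -evZ -eth evw // e0 e1 -scalerA; congr (_ *: _).
      by apply: row2P; rewrite ?pt0 ?pt1 mxE.
    have Ey : E.@[y 0] != 0.
      apply: contraTneq x0 => Ey; have /esym/eqP := Ewy; rewrite Ey scale0r.
      by rewrite scaler_eq0 mulf_eq0 expf_eq0 (negPf yn) andbF (negPf c0) /= negbK.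
    apply/(same_pointP _ (bth y y0)); exists ((E.@[y 0])^-1 * (y 0 0 ^+ b * c)).
      by rewrite !mulf_neq0 ?invr_eq0 ?expf_neq0.
    by rewrite -[RHS]scalerA -Ewy scalerA mulVf // scale1r.
  rewrite ev_subst_row; apply/eqmxP.
  apply: eqmx_trans (eqmxP (ev_same_point hf (bth y y0) thx)) _.
  exact: eqmx_sym (eqmxP yx).
have [|F hF eF] := parallel_multiple hft hg bg.
  move=> i j; apply/eqP; rewrite -subr_eq0; apply/eqP.
  apply: (@form_eq0 _ (d * beta + d)).
    by apply: rpredB; apply: dhomogM.
  apply: generic_impl parg => y y0 /(same_pointP _ (bft y y0))[c c0 ec].
  by rewrite mevalB !mevalM -!evE ec !mxE; ring.
have nz : forall x : 'rV[K]_2, x != 0 -> F.@[x 0] != 0.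
  by apply: (@form_neq0_of_bpf _ _ F g); rewrite -eF.
have [dz [c c0 ec]] := form_no_zero hF nz.
have beta1 : beta = 1%N.
  have : beta != 0%N.
    apply/eqP => b0; have [i gi] := row_neq0 (bpf_neq0 bg).
    have n0 : c *: g 0 i != 0 by rewrite scaler_eq0 negb_or c0.
    have h1 : c *: g 0 i \is d.-homog by apply: rpredZ.
    have h2 : c *: g 0 i \is (d * beta).-homog.
      by have := hft i; rewrite eF mxE ec mul_mpolyC.
    by have := dhomog_uniq n0 h1 h2; rewrite b0 muln0 => dd; move: d0; rewrite dd.
  move/eqP: dz; rewrite subn_eq0 -{2}[d]muln1 leq_pmul2l //.
  by case: (beta) => [|[|]].
have [N uN eN] := linear_pair (form_row_cast beta1 hth) bth.
exists N, c; split=> // x; rewrite -eN -ev_subst_row -/ft eF evZ ec mevalC.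
by [].
Qed.

End LinearReparametrization.

(** * Curves on a scroll *)

Section CurveOnScroll.
Variables (K : closedFieldType) (d k h : nat).
Local Notation S := {mpoly K[2]}.
Variables (G1 : 'M[K]_(h.+1, k.+2)) (G2 : 'M[K]_((k - h).+1, k.+2)).
Variables (R1 : 'M[K]_(k.+2, h.+1)) (R2 : 'M[K]_(k.+2, (k - h).+1)).
Hypotheses (G1R1 : G1 *m R1 = 1%:M) (G1R2 : G1 *m R2 = 0).
Hypotheses (G2R1 : G2 *m R1 = 0) (G2R2 : G2 *m R2 = 1%:M).
Hypothesis (RG : R1 *m G1 + R2 *m G2 = 1%:M).
Local Notation spt u v x := (spoint G1 G2 (idr K) u v (x 0 0) (x 0 1)).
Local Notation mpC := (@mpolyC 2 K).
Variable phi : 'rV[S]_k.+2.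
Hypothesis Hphi : @rational_param K k.+1 d phi.
Hypothesis on : forall p, @curve K k.+1 phi p -> scroll G1 G2 p.
Hypothesis kh0 : (0 < k - h)%N.

Let hphi : form_row d phi. Proof. by case: Hphi. Qed.
Let bphi : base_point_free phi. Proof. by case: Hphi. Qed.

Lemma curve_ev x : x != 0 -> @curve K k.+1 phi (ev phi x).
Proof.
by move=> x0; split; [exact: bphi|exists x => //; apply/eqmxP].
Qed.

Lemma in_fiber x : x != 0 -> exists (y : 'rV[K]_2) u v, y != 0 /\ ev phi x = spt u v y.
Proof.
move=> x0; have [y y0 /fiberP[_ [u [v e]]]] := on (curve_ev x0).
by exists y, u, v.
Qed.

Lemma ev_lows x : ev (lows R1 R2 mpC phi) x = lows R1 R2 (idr K) (ev phi x).
Proof. by rewrite !lowsE ev_mul map_mx_idfun. Qed.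
Lemma ev_highs x : ev (highs R1 R2 mpC phi) x = highs R1 R2 (idr K) (ev phi x).
Proof. by rewrite !highsE ev_mul map_mx_idfun. Qed.

(** The fiber through phi(x) depends rationally on x: it is given by any pair
    of consecutive coordinates. *)
Lemma fiber_map : exists r (tau : 'rV[S]_2) B C, [/\ form_row r tau,
  base_point_free tau, B \is (d - h * r).-homog, C \is (d - (k - h) * r).-homog &
  phi = spoint G1 G2 mpC B C (tau 0 0) (tau 0 1) /\ (C != 0 -> ((k - h) * r <= d)%N)].
Proof.
set lo := lows R1 R2 mpC phi; set hi := highs R1 R2 mpC phi.
have hlo : form_row d lo by rewrite /lo lowsE; apply: form_row_mul.
have hhi : form_row d hi by rewrite /hi highsE; apply: form_row_mul.
have par i j : lo 0 i * hi 0 j = lo 0 j * hi 0 i.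
  apply: (@form_eq _ (d + d)); try by apply: dhomogM.
  move=> x x0; rewrite !mevalM -!evE ev_lows ev_highs.
  have [y [u [v [y0 ->]]]] := in_fiber x0.
  rewrite (lows_spoint G1R1 G1R2 G2R1 G2R2) (highs_spoint G1R1 G1R2 G2R1 G2R2) !mxE.
  ring.
(* Otherwise all points of the curve would be the vertex. *)
have [i ni] : exists i, (lo 0 i != 0) || (hi 0 i != 0).
  apply: NNPP => no.
  have lo0 : lo = 0.
    apply/rowP=> i; rewrite [RHS]mxE; apply/eqP; apply: contraT => n0.
    by case: no; exists i; rewrite n0.
  have hi0 : hi = 0.
    apply/rowP=> i; rewrite [RHS]mxE; apply/eqP; apply: contraT => n0.
    by case: no; exists i; rewrite n0 orbT.
  have [x x0 nx] := rational_param_nonconstant (vertex G1) Hphi.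
  have [y [u [v [y0 e]]]] := in_fiber x0.
  have q0 : ratios k h u v (y 0 0) (y 0 1) = 0.
    apply/eqP; apply: contraT => n0.
    have := ev_lows x; have := ev_highs x; rewrite -/lo -/hi lo0 hi0 !ev0 e.
    rewrite (lows_spoint G1R1 G1R2 G2R1 G2R2) (highs_spoint G1R1 G1R2 G2R1 G2R2).
    move=> /esym/eqP; rewrite scaler_eq0 (negPf n0) orbF => /eqP y1.
    move=> /esym/eqP; rewrite scaler_eq0 (negPf n0) orbF => /eqP y00.
    by case/eqP: y0; apply: row2P; rewrite mxE.
  have v0 : v = 0.
    apply/eqP; apply: contraT => v0.
    by have := ratio_neq0 y0 (_ : (0 < h)%N && (u != 0) || (0 < k - h)%N && (v != 0));
      rewrite q0 eqxx kh0 v0 orbT => /(_ isT).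
  have [h0|hp] := posnP h.
    case/negP: nx; rewrite e v0 /spoint scale0r addr0 (vrow_vertex _ _ _ _ h0).
    by rewrite map_mx_idfun; apply: scalemx_sub.
  have u0 : u = 0.
    apply/eqP; apply: contraT => u0.
    by have := ratio_neq0 y0 (_ : (0 < h)%N && (u != 0) || (0 < k - h)%N && (v != 0));
      rewrite q0 eqxx hp u0 => /(_ isT).
  by have := bphi x0; rewrite e u0 v0 sptE !scale0r addr0 eqxx.
pose w : 'rV[S]_2 := \row_j (if j == 0 then lo 0 i else hi 0 i).
have hw : form_row d w by move=> j; rewrite mxE; case: ifP.
have w0 : w != 0.
  apply: contraTneq ni => /rowP w0; have := w0 0; have := w0 1.
  by rewrite !mxE /= => -> ->; rewrite eqxx.
have [e [E [tau [hE E0 le htau [btau ew]]]]] := primitive_part hw w0.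
have loi : lo 0 i = E * tau 0 0 by have /rowP/(_ 0) := ew; rewrite !mxE.
have hii : hi 0 i = E * tau 0 1 by have /rowP/(_ 1) := ew; rewrite !mxE.
have par2 j : lo 0 j * tau 0 1 = hi 0 j * tau 0 0.
  apply: (mulfI E0); have := par i j; rewrite loi hii => p.
  by rewrite mulrCA -p; ring.
pose r := (d - e)%N.
have fib x : x != 0 -> exists u v, ev phi x = spt u v (ev tau x).
  move=> x0; apply: (deviation_eq0 G1R1 G1R2 G2R1 G2R2 RG (btau x x0)).
  rewrite /deviation -ev_lows -ev_highs; apply/eqP; rewrite subr_eq0; apply/eqP.
  apply/rowP=> j; rewrite [LHS]mxE [RHS]mxE !evE.
  have /(congr1 (meval (x 0))) := par2 j; rewrite !mevalM => p.
  by rewrite mulrC -p mulrC.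
have coord m (R : 'M[K]_(k.+2, m.+1)) :
    (forall x, x != 0 -> exists u, ev phi x *m R = u *: veronese m (ev tau x)) ->
    exists2 B, B \is (d - m * r).-homog & phi *m map_mx mpC R = B *: vrow m (tau 0 0) (tau 0 1)
      /\ (B != 0 -> (m * r <= d)%N).
  move=> val; have hv : form_row (m * r) (vrow m (tau 0 0) (tau 0 1)).
    move=> l; rewrite mxE; have := dhomogM (dhomogMn (m - l) (htau 0)) (dhomogMn l (htau 1)).
    by apply: homog_cast; rewrite -/r -mulnDr mulnC subnK // -ltnS.
  have evv x : ev (vrow m (tau 0 0) (tau 0 1)) x = veronese m (ev tau x).
    by apply/rowP=> l; rewrite !mxE rmorphM !rmorphXn.
  have bv : base_point_free (vrow m (tau 0 0) (tau 0 1)).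
    by move=> x x0; rewrite evv; apply/veronese_neq0/btau.
  have hR : form_row d (phi *m map_mx mpC R) by apply: form_row_mul.
  have [|B hB eB] := parallel_multiple hR hv bv.
    move=> l l'; apply: (@form_eq _ (d + m * r)); try by apply: dhomogM.
    move=> x x0; rewrite !mevalM -!evE ev_mul evv.
    by have [u ->] := val x x0; rewrite !mxE; ring.
  exists B => //; split=> // B0; apply: (multiple_degree hB hv); rewrite -eB //.
  rewrite eB; apply/eqP => z; case/eqP: B0; exact: (scale_row_eq0 (bpf_neq0 bv) z).
have [|B hB [eB _]] := coord h R1.
  move=> x x0; have [u [v ->]] := fib x x0; exists u.
  by rewrite -{1}(map_mx_idfun R1) (spoint_R1 G1R1 G2R1).
have [|C hC [eC leC]] := coord (k - h)%N R2.
  move=> x x0; have [u [v ->]] := fib x x0; exists v.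
  by rewrite -{1}(map_mx_idfun R2) (spoint_R2 G1R2 G2R2).
exists r, tau, B, C; split=> //; split=> //.
apply: (coords_inj RG (f := mpC)); first by rewrite spoint_R1.
by rewrite spoint_R2.
Qed.

End CurveOnScroll.

Section FiberDegree.
Variables (K : closedFieldType) (d k h : nat).
Hypothesis charK0 : [pchar K] =i pred0.
Local Notation S := {mpoly K[2]}.
Variables (G1 : 'M[K]_(h.+1, k.+2)) (G2 : 'M[K]_((k - h).+1, k.+2)).
Variables (R1 : 'M[K]_(k.+2, h.+1)) (R2 : 'M[K]_(k.+2, (k - h).+1)).
Hypotheses (G1R1 : G1 *m R1 = 1%:M) (G1R2 : G1 *m R2 = 0).
Hypotheses (G2R1 : G2 *m R1 = 0) (G2R2 : G2 *m R2 = 1%:M).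
Local Notation spt u v x := (spoint G1 G2 (idr K) u v (x 0 0) (x 0 1)).
Local Notation mpC := (@mpolyC 2 K).

(** In characteristic 0 a nonconstant map of P^1 is not ramified everywhere: by
    Euler's identity both rows of partial derivatives of tau would be parallel to
    tau, hence zero for degree reasons, and tau itself would be zero. *)
Lemma jacobian_neq0 r (tau : 'rV[S]_2) : (0 < r)%N -> form_row r tau ->
  base_point_free tau ->
  (tau 0 0)^`M(0) * (tau 0 1)^`M(1) - (tau 0 1)^`M(0) * (tau 0 0)^`M(1) != 0.
Proof.
move=> r0 ht bt; apply/eqP => J.
have rn : r%:R != 0 :> K by move/pcharf0P: charK0 => ->; rewrite -lt0n.
have eul (x : 'rV[K]_2) j : x 0 0 * ((tau 0 j)^`M(0)).@[x 0]
    + x 0 1 * ((tau 0 j)^`M(1)).@[x 0] = r%:R * (tau 0 j).@[x 0].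
  rewrite -(euler x (ht j)) /dirD !big_ord_recl big_ord0 addr0.
  have -> : lift ord0 ord0 = 1 :> 'I_2 by apply: val_inj.
  by rewrite ![x 0 _ * _]mulrC.
have Jx (x : 'rV[K]_2) : ((tau 0 0)^`M(0)).@[x 0] * ((tau 0 1)^`M(1)).@[x 0] =
    ((tau 0 1)^`M(0)).@[x 0] * ((tau 0 0)^`M(1)).@[x 0].
  have /(congr1 (meval (x 0))) := J; rewrite mevalB !mevalM meval0 => /eqP.
  by rewrite subr_eq0 => /eqP.
have dz (i : 'I_2) : \row_j (tau 0 j)^`M(i) = 0.
  set w := \row_j _; have hw : form_row r.-1 w.
    by move=> j; rewrite mxE; apply: mderiv_homog.
  have pw (x : 'rV[K]_2) : (w 0 0).@[x 0] * (tau 0 1).@[x 0] =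
      (w 0 1).@[x 0] * (tau 0 0).@[x 0].
    apply: (mulfI rn); rewrite mulrCA -eul [RHS]mulrCA -eul !mxE.
    have := Jx x; case: (ord2_case i) => ->;
    move: ((tau 0 0)^`M(0)).@[x 0] ((tau 0 1)^`M(1)).@[x 0];
    move: ((tau 0 1)^`M(0)).@[x 0] ((tau 0 0)^`M(1)).@[x 0] => a b c e E;
    apply/eqP; rewrite -subr_eq0; apply/eqP.
      by transitivity (x 0 1 * (c * e - a * b)); [ring | rewrite E subrr mulr0].
    by transitivity (x 0 0 * (a * b - c * e)); [ring | rewrite E subrr mulr0].
  have [|E hE eE] := parallel_multiple hw ht bt.
    have e01 : w 0 0 * tau 0 1 = w 0 1 * tau 0 0.
      apply: (@form_eq _ (r.-1 + r)); try by apply: dhomogM.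
      by move=> x _; rewrite !mevalM pw.
    by move=> l j; case: (ord2_case l) => ->; case: (ord2_case j) => ->; rewrite ?e01.
  apply/eqP; apply: contraT => w0.
  have := multiple_degree hE ht; rewrite -eE => /(_ hw w0).
  by move: r0; clear; lia.
have d0 (i j : 'I_2) : (tau 0 j)^`M(i) = 0.
  by have /rowP/(_ j) := dz i; rewrite !mxE.
have [x x0] := point_exists K; case/eqP: (bt x x0).
apply/rowP=> j; rewrite evE [RHS]mxE; apply: (mulfI rn).
by rewrite -eul !d0 !meval0 !mulr0 addr0.
Qed.

Lemma veronese_scale m c (x : 'rV[K]_2) : veronese m (c *: x) = c ^+ m *: veronese m x.
Proof.
apply/rowP=> i; rewrite !mxE !exprMn mulrACA -exprD subnK //.
by rewrite -ltnS.
Qed.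

Lemma fiber_same_point (x y : 'rV[K]_2) p : x != 0 -> (x == y)%MS ->
  fiber G1 G2 x p -> fiber G1 G2 y p.
Proof.
move=> x0 /(same_pointP _ x0)[c c0 ->] /fiberP[p0 [u [v e]]].
apply/fiberP; split=> //; exists (u * c ^+ h), (v * c ^+ (k - h)).
rewrite e !sptE !veronese_scale -!scalemxAl !scalerA //.
Qed.

Variables (phi : 'rV[S]_k.+2) (r : nat) (tau : 'rV[S]_2) (B C : S).
Hypothesis Hphi : @rational_param K k.+1 d phi.
Hypotheses (htau : form_row r tau) (btau : base_point_free tau).
Hypothesis ephi : phi = spoint G1 G2 mpC B C (tau 0 0) (tau 0 1).
Hypothesis kh0 : (0 < k - h)%N.
Local Notation D := (@curve K k.+1 phi).

Let hphi : form_row d phi. Proof. by case: Hphi. Qed.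
Let bphi : base_point_free phi. Proof. by case: Hphi. Qed.

Lemma ev_phi_tau x : ev phi x = spt B.@[x 0] C.@[x 0] (ev tau x).
Proof. by rewrite ephi ev_spoint !evE. Qed.

Lemma fiber_tau x : x != 0 -> fiber G1 G2 (ev tau x) (ev phi x).
Proof.
move=> x0; apply/fiberP; split; first exact: bphi.
by exists B.@[x 0], C.@[x 0]; rewrite ev_phi_tau.
Qed.

(** A general fiber meets the curve in deg tau distinct points. *)
Lemma unisecant_degree : (0 < h)%N -> unisecant G1 G2 D -> r = 1%N.
Proof.
move=> h0 [Z HZ]; have [_ _ inj _] := Hphi.
(* If tau is constant, the curve lies in a fiber and misses the others. *)
have [r0|rp] := posnP r.
  have [x x0] := point_exists K; pose t := ev tau x.
  have tauE y : y != 0 -> ev tau y = t.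
    move=> y0; apply/rowP=> j; rewrite !evE.
    have := htau j; rewrite r0 => /form_const[c ->]; rewrite !mevalC //.
  have gen : generic (fun y : 'rV[K]_2 => exists2 p : 'rV[K]_k.+2, D p & fiber G1 G2 y p).
    exists Z => y y0 H; have [p p0 pH] := HZ y y0 H.
    by have [_ /(_ (conj p0 (introT (@eqmxP _ _ _ _ _ _) (@eqmx_refl _ _ _ p))))[Dp fp _]] := pH p; exists p.
  have gt : generic (fun y : 'rV[K]_2 => ~~ (y == t)%MS).
    by exists [:: t] => y y0; apply; rewrite mem_head.
  have [y y0 [[p [p0 [z z0 /(same_pointP _ p0)[a a0 ep]]] fp] nt]] := generic_ex (generic_and gen gt).
  case/negP: nt; have [_ [u [v e]]] := (fiberP G1 G2 y p).1 fp.
  have t0 : t != 0 by apply: btau.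
  have tz := tauE z z0.
  have ep' : p = spt (a * B.@[z 0]) (a * C.@[z 0]) t.
    by rewrite ep ev_phi_tau tz !sptE scalerDr !scalerA.
  have uv : (0 < h)%N && (u != 0) || (0 < k - h)%N && (v != 0).
    rewrite h0 kh0 /= -negb_and; apply: contra p0 => /andP[/eqP u0 /eqP v0].
    by rewrite e u0 v0 sptE !scale0r addr0.
  exact: (fiber_uniq G1R1 G1R2 G2R1 G2R2 y0 t0 uv (etrans (esym e) ep')).
apply/eqP; rewrite eqn_leq rp andbT leqNgt; apply/negP => r2.
have J := jacobian_neq0 rp htau btau.
have hJ : (tau 0 0)^`M(0) * (tau 0 1)^`M(1) - (tau 0 1)^`M(0) * (tau 0 0)^`M(1)
    \is (r.-1 + r.-1).-homog.
  by apply: rpredB; apply: dhomogM; apply: mderiv_homog.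
have gZ : generic (fun y => forall z, z \in [seq z <- Z | z != 0] -> ~~ (ev tau y == z)%MS).
  apply: generic_all => z; rewrite mem_filter => /andP[z0 _].
  exact: (finite_fiber rp htau btau z0).
have [y y0 [iy [Jy nZ]]] := generic_ex (generic_and inj (generic_and (generic_form hJ J) gZ)).
pose x := ev tau y; have x0 : x != 0 by apply: btau.
have [|p p0 Hp] := HZ x x0.
  move=> z zZ; apply/negP => xz.
  have z0 : z != 0.
    have [c c0 e] := same_pointP z x0 xz.
    by apply: contraNneq x0 => z0; rewrite e z0 scaler0.
  by have := nZ z; rewrite mem_filter z0 zZ => /(_ isT)/negP; apply.
(* The zeros of P are the points of the curve on the fiber over x, hence y is the
   only one; but y is simple since the Jacobian does not vanish there. *)
pose P := x 0 1 *: tau 0 0 - x 0 0 *: tau 0 1.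
have hP : P \is r.-homog by apply: rpredB; apply: rpredZ.
have Pz (z : 'rV[K]_2) : P.@[z 0] = x 0 1 * (ev tau z) 0 0 - x 0 0 * (ev tau z) 0 1.
  by rewrite mevalB !mevalZ !evE.
have Py : P.@[y 0] = 0 by rewrite Pz mulrC subrr.
have [P' hP' eP] := form_factor hP y0 Py.
have rp' : (0 < r.-1)%N by move: r2; clear; lia.
have [y' y'0 Py'] := form_root rp' hP'.
have tx : (ev tau y' == x)%MS.
  rewrite same_point2 //; last exact: btau.
  have : P.@[y' 0] = 0 by rewrite eP mevalM Py' mulr0.
  rewrite Pz => /eqP; rewrite subr_eq0 => /eqP e.
  by apply/eqP; rewrite mulrC e mulrC.
have on z : z != 0 -> (ev tau z == x)%MS -> (ev phi z == p)%MS.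
  move=> z0 zx; have bz := bphi z0.
  suff H3 : [/\ D (ev phi z), fiber G1 G2 x (ev phi z)
      & ~ (h = 0%N /\ (ev phi z == vertex G1)%MS)] by have [] := (Hp _).1 H3.
  split.
  - by split=> //; exists z => //; apply/eqmxP.
  - exact: (fiber_same_point (btau z0) zx (fiber_tau z0)).
  - by case=> e; rewrite e in h0.
have yy : (y' == y)%MS.
  apply: iy => //; apply/eqmxP; apply: eqmx_trans (eqmxP (on y' y'0 tx)) _.
  by apply: eqmx_sym; apply/eqmxP/on => //; apply/eqmxP.
have P'y : P'.@[y 0] = 0.
  have [c c0 e] := same_pointP y y'0 yy.
  have := Py'; rewrite e (meval_scale _ _ hP') => /eqP.
  by rewrite mulf_eq0 expf_eq0 (negPf c0) andbF => /eqP.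
have dP i : x 0 1 * ((tau 0 0)^`M(i)).@[y 0] = x 0 0 * ((tau 0 1)^`M(i)).@[y 0].
  have /(congr1 (fun P : S => P^`M(i).@[y 0])) := eP.
  rewrite mderivM mevalD !mevalM P'y mulr0 add0r.
  have -> : (line_form y).@[y 0] = 0 by rewrite meval_line_form mulrC subrr.
  rewrite mul0r mderivB !mderivZ mevalB !mevalZ => /eqP.
  by rewrite subr_eq0 => /eqP.
move: Jy; rewrite mevalB !mevalM; have := dP 0; have := dP 1.
move: ((tau 0 0)^`M(0)).@[y 0] ((tau 0 1)^`M(1)).@[y 0].
move: ((tau 0 1)^`M(0)).@[y 0] ((tau 0 0)^`M(1)).@[y 0] => a b c e E1 E0 /eqP; apply.
case: (row2_neq0 x0) => xn; apply: (mulfI xn); rewrite mulr0.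
  transitivity (c * (x 0 0 * e) - (x 0 0 * a) * b); first by ring.
  by rewrite -E1 -E0; ring.
transitivity ((x 0 1 * c) * e - a * (x 0 1 * b)); first by ring.
by rewrite E1 E0; ring.
Qed.

(** On a cone the multiplicity of the vertex is d - k deg tau. *)
Lemma cone_degree : h = 0%N -> (0 < k)%N -> (k <= d)%N ->
  C \is (d - (k - h) * r).-homog -> (C != 0 -> ((k - h) * r <= d)%N) ->
  mult_at phi (vertex G1) (d - k) -> r = 1%N.
Proof.
move=> h0 k0 kd hC leC mult; set V := vertex G1.
pose gam : 'rV[S]_k.+2 := vrow (k - h) (tau 0 0) (tau 0 1) *m map_mx mpC G2.
have cphi : phi = B *: constant_row V + C *: gam.
  by rewrite ephi /spoint; congr (_ *: _ + _); apply: vrow_vertex.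
have VR2 : V *m R2 = 0 by rewrite /V /vertex rowE -mulmxA G1R2 mulmx0.
have C0 : C != 0.
  have [x x0] := rational_param_nonconstant V Hphi.
  apply: contraNneq => C0; rewrite cphi C0 scale0r addr0 evZ ev_constant.
  exact: scalemx_sub.
have hg : form_row ((k - h) * r) gam.
  apply: form_row_mul => l; rewrite mxE.
  have := dhomogM (dhomogMn (k - h - l) (htau 0)) (dhomogMn l (htau 1)).
  by apply: homog_cast; rewrite -mulnDr mulnC subnK // -ltnS.
have gV x : x != 0 -> ~~ (ev gam x <= V)%MS.
  move=> x0; apply/negP => /sub_rVP[a e]; have := congr1 (mulmx^~ R2) e.
  rewrite /= /gam ev_mul -mulmxA G2R2 mulmx1 -scalemxAl VR2 scaler0.
  have -> : ev (vrow (k - h) (tau 0 0) (tau 0 1)) x = veronese (k - h) (ev tau x).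
    by apply/rowP=> l; rewrite !mxE rmorphM !rmorphXn.
  by apply/eqP/veronese_neq0/btau.
have := mult_at_uniq mult (multiplicity_over cphi hC hg bphi gV C0).
have {}leC := leC C0; have ekh : (k - h = k)%N by rewrite h0 subn0.
rewrite ekh in leC *; move=> e.
have : (k * r = k * 1)%N by move: leC e kd; clear; lia.
by move/eqP; rewrite eqn_pmul2l // => /eqP.
Qed.

End FiberDegree.

(** * From curves on scrolls to syzygies *)

Section Converse.
Variables (K : closedFieldType) (d k : nat).
Hypothesis charK0 : [pchar K] =i pred0.
Local Notation S := {mpoly K[2]}.
Local Notation mpC := (@mpolyC 2 K).
Variable f : 'rV[S]_3.
Hypotheses (Hf : @rational_param K 2 d f) (k0 : (0 < k)%N) (k2d : (2 * k <= d)%N).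

(** The fibers project to lines, since the center of projection is disjoint from
    them. Hence the projections of the two directrices, seen in the parameter of
    C, are moving points b and c with b x c without zeros, and f is a combination
    of them. The parameters are matched using that D is unisecant and that C
    determines its parametrization. *)
Lemma directrices_of_model h (G1 : 'M[K]_(h.+1, k.+2)) (G2 : 'M[K]_((k - h).+1, k.+2))
    (phi : 'rV[S]_k.+2) (Q : 'M[K]_(k.-1, k.+2)) (M : 'M[K]_(k.+2, 3)) :
  on_scroll d f G1 G2 phi Q M -> smooth_case G1 G2 phi \/ cone_case d G1 phi ->
  unisecant G1 G2 (@curve K k.+1 phi) /\
  exists b c B C, [/\ form_row h b, form_row (k - h) c, base_point_free (cross b c),
    C \is (d - (k - h)).-homog /\ f = B *: b + C *: c &
    h = 0%N -> exists p, b = constant_row p].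
Proof.
move=> [h2k fr Hphi on [fQ eQ disj _ proj]] cases.
have hk : (h <= k)%N by move: h2k; clear; lia.
have kh0 : (0 < k - h)%N by move: h2k k0; clear; lia.
have [R1 [R2 [G1R1 G1R2 G2R1 G2R2 RG]]] := dual_frame hk fr.
have [hphi bphi injphi _] := Hphi; have [hf bf inj imm] := Hf.
have [r [tau [B [C [htau btau hB hC [ephi leC]]]]]] :=
  fiber_map G1R1 G1R2 G2R1 G2R2 RG Hphi on kh0.
have r1 : r = 1%N.
  case: cases => [[hp _ _ uni]|[h0 mult _ _]].
    exact: (unisecant_degree charK0 G1R1 G1R2 G2R1 G2R2 Hphi htau btau ephi kh0 hp uni).
  apply: (cone_degree G1R2 G2R2 Hphi htau btau ephi h0 k0 _ hC leC mult).
  by move: k2d; clear; lia.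
subst r; rewrite muln1 in hB; rewrite muln1 in hC.
have [T uT eT] := linear_pair htau btau.
have center p : scroll G1 G2 p -> p *m M != 0.
  move=> Sp; apply: contra (disj p Sp) => /eqP pM.
  by rewrite -(eqmxP eQ); apply/sub_kermxP.
have C0 : C != 0.
  apply/eqP => C0.
  have nB : base_point_free (B *: (vrow h (tau 0 0) (tau 0 1) *m map_mx mpC G1)).
    by move: bphi; rewrite ephi C0 /spoint scale0r addr0.
  have [] := form_no_zero hB (form_neq0_of_bpf nB).
  by move: h2k k2d k0; clear; lia.
pose TI := invmx T.
have uTI : TI \in unitmx by rewrite unitmx_inv.
split.
  (* With tau as parameter the curve is in normal form. *)
  pose phi' := spoint G1 G2 mpC (linsub TI B) (linsub TI C) 'X_0 'X_1.
  have evphi' x : ev phi' x = ev phi (x *m TI).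
    have exT : x = ev tau (x *m TI) by rewrite eT mulmxKV.
    rewrite /phi' ev_spoint !meval_linsub !mevalXU ephi ev_spoint.
    by rewrite -(evE tau _ 0) -(evE tau _ 1) -exT.
  have bphi' : base_point_free phi'.
    by move=> x x0; rewrite evphi'; apply/bphi/unit_point.
  have C'0 : linsub TI C != 0.
    apply/eqP => e; have [x x0 Cx] := generic_ex (generic_form hC C0).
    have := meval_linsub TI C (x *m T); rewrite e meval0 mulmxK // => /esym/eqP.
    by rewrite (negPf Cx).
  have uni := curve_unisecant G1R1 G1R2 G2R1 G2R2 (erefl phi') (linsub_homog TI hB)
    (linsub_homog TI hC) h2k k0 k2d bphi' C'0.
  have same p : @curve K k.+1 phi' p <-> @curve K k.+1 phi p.
    split=> -[p0 [x x0 e]]; split=> //.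
      by exists (x *m TI); [exact: unit_point|rewrite -evphi'].
    exists (x *m T); first exact: unit_point.
    by rewrite evphi' mulmxK.
  apply: generic_impl uni => x x0 [p p0 Hp]; exists p => // q.
  by rewrite -Hp; split=> -[D1 D2 D3]; split=> //; apply/same.
pose g := phi *m map_mx mpC M.
have hg : form_row d g by apply: form_row_mul.
have evg x : ev g x = ev phi x *m M by rewrite ev_mul.
have onphi x : x != 0 -> @curve K k.+1 phi (ev phi x).
  by move=> x0; split; [exact: bphi|exists x => //; apply/eqmxP].
have bg : base_point_free g.
  by move=> x x0; rewrite evg; apply/center/on/onphi.
have sub y : y != 0 -> exists2 x, x != 0 & (ev g y == ev f x)%MS.
  move=> y0; have [|_ [x x0 e]] := (proj (ev g y)).2; last by exists x.
  split; first exact: bg.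
  by exists (ev phi y); [exact: onphi|rewrite evg; apply/eqmxP].
have d0 : (0 < d)%N by move: k0 k2d; clear; lia.
have [N [e [uN e0 eN]]] := reparametrization d0 hf hg bf bg inj imm sub.
pose NI := invmx N; have uNI : NI \in unitmx by rewrite unitmx_inv.
have evf z : ev f z = e *: (ev phi (z *m NI) *m M).
  by rewrite -evg -eN mulmxKV.
pose W := NI *m T; have uW : W \in unitmx by rewrite unitmx_mul uNI.
pose s j := linear_form (col j W) : S.
have hs j : s j \is 1.-homog by apply: linear_form_homog.
have evs j (z : 'rV[K]_2) : (s j).@[z 0] = (z *m W) 0 j.
  by rewrite meval_linear_form colE mulmxA -colE mxE.
pose b := vrow h (s 0) (s 1) *m map_mx mpC (G1 *m M).
pose c := vrow (k - h) (s 0) (s 1) *m map_mx mpC (G2 *m M).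
have hb : form_row h b by apply/form_row_mul/vrow_homog.
have hc : form_row (k - h) c by apply/form_row_mul/vrow_homog.
have evv m z : ev (vrow m (s 0) (s 1)) z = veronese m (z *m W).
  by apply/rowP=> l; rewrite evE !mxE rmorphM !rmorphXn /= !evs !mxE.
have evb z : ev b z = veronese h (z *m W) *m G1 *m M by rewrite ev_mul evv mulmxA.
have evc z : ev c z = veronese (k - h) (z *m W) *m G2 *m M by rewrite ev_mul evv mulmxA.
have comb u v z : u *: ev b z + v *: ev c z =
    spoint G1 G2 (idr K) u v ((z *m W) 0 0) ((z *m W) 0 1) *m M.
  by rewrite sptE mulmxDl -!scalemxAl evb evc.
have ind u v z : z != 0 -> u *: ev b z + v *: ev c z = 0 -> u = 0 /\ v = 0.
  move=> z0 E; have zW : z *m W != 0 by apply: unit_point.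
  have [uv|uv] := boolP ((u != 0) || (v != 0)); last first.
    by move: uv; rewrite negb_or !negbK => /andP[/eqP-> /eqP->].
  have := center _ (scroll_spt G1R1 G1R2 G2R1 G2R2 zW uv).
  by rewrite -comb E eqxx.
exists b, c, (e *: linsub NI B), (e *: linsub NI C); split=> //.
- move=> z z0; rewrite ev_cross; apply: cross_point_neq0.
    apply/eqP => b0; have [|/eqP + _] := ind 1 0 z z0; last by rewrite oner_eq0.
    by rewrite b0 scaler0 scale0r addr0.
  apply/negP => /sub_rVP[a E].
  have [|_ /eqP] := ind (- a) 1 z z0; last by rewrite oner_eq0.
  by rewrite E scale1r scaleNr addNr.
- split; first by apply/rpredZ/linsub_homog.
  have hB' : e *: linsub NI B \is (d - h).-homog by apply/rpredZ/linsub_homog.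
  have hC' : e *: linsub NI C \is (d - (k - h)).-homog by apply/rpredZ/linsub_homog.
  apply: (form_row_eq hf).
    apply: form_rowD.
      apply: form_row_cast (form_rowZ hB' hb); move: h2k k2d; clear; lia.
    apply: form_row_cast (form_rowZ hC' hc); move: h2k k2d; clear; lia.
  move=> z z0; rewrite evD !evZ !mevalZ !meval_linsub comb evf ephi ev_spoint.
  rewrite -(evE tau _ 0) -(evE tau _ 1) eT -(mulmxA z) -/W !sptE scalemxAl scalerDr !scalerA.
  by [].
- move=> h0; exists (row 0 G1 *m M).
  by rewrite /b (vrow_vertex _ _ _ _ h0) row_mul.
Qed.

Section Consequences.
Variables (h : nat) (b c : 'rV[S]_3) (B C : S).
Hypotheses (h2k : (2 * h <= k)%N) (hb : form_row h b) (hc : form_row (k - h) c).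
Hypotheses (bbc : base_point_free (cross b c)) (hC : C \is (d - (k - h)).-homog).
Hypothesis ef : f = B *: b + C *: c.

Let hf : form_row d f. Proof. by case: Hf. Qed.
Let bf : base_point_free f. Proof. by case: Hf. Qed.
Let al := cross b c.

Lemma moving_line_syzygy : form_row k al /\ dot al f = 0.
Proof.
split.
  by apply: form_row_cast (form_row_cross hb hc); move: h2k; clear; lia.
by rewrite ef dotDr !dotZr !(dotC al) dot_crossl dot_crossr !mulr0 addr0.
Qed.

Lemma moving_line_min : min_syzygy_degree h al.
Proof. by apply: (min_syzygy_degree_cross _ hb hc bbc); move: h2k; clear; lia. Qed.

Lemma splitting_of_directrices : splitting_type f k (d - k).
Proof.
have [hal alf] := moving_line_syzygy.
have [a ha ea] := complementary_syzygy hf bf hal bbc alf k2d.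
have baa : base_point_free (cross al a) by rewrite ea.
by have := splitting_type_cross hal ha baa; rewrite ea.
Qed.

(** For 2k < d the syzygies of degree k are unique up to a constant. *)
Lemma minimal_syzygies_min alpha : (2 * k < d)%N -> alpha != 0 ->
  syzygy k alpha f -> min_syzygy_degree h alpha.
Proof.
move=> kd al0 /syzygyP[halpha alphaf]; have [hal alf] := moving_line_syzygy.
have [a ha ea] := complementary_syzygy hf bf hal bbc alf k2d.
have baa : base_point_free (cross al a) by rewrite ea.
have : dot alpha (cross al a) = 0 by rewrite ea.
move=> /(homog_syzygy_decomposition hal ha baa halpha)[x [y [hx _ e _ y0]]].
have {}y0 : y = 0 by apply: y0; move: kd; clear; lia.
have [w ew] := form_const (homog_cast (subnn k) hx).
move: e al0; rewrite y0 scale0r addr0 ew => -> wal.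
apply: min_syzygy_degree_scale; last exact: moving_line_min.
by apply: contraNneq wal => ->; rewrite mpolyC0 scale0r.
Qed.

Lemma cone_case_ascenzi : h = 0%N -> (exists p, b = constant_row p) -> ascenzi d f.
Proof.
move=> h0 [p ep].
have bb := bpf_crossl bbc; have [x0 x00] := point_exists K.
have p0 : p != 0 by have := bb x0 x00; rewrite ep ev_constant.
have edk : (d - (k - h) = d - k)%N by rewrite h0 subn0.
have C0 : C != 0.
  apply/eqP => C0; have := bf; rewrite ef C0 scale0r addr0.
  have [x x0' nx] := rational_param_nonconstant p Hf.
  case/negP: nx; rewrite ef C0 scale0r addr0 evZ ep ev_constant.
  exact: scalemx_sub.
apply: (cone_ascenzi (c := d - (k - h)) (e := k - h) (B := B) (C := C) (gam := c) (p := p)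
  bf _ _ _ hC C0 hc p0).
- by rewrite edk; move: k0 k2d; clear; lia.
- by rewrite edk; move: k0 k2d; clear; lia.
- by rewrite -ep.
move=> x xn; apply/negP => /sub_rVP[a E]; have := bbc xn.
rewrite ev_cross ep ev_constant E crossZr crossvv scaler0 eqxx //.
Qed.

(** For d > 2k + 1 an Ascenzi curve has a syzygy of degree k which itself has a
    constant syzygy. *)
Lemma smooth_case_not_ascenzi : (0 < h)%N -> ((2 * k).+1 < d)%N -> ~ ascenzi d f.
Proof.
move=> h0 kd asc.
have [|alpha [al0 sal [w0 w]]] := ascenzi_syzygy hf bf Hf k2d splitting_of_directrices asc.
  by move=> e; rewrite e ltnn in kd.
have kd' : (2 * k < d)%N by move: kd; clear; lia.
have [_ minh] := minimal_syzygies_min kd' al0 sal.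
have [A A0 sA] := w0; have := minh _ _ A0 sA.
by rewrite leqNgt h0.
Qed.

End Consequences.
End Converse.

Theorem theorem3p1 (K : closedFieldType) (charK0 : [pchar K] =i pred0)
  (d k : nat) (f : 'rV[{mpoly K[2]}]_3)
  (Hf : @rational_param K 2 d f) (Hk : (2 <= 2 * k <= d)%N) :
  (* For d = 2k+1, "C is not Ascenzi" is dropped from (i): a general rational
     quintic (k = 2, h = 1) is Ascenzi because it has double points. *)
  (splitting_type f k (d - k) <->
    exists (h : nat) (G1 : 'M[K]_(h.+1, k.+2)) (G2 : 'M[K]_((k - h).+1, k.+2))
           (phi : 'rV[{mpoly K[2]}]_k.+2)
           (Q : 'M[K]_(k.-1, k.+2)) (M : 'M[K]_(k.+2, 3)),
      on_scroll d f G1 G2 phi Q M /\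
      ((smooth_case G1 G2 phi /\ (d <> (2 * k).+1 -> ~ ascenzi d f)) \/
       (cone_case d G1 phi /\ ascenzi d f))) /\
  (* Every such D and S_{h,k-h}. For d = 2k the syzygies of degree k form a
     pencil, whose members alpha may have different h. *)
  (forall (h : nat) (G1 : 'M[K]_(h.+1, k.+2)) (G2 : 'M[K]_((k - h).+1, k.+2))
          (phi : 'rV[{mpoly K[2]}]_k.+2)
          (Q : 'M[K]_(k.-1, k.+2)) (M : 'M[K]_(k.+2, 3)),
      on_scroll d f G1 G2 phi Q M ->
      smooth_case G1 G2 phi \/ cone_case d G1 phi ->
      [/\ splitting_type f k (d - k),
          unisecant G1 G2 (@curve K k.+1 phi),
          (0 < h)%N -> ((2 * k).+1 < d)%N -> ~ ascenzi d f,
          h = 0%N -> ascenzi d f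
        & (exists alpha : 'rV[{mpoly K[2]}]_3, [/\ alpha != 0, syzygy k alpha f
                           & min_syzygy_degree h alpha]) /\
          ((2 * k < d)%N -> forall alpha : 'rV[{mpoly K[2]}]_3, alpha != 0 -> syzygy k alpha f ->
             min_syzygy_degree h alpha)]) /\
  (* Every nonzero syzygy alpha of minimal degree k arises in this way. *)
  (splitting_type f k (d - k) ->
    forall (alpha : 'rV[{mpoly K[2]}]_3) (h : nat),
      alpha != 0 -> syzygy k alpha f -> min_syzygy_degree h alpha ->
      exists (G1 : 'M[K]_(h.+1, k.+2)) (G2 : 'M[K]_((k - h).+1, k.+2))
             (phi : 'rV[{mpoly K[2]}]_k.+2)
             (Q : 'M[K]_(k.-1, k.+2)) (M : 'M[K]_(k.+2, 3)),
        on_scroll d f G1 G2 phi Q M /\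
        (smooth_case G1 G2 phi \/ cone_case d G1 phi)).
Proof.
have [k0 k2d] : (0 < k)%N /\ (2 * k <= d)%N by move: Hk; clear; lia.
have [hf bf _ _] := Hf.
have given h (G1 : 'M[K]_(h.+1, k.+2)) (G2 : 'M[K]_((k - h).+1, k.+2)) phi Q M :
    on_scroll d f G1 G2 phi Q M -> smooth_case G1 G2 phi \/ cone_case d G1 phi ->
  [/\ splitting_type f k (d - k), unisecant G1 G2 (@curve K k.+1 phi),
      (0 < h)%N -> ((2 * k).+1 < d)%N -> ~ ascenzi d f, h = 0%N -> ascenzi d f
    & (exists alpha : 'rV[{mpoly K[2]}]_3,
         [/\ alpha != 0, syzygy k alpha f & min_syzygy_degree h alpha]) /\
      ((2 * k < d)%N -> forall alpha : 'rV[{mpoly K[2]}]_3, alpha != 0 ->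
         syzygy k alpha f -> min_syzygy_degree h alpha)].
  move=> model cases; have [h2k _ _ _ _] := model.
  have [uni [b [c [B [C [hb hc bbc [hC ef] vert]]]]]] :=
    directrices_of_model charK0 Hf k0 k2d model cases.
  split=> //.
  - exact: (splitting_of_directrices Hf k2d h2k hb hc bbc ef).
  - exact: (smooth_case_not_ascenzi Hf k2d h2k hb hc bbc ef).
  - by move=> h0; apply: (cone_case_ascenzi Hf k0 k2d hc bbc hC ef h0 (vert h0)).
  split.
    exists (cross b c); split; first exact: bpf_neq0.
      exact/syzygyP/(moving_line_syzygy h2k hb hc ef).
    exact: (moving_line_min h2k hb hc bbc).
  by move=> kd alpha; exact: (minimal_syzygies_min Hf k2d h2k hb hc bbc ef).
split; last split=> //; last first.
  by move=> split_f alpha h; exact: (model_of_syzygy Hf k0 k2d split_f).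
split=> [split_f|[h [G1 [G2 [phi [Q [M [model cases]]]]]]]]; last first.
  have [|split_f _ _ _ _] := given _ _ _ _ _ _ model; last exact: split_f.
  by case: cases => -[]; [left|right].
have [[alpha [al0 sal minal]]|noconst] := classic (exists alpha : 'rV[{mpoly K[2]}]_3,
  [/\ alpha != 0, syzygy k alpha f & min_syzygy_degree 0 alpha]).
  have [G1 [G2 [phi [Q [M [model cases]]]]]] :=
    model_of_syzygy Hf k0 k2d split_f al0 sal minal.
  exists 0%N, G1, G2, phi, Q, M; split=> //; right.
  have [_ _ _ asc _] := given _ _ _ _ _ _ model cases.
  by case: cases => [[]//|cone]; split=> //; apply: asc.
have kdk : (k <= d - k)%N by move: k2d; clear; lia.
have [[alpha al0 sal] _] := splitting_type_min kdk split_f.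
have /syzygyP[hal _] := sal; have [h minal] := min_syzygy_degree_ex hal.
have [G1 [G2 [phi [Q [M [model cases]]]]]] :=
  model_of_syzygy Hf k0 k2d split_f al0 sal minal.
exists h, G1, G2, phi, Q, M; split=> //; left.
case: cases => [smooth|[h0 _ _ _]].
  split=> // odd_d asc; apply: noconst.
  exact: (ascenzi_syzygy hf bf Hf k2d split_f asc odd_d).
by case: noconst; exists alpha; rewrite h0 in minal.
Qed.
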